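(* Let $\mathcal{H}_r(\mathbb{T}^d)$ be the reproducing kernel Hilbert space associated with a weight function $r_d\colon\mathbb{Z}^d\to(0,\infty)$ satisfying $\sum_{\boldsymbol{h}\in\mathbb{Z}^d}r_d(\boldsymbol{h})^{-1}<\infty$. In addition, assume that $I^n\subset[-n+1,n-1]^d$ holds for all $n\in\mathbb{N}$, where $I^n\subset\mathbb{Z}^d$ is a set of $n-1$ frequencies with smallest weights, i.e. $|I^n|=n-1$ and $r_d(\boldsymbol{k})\le r_d(\boldsymbol{h})$ for all $\boldsymbol{k}\in I^n$ and all $\boldsymbol{h}\in\mathbb{Z}^d\setminus I^n$. Then $$a_{M}(\mathcal{H}_r(\mathbb{T}^d),L_\infty(\mathbb{T}^d))\le g_{M}(\mathcal{H}_r(\mathbb{T}^d),L_\infty(\mathbb{T}^d))\lesssim\frac{a_{M/\log M}(\operatorname{I}_d\colon\mathcal{H}_r(\mathbb{T}^d)\to L_\infty(\mathbb{T}^d))}{(\ln M)^{-1}},$$ where $a_n$ denotes the approximation numbers of the identity operator $\operatorname{I}_d\colon\mathcal{H}_r(\mathbb{T}^d)\to L_\infty(\mathbb{T}^d)$ and $g_M$ denotes the sampling numbers.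
   Context: $\mathbb{T}\sim[0,1)$ is the torus, and $c_{\boldsymbol{h}}(f)=\int_{\mathbb{T}^d}f(\boldsymbol{x})\mathrm{e}^{-2\pi\mathrm{i}\boldsymbol{h}\cdot\boldsymbol{x}}\,\mathrm{d}\boldsymbol{x}$ are the Fourier coefficients of $f$. The space $\mathcal{H}_r(\mathbb{T}^d)$ consists of all (continuous periodic) functions $f\in L_1(\mathbb{T}^d)$ with $\|f|\mathcal{H}_r(\mathbb{T}^d)\|=\left(\sum_{\boldsymbol{h}\in\mathbb{Z}^d}r_d(\boldsymbol{h})|c_{\boldsymbol{h}}(f)|^2\right)^{1/2}<\infty$. Its inner product is $\langle f,g\rangle_d=\sum_{\boldsymbol{h}\in\mathbb{Z}^d}c_{\boldsymbol{h}}(f)\overline{c_{\boldsymbol{h}}(g)}r_d(\boldsymbol{h})$ and its reproducing kernel is $K_d(\boldsymbol{x},\boldsymbol{y})=\sum_{\boldsymbol{h}\in\mathbb{Z}^d}\mathrm{e}^{2\pi\mathrm{i}\boldsymbol{h}\cdot(\boldsymbol{x}-\boldsymbol{y})}/r_d(\boldsymbol{h})$; the summability of $r_d^{-1}$ guarantees that the kernel is continuous. For a bounded linear operator $\operatorname{T}\colon X\to Y$ between Banach spaces, the approximation numbers are $a_n(\operatorname{T})=\inf\{\|\operatorname{T}-\operatorname{A}\|\colon\operatorname{rank}\operatorname{A}<n\}$, i.e. the optimal error of approximating $\operatorname{T}$ by operators of rank less than $n$. Here $\operatorname{I}_d$ is the identity (embedding) operator from $\mathcal{H}_r(\mathbb{T}^d)$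 to $L_\infty(\mathbb{T}^d)$, and $a_M(\mathcal{H}_r(\mathbb{T}^d),L_\infty(\mathbb{T}^d))$ is short for $a_M(\operatorname{I}_d\colon\mathcal{H}_r(\mathbb{T}^d)\to L_\infty(\mathbb{T}^d))$. The sampling numbers are $$g_M(\mathcal{H}_r(\mathbb{T}^d),L_\infty(\mathbb{T}^d))=\inf_{\mathcal{X},\,|\mathcal{X}|\le M}\ \inf_{\operatorname{A}\colon\mathbb{C}^{|\mathcal{X}|}\to L_\infty(\mathbb{T}^d)}\ \sup_{\|f|\mathcal{H}_r(\mathbb{T}^d)\|\le1}\left\|f-\operatorname{A}\left(\{f(\boldsymbol{x})\}_{\boldsymbol{x}\in\mathcal{X}}\right)|L_\infty(\mathbb{T}^d)\right\|,$$ where $\mathcal{X}\subset\mathbb{T}^d$ is a set of sampling nodes; this is the best possible worst case error over the unit ball of $\mathcal{H}_r(\mathbb{T}^d)$ using not more than $M$ sampling values. The sets $I^n$ are not necessarily uniquely defined. The symbol $\lesssim$ means inequality up to a multiplicative constant.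
   Formalization: The first inequality is proved as a_{M+1} ≤ g_M: with rank < n in a_n and at most M nodes in g_M, the printed a_M ≤ g_M fails (weights near 1 on M consecutive frequencies, huge elsewhere). The upper bound is for M ≥ 2, where ln M > 0. *)

(* Defs.v *)
From HB Require Import structures.
From mathcomp Require Import all_boot all_order all_algebra finmap.
From mathcomp Require Import complex.
From mathcomp Require Import all_classical all_reals all_analysis.

Set Implicit Arguments.
Unset Strict Implicit.
Unset Printing Implicit Defensive.

Import Order.TTheory GRing.Theory Num.Theory.
Import numFieldNormedType.Exports.

Local Open Scope classical_set_scope.
Local Open Scope ring_scope.
Local Open Scope complex_scope.

Section cube_measure.
Context {R : realType}.
Local Open Scope ereal_scope.

Section step.
Context (n : nat) (P : probability (n.-tuple R) R).

Definition cube_step : set (n.+1.-tuple R) -> \bar R :=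
  pushforward (uniform_prob (@ltr01 R) \x P)%E
    (fun p : R * n.-tuple R => [the n.+1.-tuple R of p.1 :: p.2]).

Let mcons : measurable_fun [set: R * n.-tuple R]
  (fun p : R * n.-tuple R => [the n.+1.-tuple R of p.1 :: p.2]).
Proof. exact: measurable_cons. Qed.

Let cube_step0 : cube_step set0 = 0.
Proof. by rewrite /cube_step /pushforward preimage_set0 measure0. Qed.

Let cube_step_ge0 A : 0 <= cube_step A.
Proof. exact: measure_ge0. Qed.

Let cube_step_sigma_additive : semi_sigma_additive cube_step.
Proof.
move=> F mF tF mUF; rewrite /cube_step /pushforward preimage_bigcup.
apply: measure_semi_sigma_additive.
- by move=> k; rewrite -[X in measurable X]setTI; exact: mcons.
- apply/trivIsetP => /= i j _ _ ij; rewrite -preimage_setI.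
  by move/trivIsetP : tF => /(_ _ _ _ _ ij) ->//; rewrite preimage_set0.
- by rewrite -preimage_bigcup -[X in measurable X]setTI; exact: mcons.
Qed.

HB.instance Definition _ := isMeasure.Build _ _ _ cube_step
  cube_step0 cube_step_ge0 cube_step_sigma_additive.

Let cube_step_setT : cube_step setT = 1.
Proof.
rewrite /cube_step /pushforward preimage_setT -setXTT.
rewrite [LHS]product_measure1E// -[RHS]mule1; congr (_ * _).
  exact: (probability_setT (uniform_prob (@ltr01 R))).
exact: (probability_setT P).
Qed.

HB.instance Definition _ :=
  Measure_isProbability.Build _ _ _ cube_step cube_step_setT.

Definition cube_step_prob : probability (n.+1.-tuple R) R := cube_step.

End step.

(* Lebesgue measure on the unit cube [0,1]^n, regarded as a measure on R^n. *)
Fixpoint cube n : probability (n.-tuple R) R :=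
  match n with
  | 0 => \d_([tuple] : 0.-tuple R)
  | m.+1 => cube_step_prob (cube m)
  end.

End cube_measure.

Section spaces.
Context {R : realType} {d : nat}.

(* A function on T^d is a function on R^d; elements of H_r are 1-periodic, and
   elements of L_oo matter only through their values on the unit cube. *)
Local Notation point := (d.-tuple R).
Local Notation freq := (d.-tuple int).
Local Notation func := (point -> R[i]).

Definition torus : set point := [set x | forall i, 0 <= tnth x i < 1].

Definition dot (h : freq) (x : point) : R :=
  \sum_(i < d) (tnth h i)%:~R * tnth x i.

Definition expc (t : R) : R[i] := cos (2 * pi * t) +i* sin (2 * pi * t).

Definition cintegral (f : func) : R[i] :=
  (\int[cube d]_x complex.Re (f x)) +i* (\int[cube d]_x complex.Im (f x)).

Definition fourier (f : func) (h : freq) : R[i] :=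
  cintegral (fun x => f x * expc (- dot h x)).

Definition periodic (f : func) : Prop :=
  forall (x : point) (k : freq), f [tuple tnth x i + (tnth k i)%:~R | i < d] = f x.

(* 'rV[R]_d carries the library's topology of R^d. *)
Definition continuousC (f : func) : Prop :=
  continuous (fun v : 'rV[R]_d => complex.Re (f [tuple v ord0 i | i < d])) /\
  continuous (fun v : 'rV[R]_d => complex.Im (f [tuple v ord0 i | i < d])).

Definition measurableC (f : func) : Prop :=
  measurable_fun [set: point] (fun x => complex.Re (f x)) /\
  measurable_fun [set: point] (fun x => complex.Im (f x)).

Local Open Scope ereal_scope.

Section weight.
Variable r : freq -> R.

Definition Hnorm (f : func) : \bar R :=
  (\esum_(h in [set: freq]) (r h * Normc.normc (fourier f h) ^+ 2)%R%:E) `^ 2^-1.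

Definition Hspace : set func :=
  [set f | [/\ periodic f, continuousC f & Hnorm f < +oo]].

Definition Hball : set func := [set f | Hspace f /\ Hnorm f <= 1].

Definition Linf_norm (g : func) : \bar R :=
  Lnorm (cube d) +oo (fun x => (Normc.normc (g x))%:E).

Definition Linf : set func := [set g | measurableC g /\ Linf_norm g < +oo].

(* Operators from H_r to L_oo are represented by maps on functions that are
   relevant on Hspace only; identities in L_oo hold almost everywhere. *)
Definition bounded_linear (A : func -> func) : Prop :=
  [/\ forall f, Hspace f -> Linf (A f),
      forall (a : R[i]) f g, Hspace f -> Hspace g ->
        \forall x \ae cube d,
          A (fun y => a * f y + g y)%R x = (a * A f x + A g x)%R
    & exists K : R, forall f, Hspace f -> Linf_norm (A f) <= K%:E * Hnorm f].

(* The range has dimension at most m for some natural number m < t. *)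
Definition rank_lt (A : func -> func) (t : R) : Prop :=
  exists (m : nat) (g : 'I_m -> func),
    [/\ (m%:R < t)%R,
        forall j, Linf (g j)
      & forall f, Hspace f -> exists c : 'I_m -> R[i],
          \forall x \ae cube d, A f x = (\sum_(j < m) c j * g j x)%R].

Definition op_norm (A : func -> func) : \bar R :=
  ereal_sup [set Linf_norm (A f) | f in Hball].

(* The index is real so that a_(M / log M) makes sense without rounding; for a
   natural number t this is the usual approximation number. *)
Definition approx_number (T : func -> func) (t : R) : \bar R :=
  ereal_inf [set op_norm (fun f x => (T f x - A f x)%R) |
             A in [set A | bounded_linear A /\ rank_lt A t]].

Definition embedding : func -> func := fun f => f.

(* The reconstruction map A is arbitrary, not necessarily linear. *)
Definition worst_case_error (X : {fset point})
    (A : {ffun X -> R[i]} -> func) : \bar R :=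
  ereal_sup [set Linf_norm (fun x => (f x - A [ffun y : X => f (val y)] x)%R) |
             f in Hball].

(* A reconstruction from M samples may have rank M, whereas a_n involves rank
   less than n only: sampling_number M is comparable with a_(M + 1). *)
Definition sampling_number (M : nat) : \bar R :=
  ereal_inf [set ereal_inf [set worst_case_error A |
               A in [set A : {ffun X -> R[i]} -> func | forall y, Linf (A y)]] |
             X in [set X : {fset point} |
               (#|` X| <= M)%N /\ forall x, x \in X -> torus x]].

Definition smallest_weights (n : nat) (J : set freq) : Prop :=
  (J #= `I_n.-1)%card /\ forall k h, J k -> ~ J h -> (r k <= r h)%R.

End weight.

End spaces.

(* Main.v *)
(* Write tau_m for the square root of the sum of 1/r over the frequencies outside I^(m+1), the m
   frequencies of smallest weight.

   First inequality: for nodes X, let P be the projection of H_r onto the span of the kernel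
   functions K_x, x in X. It has rank at most |X|, uses only the values of f on X, and g = f - P f
   lies in the unit ball and vanishes on X. A reconstruction cannot distinguish g from -g, so its
   error is at least the norm of g.

   Second inequality, lower bound tau_m <= a_n for n <= m + 1: if A has rank at most m and E = id - A
   has norm at most B, then for finite F the sum over h in F of |E chi_h (x)|^2 / r(h) is at most B^2
   for almost every x. So the vectors v(x) = (chi_h(x) / sqrt r(h))_h stay within B of a fixed subspace of
   dimension at most m; projecting onto its orthogonal complement and integrating over x gives the
   bound.

   Second inequality, upper bound g_M <= 26 tau_m for 1 <= m and 2m <= M: let D_k be the largest Gram
   determinant of v at k points. By Cauchy-Binet, Hadamard's inequality and averaging over a grid, D_k
   is comparable with the k-th elementary symmetric function of the 1/r(h), so D_(k+1) <= 64 tau_m^2 D_k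
   for some m <= k < 2m. At a nearly optimal k-point configuration, the squared distance of any v(x) to
   the span of the v(x_i) is a quotient of consecutive Gram determinants, and the squared least-squares
   weights are bounded by quotients of k-point ones. Hence a function of the unit ball that vanishes at these points is O(tau_m).

   With m the integer part of M / ln M one has 2m <= M as soon as ln M >= 2; the remaining M are
   finitely many and only affect the constant. *)
Require Import Defs.
From mathcomp Require Import all_boot all_order all_algebra finmap.
From mathcomp Require Import complex.
From mathcomp Require Import all_classical all_reals all_analysis.
From mathcomp Require Import perm spectral measurable_realfun ess_sup_inf.
From mathcomp Require Import ring lra.

Set Implicit Arguments.
Unset Strict Implicit.
Unset Printing Implicit Defensive.

Import Order.TTheory GRing.Theory Num.Theory.
Import numFieldNormedType.Exports.

(** * Gram determinants and good nodes *)

(** The comparison of D_k with the elementary symmetric functions loses a factor k^k / k!, which is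
    exponential in k, so a single quotient D_(k+1) / D_k cannot be read off from it. Over the m
    steps from D_m to D_(2m) the loss is only a constant per step, and some step must do at least as
    well as their geometric mean. This is why k ranges over [m, 2m) and why twice as many nodes as
    frequencies are taken.

    Two obstacles shape the rest. Determinants require finitely many frequencies, so a finite list
    with a negligible tail is fixed in advance, and a small tail of coefficients has to be turned
    into a small error at every point. For continuous periodic functions this follows by testing
    against powers of a trigonometric bump. On the other side, operators into L_oo are linear only
    almost everywhere, with an exceptional set that depends on the functions involved; the pointwise
    bound is therefore tested on countably many coefficient vectors only. *)

Section GramDeterminants.
Local Open Scope ring_scope.
Local Open Scope sesquilinear_scope.

(** Summing over all maps instead of k-subsets counts every subset k! times, while non-injective
    maps contribute 0. Each permutation in the expansion of the first determinant yields, after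
    precomposing f with its inverse, one full copy of the determinant of the product. *)
Lemma cauchy_binet_ffun (K : comNzRingType) k n (V : 'M[K]_(k, n)) (W : 'M[K]_(n, k)) :
  \sum_(f : {ffun 'I_k -> 'I_n}) \det (colsub f V) * \det (rowsub f W) =
  k`!%:R * \det (V *m W).
Proof.
have -> : \det (V *m W) =
    \sum_(f : {ffun 'I_k -> 'I_n}) (\prod_i V i (f i)) * \det (rowsub f W).
  rewrite {1}/determinant.
  under eq_bigr => s _.
    under eq_bigr do rewrite mxE.
    rewrite bigA_distr_bigA mulr_sumr.
    over.
  rewrite exchange_big /=; apply: eq_bigr => f _.
  rewrite /determinant mulr_sumr; apply: eq_bigr => s _.
  rewrite big_split /= mulrCA; congr (_ * (_ * _)).
  by apply: eq_bigr => i _; rewrite mxE.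
under eq_bigr => f _ do rewrite {1}/determinant mulr_suml.
rewrite exchange_big /= -card_Sn mulr_natl -cardsT -sumr_const.
rewrite [RHS](eq_bigl xpredT) => [|s]; last by rewrite inE.
apply: eq_bigr => s _.
pose h (g : {ffun 'I_k -> 'I_n}) : {ffun 'I_k -> 'I_n} := [ffun i => g ((s^-1)%g i)].
pose h' (g : {ffun 'I_k -> 'I_n}) : {ffun 'I_k -> 'I_n} := [ffun i => g (s i)].
have hK : cancel h h' by move=> g; apply/ffunP => i; rewrite !ffunE permK.
have h'K : cancel h' h by move=> g; apply/ffunP => i; rewrite !ffunE permKV.
rewrite (reindex h) /=; last by exists h' => g _; [exact: hK|exact: h'K].
apply: eq_bigr => g _.
have -> : rowsub (h g) W = row_perm (s^-1)%g (rowsub g W).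
  by apply/matrixP => i j; rewrite !mxE ffunE.
rewrite row_permE det_mulmx det_perm odd_permV.
rewrite mulrCA mulrA mulrA [(-1) ^+ s * (-1) ^+ s]mulrC -signr_addb addbb mul1r.
congr (_ * _); apply: eq_bigr => i _.
by rewrite mxE ffunE permK.
Qed.

Variable C : numClosedFieldType.

Definition gram k n (V : 'M[C]_(k, n)) : C := \det (V *m V ^t*).

Lemma det_trmxC k (A : 'M[C]_k) : \det (A ^t*) = (\det A)^*.
Proof. by rewrite det_map_mx det_tr. Qed.

Lemma gram_sum k n (V : 'M[C]_(k, n)) :
  k`!%:R * gram V = \sum_(f : {ffun 'I_k -> 'I_n}) `|\det (colsub f V)| ^+ 2.
Proof.
rewrite /gram -cauchy_binet_ffun; apply: eq_bigr => f _.
by rewrite normCK; congr (_ * _); rewrite -det_trmxC; congr (\det _);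
  apply/matrixP => i j; rewrite !mxE.
Qed.

Lemma gram_ge0 k n (V : 'M[C]_(k, n)) : 0 <= gram V.
Proof.
have : 0 <= k`!%:R * gram V by rewrite gram_sum sumr_ge0// => f _; rewrite exprn_ge0.
by rewrite pmulr_rge0// ltr0n fact_gt0.
Qed.

Lemma mulmx_trC_diag_ge0 k n (V : 'M[C]_(k, n)) i : 0 <= (V *m V ^t*) i i.
Proof. by rewrite mxE sumr_ge0// => j _; rewrite !mxE mul_conjC_ge0. Qed.

(** The eigenvalues of W times its conjugate transpose are nonnegative, with product |det W|^2 and
    sum equal to the trace k * k; the inequality of arithmetic and geometric means concludes. *)
Lemma hadamard_unimodular k (W : 'M[C]_k) :
  (forall i j, `|W i j| = 1) -> `|\det W| ^+ 2 <= k%:R ^+ k.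
Proof.
move=> W1; pose A := W *m W ^t*.
have An : A \is normalmx.
  by apply/normalmxP; rewrite /A trmx_mul map_mxM trmxCK.
have /orthomx_spectralP := An; set P := spectralmx A; set D := spectral_diag A.
have Pu : P \is unitarymx by exact: spectral_unitarymx.
have Pun : P \in unitmx := unitarymx_unit Pu.
move=> AE.
have DE : diag_mx D = P *m A *m P ^t*.
  by rewrite -(invmx_unitary Pu) AE !mulmxA mulmxV// mul1mx -mulmxA mulmxV// mulmx1.
have D0 i : 0 <= D 0 i.
  have -> : D 0 i = diag_mx D i i by rewrite mxE eqxx.
  by rewrite DE /A mulmxA -mulmxA -map_mxM -trmx_mul mulmx_trC_diag_ge0.
have detA : \det A = \prod_i D 0 i.
  by rewrite AE !det_mulmx det_diag mulrAC -det_mulmx mulVmx// det1 mul1r.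
have trA : \tr A = \sum_i D 0 i by rewrite AE mxtrace_mulC mulmxA mulmxV// mul1mx mxtrace_diag.
have -> : `|\det W| ^+ 2 = \det A by rewrite normCK det_mulmx det_trmxC.
rewrite detA.
have := (leif_AGM (A := predT) (fun i _ => D0 i)).1.
rewrite cardT size_enum_ord => /le_trans; apply.
rewrite -trA.
have -> : \tr A = k%:R * k%:R.
  rewrite /mxtrace.
  under eq_bigr => i _.
    rewrite mxE; under eq_bigr do rewrite !mxE -normCK W1 expr1n.
    rewrite sumr_const card_ord.
    over.
  by rewrite sumr_const card_ord mulr_natr.
by case: k {P D Pu Pun DE AE D0 detA trA W W1 A An} => [|k]; rewrite ?expr0// mulfK.
Qed.

Lemma det_colsub_scale k n (V X : 'M[C]_(k, n)) (a : 'I_n -> C) (f : 'I_k -> 'I_n) :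
  (forall i j, V i j = a j * X i j) ->
  `|\det (colsub f V)| ^+ 2 = `|\det (colsub f X)| ^+ 2 * \prod_i `|a (f i)| ^+ 2.
Proof.
move=> VX.
have -> : colsub f V = colsub f X *m diag_mx (\row_i a (f i)).
  by apply/matrixP => i j; rewrite mul_mx_diag !mxE VX mulrC.
rewrite det_mulmx det_diag normrM exprMn normr_prod -prodrXl.
by congr (_ * _); apply: eq_bigr => i _; rewrite mxE.
Qed.

Lemma det_colsub_ninj k n (V : 'M[C]_(k, n)) (f : {ffun 'I_k -> 'I_n}) :
  ~~ injectiveb f -> \det (colsub f V) = 0.
Proof.
move/injectivePn => [i [j ij fij]]; rewrite -det_tr.
by apply: (determinant_alternate ij) => l; rewrite !mxE fij.
Qed.

(** This is k! times the k-th elementary symmetric polynomial of L. *)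
Definition injsum k n (L : 'I_n -> C) : C :=
  \sum_(f : {ffun 'I_k -> 'I_n} | injectiveb f) \prod_i L (f i).

Lemma injsum_ge0 k n (L : 'I_n -> C) : (forall j, 0 <= L j) -> 0 <= injsum k L.
Proof. by move=> L0; apply: sumr_ge0 => f _; apply: prodr_ge0. Qed.

(** In the Cauchy-Binet sum the minors with repeated columns vanish, and Hadamard bounds the
    unimodular part of each remaining one. *)
Lemma gram_le_injsum k n (V X : 'M[C]_(k, n)) (a : 'I_n -> C) :
  (forall i j, V i j = a j * X i j) -> (forall i j, `|X i j| = 1) ->
  k`!%:R * gram V <= k%:R ^+ k * injsum k (fun j => `|a j| ^+ 2).
Proof.
move=> VX X1; rewrite gram_sum mulr_sumr.
rewrite (bigID (fun f : {ffun 'I_k -> 'I_n} => injectiveb f)) /= [X in _ + X]big1 ?addr0.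
  apply: ler_sum => f _; rewrite (det_colsub_scale _ VX) ler_wpM2r//.
    by apply: prodr_ge0 => i _; rewrite exprn_ge0.
  by apply: hadamard_unimodular => i j; rewrite mxE X1.
by move=> f fni; rewrite det_colsub_ninj// normr0 expr0n.
Qed.

(** After expanding both determinants the sum over Y factors over the rows. Two distinct
    permutations differ in some row, whose factor is 0 by orthogonality, so only the k! diagonal
    pairs survive, each contributing |Q|^k. *)
Lemma sum_sqr_det (Q : finType) k n (X : Q -> 'I_n -> C) (f : {ffun 'I_k -> 'I_n}) :
  (forall j j', \sum_q X q j * (X q j')^* = #|Q|%:R * (j == j')%:R) ->
  injective f ->
  \sum_(Y : {ffun 'I_k -> Q}) `|\det (\matrix_(i, j) X (Y i) (f j))| ^+ 2 =
  #|Q|%:R ^+ k * k`!%:R.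
Proof.
move=> Xo fi.
under eq_bigr => Y _.
  rewrite normCK /determinant rmorph_sum big_distrlr /=.
  under eq_bigr => s _.
    under eq_bigr => t _.
      rewrite rmorphM /= rmorphXn rmorphN1 mulrACA rmorph_prod -big_split /=.
      under eq_bigr do rewrite !mxE.
      over.
    over.
  over.
rewrite exchange_big /=.
transitivity (\sum_(s : 'S_k) #|Q|%:R ^+ k : C); last first.
  by rewrite sumr_const mulr_natr -card_Sn; congr (_ *+ _); apply: eq_card.
apply: eq_bigr => s _; rewrite exchange_big /= (bigD1 s)//=.
rewrite [X in _ + X]big1 ?addr0.
  rewrite -mulr_sumr -signr_addb addbb mul1r.
  rewrite -(bigA_distr_bigA (fun i q => X q (f (s i)) * (X q (f (s i)))^*)) /=.
  under eq_bigr do rewrite Xo eqxx mulr1.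
  by rewrite prodr_const card_ord.
move=> t ts; rewrite -mulr_sumr.
rewrite -(bigA_distr_bigA (fun i q => X q (f (s i)) * (X q (f (t i)))^*)) /=.
have [i it] : exists i, s i != t i.
  apply/existsP; rewrite -negb_forall; apply: contra ts => /forallP st.
  by apply/eqP/permP => i; apply/esym/eqP.
by rewrite (bigD1 i)//= Xo (inj_eq fi) (negPf it) mulr0 mul0r mulr0.
Qed.

(** Averaging: by Cauchy-Binet and [sum_sqr_det], the mean of the Gram determinants over all
    k-tuples of nodes is at least [injsum], so they cannot all lie below it. *)
Lemma exists_gram_ge_injsum (Q : finType) k n (X : Q -> 'I_n -> C) (a : 'I_n -> C) :
  (0 < #|Q|)%N ->
  (forall j j', \sum_q X q j * (X q j')^* = #|Q|%:R * (j == j')%:R) ->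
  exists Y : {ffun 'I_k -> Q},
    injsum k (fun j => `|a j| ^+ 2) <= gram (\matrix_(i, j) (a j * X (Y i) j)).
Proof.
move=> Q0 Xo; apply: contrapT => /forallNP noY.
set s := injsum _ _ in noY.
have s0 : 0 <= s by apply: injsum_ge0 => j; rewrite exprn_ge0.
have lt (Y : {ffun 'I_k -> Q}) : gram (\matrix_(i, j) (a j * X (Y i) j)) < s.
  by rewrite real_ltNge ?ger0_real ?gram_ge0//; apply/negP; exact: (noY Y).
suff : #|Q|%:R ^+ k * s <= \sum_(Y : {ffun 'I_k -> Q}) gram (\matrix_(i, j) (a j * X (Y i) j)).
  have S0 : 0 <= \sum_(Y : {ffun 'I_k -> Q}) gram (\matrix_(i, j) (a j * X (Y i) j)).
    by apply: sumr_ge0 => Y _; exact: gram_ge0.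
  have Qs : 0 <= #|Q|%:R ^+ k * s by rewrite mulr_ge0// exprn_ge0.
  apply/negP; rewrite -real_ltNge ?(ger0_real Qs) ?(ger0_real S0)//.
  have -> : #|Q|%:R ^+ k * s = \sum_(Y : {ffun 'I_k -> Q}) s.
    rewrite -natrX mulr_natl sumr_const; congr (_ *+ _).
    by rewrite -[k in LHS]card_ord -card_ffun; exact: eq_card.
  have [q _] : exists q, q \in Q by apply/card_gt0P.
  apply: ltr_sum => [|Y _]; last exact: lt.
  by apply/hasP; exists [ffun=> q]; rewrite ?mem_index_enum.
have k0 : 0 < k`!%:R :> C by rewrite ltr0n fact_gt0.
rewrite -(ler_pM2l k0) [leRHS]mulr_sumr.
under [leRHS]eq_bigr do rewrite gram_sum.
rewrite [leRHS]exchange_big /= mulrA mulr_sumr.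
rewrite [leRHS](bigID (fun f : {ffun 'I_k -> 'I_n} => injectiveb f)) /=.
rewrite -[leLHS]addr0 lerD//; last by do 2!apply: sumr_ge0 => ? _; rewrite exprn_ge0.
apply: ler_sum => f /injectiveP fi.
rewrite [k`!%:R * _]mulrC -(sum_sqr_det Xo fi) mulr_suml.
apply: ler_sum => Y _.
rewrite (@det_colsub_scale _ _ _ (\matrix_(i, j) X (Y i) j) a) => [|i j]; last by rewrite !mxE.
rewrite le_eqVlt; apply/orP; left; apply/eqP; congr (`|\det _| ^+ 2 * _).
by apply/matrixP => i j; rewrite !mxE.
Qed.

End GramDeterminants.

Section GramStep.
Local Open Scope ring_scope.
Local Open Scope sesquilinear_scope.
Variable C : numClosedFieldType.

(* Of k + 1 distinct indices at least k + 1 - m lie in T; split off one of them. *)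
Lemma injsum_step n (L : 'I_n -> C) (T : {pred 'I_n}) m k :
  (forall j, 0 <= L j) -> (#|[predC T]| <= m)%N ->
  (k.+1 - m)%:R * injsum k.+1 L <= k.+1%:R * (\sum_(j in T) L j) * injsum k L.
Proof.
move=> L0 Tm.
have P0 (f : {ffun 'I_k.+1 -> 'I_n}) : 0 <= \prod_i L (f i) by exact: prodr_ge0.
have cardT_ge (f : 'I_k.+1 -> 'I_n) : injective f ->
    (k.+1 - m <= #|[pred i | f i \in T]|)%N.
  move=> fi; rewrite leq_subLR -[X in (X <= _)%N](card_ord k.+1).
  rewrite -(cardC [pred i | f i \in T]) addnC leq_add// (leq_trans _ Tm)//.
  rewrite -[X in (X <= _)%N](fintype.card_image fi).
  apply/subset_leq_card/fintype.subsetP => j.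
  case/mapP => i.
  by rewrite mem_enum !inE => + ->.
apply: (@le_trans _ _ (\sum_(i < k.+1)
    \sum_(f : {ffun 'I_k.+1 -> 'I_n} | injectiveb f && (f i \in T)) \prod_i L (f i))).
  under [leRHS]eq_bigr do rewrite big_mkcondr /=.
  rewrite exchange_big /= mulr_sumr; apply: ler_sum => f /injectiveP fi.
  rewrite -big_mkcond /= sumr_const -[leRHS]mulr_natl ler_wpM2r// ler_nat.
  exact: cardT_ge.
rewrite -mulrA mulr_natl -[k.+1 in leRHS]card_ord -sumr_const; apply: ler_sum => i _.
pose h (p : 'I_n * {ffun 'I_k -> 'I_n}) : {ffun 'I_k.+1 -> 'I_n} :=
  [ffun j => if unlift i j is Some j' then p.2 j' else p.1].
pose h' (f : {ffun 'I_k.+1 -> 'I_n}) := (f i, [ffun j => f (lift i j)] : {ffun 'I_k -> 'I_n}).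
have hK : cancel h h'.
  move=> [a g]; rewrite /h /h' ffunE unlift_none; congr (_, _).
  by apply/ffunP => j; rewrite !ffunE liftK.
have h'K : cancel h' h.
  by move=> f; apply/ffunP => j; rewrite !ffunE; case: unliftP => [j' ->|->]//=; rewrite ffunE.
rewrite (reindex h) /=; last by exists h' => f _; [exact: hK|exact: h'K].
rewrite /injsum big_distrlr /= pair_big_dep /=.
rewrite [leRHS]big_mkcond [leLHS]big_mkcond /=; apply: ler_sum => -[a g] _ /=.
have -> : \prod_i0 L (h (a, g) i0) = L a * \prod_j L (g j).
  rewrite (bigD1_ord i)//= !ffunE unlift_none /=; congr (_ * _).
  by apply: eq_bigr => j _; rewrite ffunE liftK.
have gP0 : 0 <= L a * \prod_j L (g j) by rewrite mulr_ge0// prodr_ge0.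
case: ifPn => [/andP[/injectiveP hi]|_]; last by case: ifP.
rewrite ffunE unlift_none /= => ->.
suff -> : injectiveb g by [].
apply/injectiveP => j j' gj; apply: (@lift_inj _ i); apply: hi.
by rewrite !ffunE !liftK.
Qed.

Section Residual.
Variables (k n : nat) (V : 'M[C]_(k, n)) (v : 'rV[C]_n).
Hypothesis V0 : gram V != 0.

Definition lsq_weight : 'rV[C]_k := v *m V ^t* *m invmx (V *m V ^t*).
Definition lsq_residual : 'rV[C]_n := v - lsq_weight *m V.

Lemma lsq_residual_orth : lsq_residual *m V ^t* = 0.
Proof.
rewrite /lsq_residual mulmxBl /lsq_weight -!mulmxA mulVmx ?mulmx1 ?subrr//.
by rewrite unitmxE unitfE.
Qed.

Lemma orth_lsq_residual : V *m lsq_residual ^t* = 0.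
Proof.
have := congr1 (fun A => A ^t*) lsq_residual_orth.
by rewrite trmx_mul map_mxM trmxCK trmx0 map_mx0.
Qed.

(** Base times squared height: a unit triangular row operation replaces v by its residual, which is
    orthogonal to the rows of V, so the Gram matrix becomes block diagonal. *)
Lemma gram_col_mx :
  gram (col_mx V v) = gram V * (lsq_residual *m lsq_residual ^t*) 0 0.
Proof.
have -> : col_mx V v = block_mx 1%:M 0 lsq_weight 1%:M *m col_mx V lsq_residual.
  by rewrite mul_block_col !mul1mx mul0mx addr0 /lsq_residual addrC subrK.
rewrite /gram trmx_mul map_mxM -!mulmxA [X in _ *m X]mulmxA det_mulmx det_lblock !det1 !mul1r.
rewrite det_mulmx det_trmxC det_lblock !det1 mul1r conjC1 mulr1.
rewrite tr_col_mx map_row_mx mul_col_row orth_lsq_residual lsq_residual_orth.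
by rewrite det_ublock [X in _ * X]det_mx11.
Qed.

Definition replace_row (j : 'I_k) : 'M[C]_(k, n) :=
  \matrix_(i, l) if i == j then v 0 l else V i l.

Lemma det_add_delta (A : 'M[C]_k) j c :
  \det (A + c *: delta_mx j j) = \det A + c * cofactor A j j.
Proof.
rewrite (expand_det_row _ j) (expand_det_row A j).
rewrite [in RHS](bigD1 j)//= [in LHS](bigD1 j)//= !mxE !eqxx mulr1 mulrDl -!addrA.
have cofE l : cofactor (A + c *: delta_mx j j) j l = cofactor A j l.
  rewrite /cofactor; congr (_ * \det _); apply/matrixP => a b; rewrite !mxE.
  by rewrite [lift j a == j]eq_sym (negPf (neq_lift j a)) mulr0 addr0.
rewrite cofE; congr (_ + _); rewrite addrC; congr (_ + _).
apply: eq_bigr => l lj; rewrite cofE !mxE (negPf lj) andbF mulr0 addr0//.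
Qed.

(** As in Cramer's rule, only the coefficient of row j matters for the part of v in the row span.
    The orthogonal residual adds its squared norm times a principal minor, which is a Gram
    determinant and hence nonnegative. *)
Lemma gram_replace_row j :
  `|lsq_weight 0 j| ^+ 2 * gram V <= gram (replace_row j).
Proof.
pose w := lsq_weight.
pose L : 'M[C]_k := \matrix_(i, l) if i == j then w 0 l else (i == l)%:R.
have -> : replace_row j = L *m V + delta_mx j 0 *m lsq_residual.
  apply/matrixP => i l; rewrite /lsq_residual -/w !mxE.
  rewrite (eq_bigr (fun l' => if i == j then w 0 l' * V l' l else (i == l')%:R * V l' l));
    last first.
    by move=> l' _; rewrite !mxE; case: ifP.
  rewrite big_ord1 !mxE eqxx andbT.
  case: (eqVneq i j) => [_|ij].
    by rewrite mul1r addrC subrK.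
  rewrite mul0r addr0 (bigD1 i)//= eqxx mul1r big1 ?addr0// => l' l'i.
  by rewrite eq_sym (negPf l'i) mul0r.
set rho := (lsq_residual *m lsq_residual ^t*) 0 0.
have rho0 : 0 <= rho by exact: mulmx_trC_diag_ge0.
have trCD (A B : 'M[C]_(k, n)) : (A + B) ^t* = A ^t* + B ^t*.
  by apply/matrixP => a b; rewrite !mxE rmorphD.
pose A := L *m V; pose E : 'M[C]_(k, n) := delta_mx j 0 *m lsq_residual.
have AE : A *m E ^t* = 0.
  by rewrite trmx_mul map_mxM mulmxA -[A *m _]mulmxA orth_lsq_residual mulmx0 mul0mx.
have EA : E *m A ^t* = 0.
  by rewrite trmx_mul map_mxM mulmxA -[E *m _]mulmxA lsq_residual_orth mulmx0 mul0mx.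
have EE : E *m E ^t* = rho *: delta_mx j j.
  rewrite trmx_mul map_mxM -mulmxA [lsq_residual *m _]mulmxA.
  rewrite [lsq_residual *m _]mx11_scalar -/rho mul_scalar_mx -scalemxAr trmx_delta.
  by rewrite map_delta_mx mul_delta_mx.
rewrite /gram -/A -/E trCD mulmxDl !mulmxDr AE EA EE addr0 add0r det_add_delta.
have -> : \det (A *m A ^t*) = `|w 0 j| ^+ 2 * \det (V *m V ^t*).
  rewrite trmx_mul map_mxM mulmxA -[A *m _]mulmxA !det_mulmx det_trmxC.
  have -> : \det L = w 0 j.
    rewrite (expand_det_col _ j) (bigD1 j)//= big1 ?addr0; last first.
      by move=> i ij; rewrite mxE (negPf ij) mul0r.
    rewrite !mxE eqxx /cofactor exprD -expr2 sqrr_sign mul1r.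
    rewrite [X in \det X](_ : _ = 1%:M) ?det1 ?mulr1//.
    apply/matrixP => a b; rewrite !mxE eq_sym (negPf (neq_lift _ _)).
    by rewrite (inj_eq (@lift_inj _ j)).
  by rewrite normCK mulrAC.
rewrite lerDl mulr_ge0// /cofactor exprD -expr2 sqrr_sign mul1r.
have -> : row' j (col' j (A *m A ^t*)) = row' j A *m (row' j A) ^t*.
  by apply/matrixP => a b; rewrite !mxE; apply: eq_bigr => l _; rewrite !mxE.
exact: gram_ge0.
Qed.

End Residual.
End GramStep.

(** The product 'C(2n, n) * n! = (n + 1) ... (2n) has n factors that are at least n, and 'C(2n, n)
    is one term of (1 + 1)^(2n). *)
Lemma exp_leq_fact n : (n ^ n <= 4 ^ n * n`!)%N.
Proof.
have bin_le : ('C(n + n, n) <= 4 ^ n)%N.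
  have -> : (4 ^ n = (1 + 1) ^ (n + n))%N by rewrite [(n + n)%N]addnn -mul2n expnM.
  rewrite expnDn (bigD1 (inord n))//= inordK ?ltnS ?leq_addr//.
  by rewrite !exp1n !muln1 leq_addr.
apply: (@leq_trans ('C(n + n, n) * n`!)%N); last by rewrite leq_mul2r bin_le orbT.
rewrite bin_ffact ffact_prod -[X in (_ ^ X)%N]card_ord -prod_nat_const leq_prod// => i _.
by rewrite -addnBA ?leq_addr// ltnW.
Qed.

(** * Nodes of nearly maximal volume *)

Section Nodes.
Local Open Scope ring_scope.
Local Open Scope complex_scope.
Local Open Scope sesquilinear_scope.
Variable R : realType.
Local Notation C := R[i].

Lemma normC_normc (z : C) : `|z| = (Normc.normc z)%:C.
Proof. by []. Qed.

Lemma ge0_ReE (z : C) : 0 <= z -> (complex.Re z)%:C = z.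
Proof. by case: z => a b; rewrite lecE /= => /andP[/eqP -> _]. Qed.

Section Greedy.
Variables (n m : nat) (T : Type) (X : T -> 'I_n -> C) (a : 'I_n -> C).
Variables (Q : finType) (node : Q -> T) (tail : {pred 'I_n}).
Hypothesis X1 : forall x j, `|X x j| = 1.
Hypothesis a0 : forall j, a j != 0.
Hypothesis Q0 : (0 < #|Q|)%N.
Hypothesis Xo : forall j j',
  \sum_q X (node q) j * (X (node q) j')^* = #|Q|%:R * (j == j')%:R.
Hypothesis m0 : (0 < m)%N.
Hypothesis tail_card : #|[predC tail]| = m.

Let Vmx k (Y : 'I_k -> T) : 'M[C]_(k, n) := \matrix_(i, j) (a j * X (Y i) j).
Let vol k (Y : 'I_k -> T) : R := complex.Re (gram (Vmx Y)).
Let s k : R := complex.Re (injsum k (fun j => `|a j| ^+ 2)).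
Let tau2 : R := complex.Re (\sum_(j in tail) `|a j| ^+ 2).
(** The D_k of the overview. It is a supremum that need not be attained over the arbitrary type T,
    so later a configuration is taken that reaches half of it. *)
Let maxvol k : R := sup [set vol Y | Y in [set: 'I_k -> T]]%classic.

Let volE k (Y : 'I_k -> T) : (vol Y)%:C = gram (Vmx Y).
Proof. by rewrite ge0_ReE// gram_ge0. Qed.

Let sE k : (s k)%:C = injsum k (fun j => `|a j| ^+ 2).
Proof. by rewrite ge0_ReE// injsum_ge0// => j; rewrite exprn_ge0. Qed.

Let tau2E : tau2%:C = \sum_(j in tail) `|a j| ^+ 2.
Proof. by rewrite ge0_ReE// sumr_ge0// => j _; rewrite exprn_ge0. Qed.

Let s_ge0 k : 0 <= s k.
Proof. by rewrite -lecR sE injsum_ge0// => j; rewrite exprn_ge0. Qed.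

Let tau2_ge0 : 0 <= tau2.
Proof. by rewrite -lecR tau2E sumr_ge0// => j _; rewrite exprn_ge0. Qed.

Let vol_ge0 k (Y : 'I_k -> T) : 0 <= vol Y.
Proof. by rewrite -lecR volE gram_ge0. Qed.

Let vol_le k (Y : 'I_k -> T) : k`!%:R * vol Y <= k%:R ^+ k * s k.
Proof.
rewrite -lecR !rmorphM rmorphXn !rmorph_nat /= volE sE.
by apply: (@gram_le_injsum _ _ _ _ (\matrix_(i, j) X (Y i) j) a) => i j; rewrite !mxE.
Qed.

Let s_step k : (k.+1 - m)%:R * s k.+1 <= k.+1%:R * tau2 * s k.
Proof.
rewrite -lecR !rmorphM !rmorph_nat /= !sE tau2E; apply: injsum_step.
  by move=> j; rewrite exprn_ge0.
by rewrite tail_card.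
Qed.

(** Iterating [s_step] from m multiplies the quotients (m + j + 1) / (j + 1), whose product is a
    binomial coefficient. *)
Let s_iter i : (i`! * m`!)%:R * s (m + i) <= (m + i)`!%:R * tau2 ^+ i * s m.
Proof.
elim: i => [|i IH]; first by rewrite addn0 expr0 mulr1 mul1n.
have := s_step (m + i); rewrite -addnS subDnCA ?subnn// addn0 => st.
rewrite factS -mulnA natrM mulrAC.
apply: (@le_trans _ _ ((i`! * m`!)%:R * ((m + i.+1)%:R * tau2 * s (m + i)))).
  by rewrite mulrC ler_wpM2l// ler0n.
have -> : (m + i.+1)`!%:R * tau2 ^+ i.+1 * s m =
    (m + i.+1)%:R * tau2 * ((m + i)`!%:R * tau2 ^+ i * s m).
  by rewrite addnS factS natrM exprS; ring.
rewrite mulrCA.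
by rewrite ler_wpM2l// mulr_ge0.
Qed.

Let s_gt0 : 0 < s m.
Proof.
have mn : (m <= n)%N by rewrite -tail_card -[n in (_ <= n)%N]card_ord max_card.
rewrite lt_def s_ge0 andbT.
have : injsum m (fun j => `|a j| ^+ 2) != 0.
  rewrite gt_eqF// /injsum.
  have fi : injectiveb [ffun i : 'I_m => widen_ord mn i].
    by apply/injectiveP => i j; rewrite !ffunE => /(congr1 val)/= ij; exact/val_inj.
  rewrite (bigD1 [ffun i : 'I_m => widen_ord mn i])//= ltr_pwDl//.
    by apply: prodr_gt0 => i _; rewrite exprn_gt0// normr_gt0.
  by apply: sumr_ge0 => f _; apply: prodr_ge0 => i _; rewrite exprn_ge0.
by rewrite -sE; apply: contra => /eqP ->.
Qed.

Let has_sup_vol k : has_sup [set vol Y | Y in [set: 'I_k -> T]]%classic.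
Proof.
have [q _] : exists q, q \in Q by apply/card_gt0P.
split; first by exists (vol (fun _ : 'I_k => node q)); exists (fun _ => node q).
exists (k%:R ^+ k * s k) => _ [Y _ <-].
apply: le_trans (vol_le Y); rewrite ler_peMl//.
by rewrite ler1n fact_gt0.
Qed.

Let vol_le_max k (Y : 'I_k -> T) : vol Y <= maxvol k.
Proof. by apply: sup_upper_bound => //; exists Y. Qed.

Let s_le_maxvol k : s k <= maxvol k.
Proof.
have [Y] := @exists_gram_ge_injsum _ _ k n (fun q => X (node q)) a Q0 Xo.
rewrite -sE => sY.
apply: le_trans (vol_le_max (fun i => node (Y i))).
by rewrite -lecR volE.
Qed.

Let maxvol_double : maxvol (m + m) <= (64 * tau2) ^+ m * maxvol m.
Proof.
apply: (@le_trans _ _ ((64 * tau2) ^+ m * s m)); last first.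
  by rewrite ler_wpM2l// exprn_ge0// mulr_ge0.
apply: sup_le_ub; first by have [] := has_sup_vol (m + m).
move=> _ [Y _ <-].
have f0 k : 0 < k`!%:R :> R by rewrite ltr0n fact_gt0.
rewrite -(ler_pM2l (f0 (m + m)%N)) -(ler_pM2l (mulr_gt0 (f0 m) (f0 m))).
apply: (@le_trans _ _ (m`!%:R * m`!%:R * ((m + m)%:R ^+ (m + m) * s (m + m)))).
  by rewrite ler_wpM2l ?vol_le// mulr_ge0.
rewrite [leLHS]mulrCA; have := s_iter m; rewrite natrM => it.
apply: (@le_trans _ _ ((m + m)%:R ^+ (m + m) * ((m + m)`!%:R * tau2 ^+ m * s m))).
  by rewrite ler_wpM2l// exprn_ge0.
(* Origin of 64: (2m)^(2m) = 4^m (m^m)^2, and each m^m is at most 4^m m!. *)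
have num : (m + m)%:R ^+ (m + m) <= 64 ^+ m * (m`!%:R * m`!%:R) :> R.
  have -> : 64 ^+ m = 4 ^+ m * (4 ^+ m * 4 ^+ m) :> R by rewrite -!exprMn; congr (_ ^+ _); ring.
  rewrite -!natrX -!natrM ler_nat addnn -mul2n expnM.
  rewrite (_ : (2 * m) ^ 2 = 4 * (m * m))%N; last by rewrite expnMn mulnn.
  rewrite expnMn -mulnA leq_mul2l; apply/orP; right.
  by rewrite expnMn mulnACA leq_mul ?exp_leq_fact.
have -> : m`!%:R * m`!%:R * ((m + m)`!%:R * ((64 * tau2) ^+ m * s m)) =
  64 ^+ m * (m`!%:R * m`!%:R) * ((m + m)`!%:R * tau2 ^+ m * s m) :> R by rewrite exprMn; ring.
by rewrite ler_wpM2r// !mulr_ge0// exprn_ge0.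
Qed.

(* Otherwise maxvol would grow faster from m to 2m than maxvol_double allows. *)
Let growth_step : exists k : nat,
  [/\ (m <= k < m + m)%N, 0 < maxvol k & maxvol (k + 1) <= 64 * tau2 * maxvol k].
Proof.
apply: contrapT => /forallNP noK.
have rho0 : 0 <= 64 * tau2 by rewrite mulr_ge0.
have D0 : 0 < maxvol m by apply: lt_le_trans s_gt0 (s_le_maxvol m).
have step i : (i < m)%N -> 0 < maxvol (m + i) ->
    64 * tau2 * maxvol (m + i) < maxvol (m + i.+1).
  move=> im Di0; rewrite ltNge; apply/negP => le; apply: (noK (m + i)%N); split => //.
    by rewrite leq_addr ltn_add2l.
  by rewrite -addnA addn1.
have grow i : (i <= m)%N ->
    0 < maxvol (m + i) /\ (64 * tau2) ^+ i * maxvol m <= maxvol (m + i).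
  elim: i => [_|i IH im]; first by rewrite addn0 expr0 mul1r; split.
  have [Di0 leDi] := IH (ltnW im); have lt := step i im Di0.
  split; first by apply: le_lt_trans lt; rewrite mulr_ge0// ltW.
  by apply: le_trans (ltW lt); rewrite exprS -[leLHS]mulrA ler_wpM2l.
have pm : (m.-1 < m)%N by rewrite prednK.
have [Dp0 leDp] := grow _ (ltnW pm).
have := step _ pm Dp0; rewrite prednK// ltNge => /negP; apply.
apply: le_trans maxvol_double _.
by rewrite -[in X in _ ^+ X](prednK m0) exprS -[leLHS]mulrA ler_wpM2l.
Qed.

Lemma exists_good_nodes : exists (k : nat) (Y : 'I_k -> T), (k < m + m)%N /\
  forall x, exists w : 'I_k -> C, (forall i, `|w i| ^+ 2 <= 2) /\
    \sum_j `|a j * X x j - \sum_i w i * (a j * X (Y i) j)| ^+ 2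
      <= 128 * \sum_(j in tail) `|a j| ^+ 2.
Proof.
have [k [/andP[_ km] Dk0 Dk1]] := growth_step.
(* Y reaches half of the supremum; this factor 2 gives the bound 2 on the squared weights and 128 =
   2 * 64 on the squared distance. *)
have hD0 : 0 < maxvol k / 2 by rewrite divr_gt0.
have [_ [Y _ <-]] := sup_adherent hD0 (has_sup_vol k).
rewrite -/(maxvol k) (_ : maxvol k - maxvol k / 2 = maxvol k / 2); last by field.
move=> volY; exists k, Y; split => // x.
have V0 : 0 < gram (Vmx Y) by rewrite -volE ltcR (lt_trans hD0).
have Vneq : gram (Vmx Y) != 0 by rewrite gt_eqF.
pose v : 'rV[C]_n := \row_j (a j * X x j).
exists (lsq_weight (Vmx Y) v 0); split.
  move=> i; rewrite -(ler_pM2r V0); apply: le_trans (gram_replace_row v Vneq i) _.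
  (* Exchanging node i for x gives again a k-point configuration, whose volume is at most twice that
     of Y. *)
  have -> : replace_row (Vmx Y) v i = Vmx (fun i' => if i' == i then x else Y i').
    by apply/matrixP => p q; rewrite !mxE; case: ifP.
  rewrite -!volE -(rmorph_nat (real_complex R)) -rmorphM /= lecR.
  by apply: le_trans (vol_le_max _) _; rewrite mulrC -ler_pdivrMr// ltW.
have -> : \sum_j `|a j * X x j - \sum_i lsq_weight (Vmx Y) v 0 i * (a j * X (Y i) j)| ^+ 2 =
    (lsq_residual (Vmx Y) v *m (lsq_residual (Vmx Y) v) ^t*) 0 0.
  have resE j : lsq_residual (Vmx Y) v 0 j =
      a j * X x j - \sum_i lsq_weight (Vmx Y) v 0 i * (a j * X (Y i) j).
    rewrite /lsq_residual !mxE; congr (_ - _); apply: eq_bigr => i _.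
    by congr (_ * _); rewrite mxE.
  rewrite mxE; apply: eq_bigr => j _; rewrite -resE normCK; congr (_ * _).
  by rewrite [in RHS]mxE [in RHS]mxE.
rewrite -(ler_pM2l V0) -(gram_col_mx _ Vneq).
(* Adjoining x to Y gives a (k + 1)-point configuration, to which the growth bound from k to k + 1
   applies. *)
pose Y1 (i : 'I_(k + 1)) : T := match fintype.split i with inl i' => Y i' | inr _ => x end.
have -> : col_mx (Vmx Y) v = Vmx Y1.
  by apply/matrixP => p q; rewrite /Y1 !mxE; case: (fintype.split p) => p'; rewrite mxE.
rewrite -tau2E -!volE -(rmorph_nat (real_complex R)) -!rmorphM /= lecR.
apply: le_trans (vol_le_max _) _; apply: le_trans Dk1 _.
have -> : 64 * tau2 * maxvol k = maxvol k / 2 * (128 * tau2) by field.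
by rewrite ler_wpM2r ?mulr_ge0// ltW.
Qed.

End Greedy.
End Nodes.

(** * Integration over the cube *)

Section BoundedMeasurable.
Local Open Scope classical_set_scope.
Local Open Scope ring_scope.
Context d (T : measurableType d) (R : realType).

(** Under a probability measure these functions are automatically integrable, and the class is
    closed under sums and products; integrals become linear without separate integrability
    conditions. *)
Definition bmeas (f : T -> R) :=
  measurable_fun [set: T] f /\ exists L, forall x, `|f x| <= L.

Lemma bmeas_cst (c : R) : bmeas (fun=> c).
Proof. by split; [exact: measurable_cst|exists `|c|]. Qed.

Lemma bmeasD (f g : T -> R) : bmeas f -> bmeas g -> bmeas (fun x => f x + g x).
Proof.
move=> [mf [L fL]] [mg [M gM]]; split; first exact: measurable_funD.
by exists (L + M) => x; rewrite (le_trans (ler_normD _ _))// lerD.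
Qed.

Lemma bmeasM (f g : T -> R) : bmeas f -> bmeas g -> bmeas (fun x => f x * g x).
Proof.
move=> [mf [L fL]] [mg [M gM]]; split; first exact: measurable_funM.
by exists (L * M) => x; rewrite normrM ler_pM.
Qed.

Lemma bmeasN (f : T -> R) : bmeas f -> bmeas (fun x => - f x).
Proof.
move=> [mf [L fL]]; split; first exact: measurableT_comp.
by exists L => x; rewrite normrN.
Qed.

Lemma bmeasB (f g : T -> R) : bmeas f -> bmeas g -> bmeas (fun x => f x - g x).
Proof. by move=> bf bg; apply: bmeasD => //; exact: bmeasN. Qed.

Lemma bmeasX (f : T -> R) n : bmeas f -> bmeas (fun x => f x ^+ n).
Proof.
move=> bf; elim: n => [|n IH].
  by under [X in bmeas X]eq_fun do rewrite expr0; exact: bmeas_cst.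
by under [X in bmeas X]eq_fun do rewrite exprS; exact: bmeasM.
Qed.

Lemma bmeas_sum I (s : seq I) (p : pred I) (f : I -> T -> R) :
  (forall i, bmeas (f i)) -> bmeas (fun x => \sum_(i <- s | p i) f i x).
Proof.
move=> bf; elim: s => [|i s IH].
  by under [X in bmeas X]eq_fun do rewrite big_nil; exact: bmeas_cst.
under [X in bmeas X]eq_fun do rewrite big_cons.
by case: (p i) => //; exact: bmeasD.
Qed.

Lemma bmeas_indic (A : set T) : measurable A -> bmeas (\1_A : T -> R).
Proof.
move=> mA; split; first exact: measurable_indic.
by exists 1 => x; rewrite indicE; case: (_ \in _); rewrite ?normr1 ?normr0.
Qed.

Variable P : probability T R.

Lemma bmeas_integrable (f : T -> R) : bmeas f -> P.-integrable setT (EFin \o f).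
Proof.
move=> [mf [L fL]]; apply: measurable_bounded_integrable => //.
  by rewrite [X in (X < _)%E](@probability_setT _ _ _ P) ltry.
exists L; split; first exact: num_real.
by move=> M LM x _ /=; rewrite (le_trans (fL x))// ltW.
Qed.

Lemma expectD (f g : T -> R) : bmeas f -> bmeas g ->
  \int[P]_x (f x + g x) = \int[P]_x f x + \int[P]_x g x.
Proof. by move=> bf bg; rewrite RintegralD//; exact: bmeas_integrable. Qed.

Lemma expectZ c (f : T -> R) : bmeas f ->
  \int[P]_x (c * f x) = c * \int[P]_x f x.
Proof. by move=> bf; rewrite RintegralZl//; exact: bmeas_integrable. Qed.

Lemma expectN (f : T -> R) : bmeas f -> \int[P]_x (- f x) = - \int[P]_x f x.
Proof.
move=> bf; rewrite -mulN1r -expectZ//; apply: eq_Rintegral => x _.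
by rewrite mulN1r.
Qed.

Lemma expectB (f g : T -> R) : bmeas f -> bmeas g ->
  \int[P]_x (f x - g x) = \int[P]_x f x - \int[P]_x g x.
Proof. by move=> bf bg; rewrite expectD ?expectN//; exact: bmeasN. Qed.

Lemma expect_cst c : \int[P]_x c = c :> R.
Proof.
rewrite Rintegral_cst// -[RHS]mulr1; congr (_ * _).
by rewrite [X in fine X](@probability_setT _ _ _ P).
Qed.

Lemma expect_sum I (s : seq I) (p : pred I) (f : I -> T -> R) :
  (forall i, bmeas (f i)) ->
  \int[P]_x (\sum_(i <- s | p i) f i x) = \sum_(i <- s | p i) \int[P]_x f i x.
Proof.
move=> bf; elim: s => [|i s IH].
  by under eq_Rintegral do rewrite big_nil; rewrite expect_cst big_nil.
under eq_Rintegral do rewrite big_cons.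
rewrite big_cons; case: (p i) => //.
by rewrite expectD ?IH//; exact: bmeas_sum.
Qed.

Lemma le_expect_ae (f g : T -> R) : bmeas f -> bmeas g ->
  (\forall x \ae P, f x <= g x) -> \int[P]_x f x <= \int[P]_x g x.
Proof.
move=> bf bg fg.
(* The minimum of f and g agrees with f almost everywhere and lies below g everywhere, which reduces
   the claim to pointwise monotonicity. *)
have bm : bmeas (fun x => Num.min (f x) (g x)).
  case: bf bg => [mf [L fL]] [mg [M gM]]; split.
    exact: measurable_minr.
  exists (L + M) => x; rewrite minEle; case: ifP => _.
    by rewrite (le_trans (fL x))// lerDl (le_trans (normr_ge0 _) (gM x)).
  by rewrite (le_trans (gM x))// lerDr (le_trans (normr_ge0 _) (fL x)).
have -> : \int[P]_x f x = \int[P]_x Num.min (f x) (g x).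
  congr fine; apply: ae_eq_integral => //.
  - by apply/measurable_EFinP; exact: bf.1.
  - by apply/measurable_EFinP; exact: bm.1.
  - by apply: filterS fg => x fgx _; congr (_%:E); apply/esym/min_idPl.
apply: le_Rintegral => //; [exact: bmeas_integrable|exact: bmeas_integrable|].
by move=> x _; rewrite ge_min lexx orbT.
Qed.

Lemma le_expect (f g : T -> R) : bmeas f -> bmeas g ->
  (forall x, f x <= g x) -> \int[P]_x f x <= \int[P]_x g x.
Proof. by move=> bf bg fg; apply: le_expect_ae => //; apply: aeW. Qed.

Lemma expect_indic (A : set T) : measurable A -> \int[P]_x (\1_A x) = fine (P A) :> R.
Proof. by move=> mA; rewrite /Rintegral integral_indic// setIT. Qed.

Lemma EFin_expect (f : T -> R) : bmeas f ->
  (\int[P]_x f x)%R%:E = (\int[P]_x (f x)%:E)%E.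
Proof.
by move=> bf; rewrite fineK//; apply: integrable_fin_num => //; exact: bmeas_integrable.
Qed.

End BoundedMeasurable.

Section Cube.
Local Open Scope classical_set_scope.
Local Open Scope ring_scope.
Context {R : realType}.

Local Notation unif := (uniform_prob (@ltr01 R)).

Lemma bmeas_cons n (g : n.+1.-tuple R -> R) :
  bmeas g -> bmeas (fun p : R * n.-tuple R => g [tuple of p.1 :: p.2]).
Proof.
move=> [mg [L gL]]; split; last by exists L => p.
by apply: (measurableT_comp mg); exact: measurable_cons.
Qed.

Lemma cube_fubini n (g : n.+1.-tuple R -> R) : bmeas g ->
  \int[cube n.+1]_z g z = \int[unif]_x \int[cube n]_y g [tuple of x :: y].
Proof.
move=> bg; have bg2 := bmeas_cons bg.
have ig : (unif \x cube n)%E.-integrable setT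
    (fun p : R * n.-tuple R => (g [tuple of p.1 :: p.2])%:E).
  apply: measurable_bounded_integrable => //.
  - rewrite -setXTT [X in (X < _)%E]product_measure1E// [X in (_ * X)%E](@probability_setT _ _ _ (cube n)).
    by rewrite [X in (X * _)%E](@probability_setT _ _ _ unif) mule1 ltry.
  - exact: bg2.1.
  - have [L gL] := bg2.2; exists L; split; first exact: num_real.
    by move=> M LM x _ /=; rewrite (le_trans (gL x))// ltW.
have mcons : @measurable_fun _ _ (measurableTypeR R * n.-tuple R)%type (n.+1.-tuple R) setT
  (fun p => [the n.+1.-tuple R of p.1 :: p.2]).
  exact: (@measurable_cons _ _ (measurableTypeR R * n.-tuple R)%type R).
have mg : measurable_fun setT (EFin \o g) by apply/measurable_EFinP; exact: bg.1.
have := @integral_pushforward _ _ _ _ R _ mcons (unif \x cube n)%E setT _ mg.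
rewrite preimage_setT => /(_ ig measurableT) pE.
rewrite [LHS](congr1 fine pE) -(congr1 fine (integral12_prod_meas1 ig)) {pE}.
apply: congr1; apply: eq_integral => x _.
rewrite EFin_expect//; split; last by have [L gL] := bg.2; exists L.
by apply: (measurableT_comp bg.1); exact: measurable_cons.
Qed.

Lemma measurable_pi n (A : 'I_n -> set R) : (forall i, measurable (A i)) ->
  measurable [set x : n.-tuple R | forall i, A i (tnth x i)].
Proof.
move=> mA.
have -> : [set x : n.-tuple R | forall i, A i (tnth x i)] =
    \bigcap_(i in [set: 'I_n]) ((@tnth _ R ^~ i) @^-1` A i).
  by apply/seteqP; split => [x Ax i _|x Ax i]; [exact: Ax|exact: (Ax i)].
apply: fin_bigcap_measurable => // i _.
by rewrite -[X in measurable X]setTI; exact: measurable_tnth.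
Qed.

Lemma cube_pi n (A : 'I_n -> set R) : (forall i, measurable (A i)) ->
  cube n [set x : n.-tuple R | forall i, A i (tnth x i)] = (\prod_i fine (unif (A i)))%:E.
Proof.
elim: n A => [|n IH] A mA.
  by rewrite big_ord0 /= diracE mem_set// => -[].
rewrite big_ord_recl /=.
rewrite /cube_step /pushforward.
have -> : (fun p : R * n.-tuple R => [the n.+1.-tuple R of p.1 :: p.2]) @^-1`
    [set x | forall i, A i (tnth x i)] =
    A ord0 `*` [set x : n.-tuple R | forall i, A (lift ord0 i) (tnth x i)].
  apply/seteqP; split => [[x y] /= Axy|[x y] /= [Ax Ay] i].
    split; first exact: (Axy ord0).
    by move=> i; have := Axy (lift ord0 i); rewrite tnthS.
  by have [j ->|->//] := unliftP ord0 i; rewrite tnthS.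
rewrite [LHS]product_measure1E; [|exact: mA|by apply: (@measurable_pi n (fun i => A (lift ord0 i)))].
rewrite EFinM -[X in _ = (_ * X)%E](IH (fun i => A (lift ord0 i)))//.
congr (_ * _)%E; rewrite fineK//.
apply: (@fin_num_measure _ _ _ (uniform_prob ltr01 : probability (measurableTypeR R) R)).
exact: mA.
Qed.

Lemma uniform_prob_oo (a b : R) : 0 <= a -> a < b -> b <= 1 ->
  unif `]a, b[ = (b - a)%:E.
Proof.
move=> a0 ab b1; rewrite /uniform_prob.
rewrite (eq_integral (fun=> 1%E)); last first.
  move=> x; rewrite inE/= in_itv/= => /andP[ax xb].
  by rewrite /uniform_pdf (ltW (le_lt_trans a0 ax)) (ltW (lt_le_trans xb b1)) subr0 invr1.
by rewrite integral_cst//= mul1e lebesgue_measure_itv/= lte_fin ab EFinB.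
Qed.

Lemma ae_cube_oo n : \forall x \ae (@cube R n), forall i, 0 < tnth x i < 1.
Proof.
have mU : measurable [set x : n.-tuple R | forall i, `]0, 1[%classic (tnth x i)].
  by apply: (@measurable_pi n (fun=> `]0%R, 1%R[%classic)).
exists (~` [set x : n.-tuple R | forall i, `]0, 1[%classic (tnth x i)]); split.
- exact: measurableC.
- rewrite probability_setC// [X in (_ - X)%E](@cube_pi n (fun=> `]0%R, 1%R[%classic))// big1 ?subee// => i _.
  by rewrite uniform_prob_oo// subr0.
- by apply: subsetC => x /= xU i; have := xU i; rewrite in_itv.
Qed.

Lemma cube_box_gt0 n (a b : n.-tuple R) :
  (forall i, 0 <= tnth a i) -> (forall i, tnth a i < tnth b i) -> (forall i, tnth b i <= 1) ->
  0 < fine (cube n [set x : n.-tuple R | forall i, tnth a i < tnth x i < tnth b i]).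
Proof.
move=> a0 ab b1.
have -> : [set x : n.-tuple R | forall i, tnth a i < tnth x i < tnth b i] =
    [set x | forall i, `]tnth a i, tnth b i[%classic (tnth x i)].
  by apply/seteqP; split => x /= + i => /(_ i); rewrite in_itv.
rewrite [X in fine X](@cube_pi n (fun i => `]tnth a i, tnth b i[%classic))//= prodr_gt0// => i _.
by rewrite uniform_prob_oo//= subr_gt0.
Qed.

End Cube.

Section OneDimensional.
Local Open Scope classical_set_scope.
Local Open Scope ring_scope.
Context {R : realType}.
Local Notation unif := (uniform_prob (@ltr01 R)).

Lemma expect_unif_derive (G g : R -> R) :
  continuous g -> (forall x : R, is_derive x 1 G (g x)) -> (forall x, 0 <= g x) ->
  \int[unif]_x g x = G 1 - G 0.
Proof.
move=> cg dG g0.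
have cG x : G @ x --> G x.
  by apply: differentiable_continuous; apply/derivable1_diffP; have [] := dG x.
rewrite /Rintegral integral_uniform; last 2 first.
- by apply/measurable_EFinP; exact: continuous_measurable_fun.
- by move=> x; rewrite lee_fin.
rewrite subr0 invr1 mul1e (@continuous_FTC2 _ _ G)//.
- exact: continuous_subspaceT.
- split=> [x _||].
  + by have [] := dG x.
  + exact: cvg_at_right_filter.
  + exact: cvg_at_left_filter.
- by move=> x _; rewrite derive1E; have [] := dG x.
Qed.

Lemma cos_int (k : int) : cos (2 * pi * k%:~R) = 1 :> R.
Proof.
have cosn (n : nat) : cos (2 * pi * n%:R) = 1 :> R.
  elim: n => [|n IH]; first by rewrite mulr0 cos0.
  by rewrite -[n.+1%:R]natr1 mulrDr mulr1 [2 * pi]mulr_natl cosD2pi -[pi *+ 2]mulr_natl.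
case: k => n; first exact: cosn.
by rewrite NegzE mulrNz mulrN cosN cosn.
Qed.

Lemma sin_int (k : int) : sin (2 * pi * k%:~R) = 0 :> R.
Proof. by apply/eqP; rewrite -sqrf_eq0 sin2cos2 cos_int expr1n subrr. Qed.

Lemma bmeas_cos d (T : measurableType d) (f : T -> R) :
  measurable_fun setT f -> bmeas (fun x => cos (f x)).
Proof.
move=> mf; split; last by exists 1 => x; rewrite ler_norml cos_geN1 cos_le1.
by apply: measurableT_comp mf; apply: continuous_measurable_fun; exact: continuous_cos.
Qed.

Lemma bmeas_sin d (T : measurableType d) (f : T -> R) :
  measurable_fun setT f -> bmeas (fun x => sin (f x)).
Proof.
move=> mf; split; last by exists 1 => x; rewrite ler_norml sin_geN1 sin_le1.
by apply: measurableT_comp mf; apply: continuous_measurable_fun; exact: continuous_sin.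
Qed.

Lemma is_derive_scale (c x : R) : is_derive x 1 ( *%R c) c.
Proof.
rewrite (_ : *%R c = c *: (id : R -> R)); last exact/funext.
apply: is_derive_eq.
by rewrite /GRing.scale /= mulr1.
Qed.

Lemma is_derive_id_add_scale (F : R -> R) (a c l x : R) : is_derive (c * x) 1 F l ->
  is_derive x 1 (fun y => y + a * F (c * y)) (1 + a * (l * c)).
Proof.
move=> dF; have dFc := is_derive1_comp dF (is_derive_scale c x).
rewrite (_ : (fun y => _) = (id : R -> R) + a *: (F \o *%R c)); last exact/funext.
exact: is_deriveD.
Qed.

Lemma expect_unif_cos (k : int) :
  \int[unif]_x cos (2 * pi * (k%:~R * x)) = (k == 0)%:R.
Proof.
have [->|k0] := eqVneq k 0.
  under eq_Rintegral do rewrite mul0r mulr0 cos0.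
  by rewrite (expect_cst unif).
have c0 : 2 * pi * k%:~R != 0 :> R.
  by apply: mulf_neq0; [apply: mulf_neq0; rewrite // gt_eqF// pi_gt0|rewrite intr_eq0].
set c := 2 * pi * k%:~R : R.
have bc : bmeas (fun x : measurableTypeR R => cos (c * x)).
  by apply: bmeas_cos; exact: measurable_funM.
(* The summand 1 makes the integrand nonnegative, as [expect_unif_derive] requires; it is cancelled
   at the end. *)
have : \int[unif]_x (1 + cos (c * x)) = (1 + c^-1 * sin (c * 1)) - (0 + c^-1 * sin (c * 0)).
  apply: (@expect_unif_derive (fun x => x + c^-1 * sin (c * x))).
  - move=> x; apply: cvgD; first exact: cvg_cst.
    by apply: continuous_comp; [exact: mulrl_continuous|exact: continuous_cos].
  - move=> x; have := is_derive_id_add_scale c^-1 (is_derive_sin (c * x)).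
    by rewrite mulrCA mulVf ?mulr1.
  - by move=> x; rewrite -lerBlDl sub0r cos_geN1.
rewrite expectD//; last exact: bmeas_cst.
rewrite (expect_cst unif) mulr1 mulr0 sin0 sin_int mulr0 !addr0 subr0.
move=> e; transitivity (\int[unif]_x cos (c * x)).
  by apply: eq_Rintegral => x _; rewrite mulrA.
by apply: (addrI 1); rewrite e addr0.
Qed.

Lemma expect_unif_sin (k : int) :
  \int[unif]_x sin (2 * pi * (k%:~R * x)) = 0.
Proof.
have [->|k0] := eqVneq k 0.
  under eq_Rintegral do rewrite mul0r mulr0 sin0.
  by rewrite (expect_cst unif).
have c0 : 2 * pi * k%:~R != 0 :> R.
  by apply: mulf_neq0; [apply: mulf_neq0; rewrite // gt_eqF// pi_gt0|rewrite intr_eq0].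
set c := 2 * pi * k%:~R : R.
have bc : bmeas (fun x : measurableTypeR R => sin (c * x)).
  by apply: bmeas_sin; exact: measurable_funM.
have : \int[unif]_x (1 + sin (c * x)) = (1 + - c^-1 * cos (c * 1)) - (0 + - c^-1 * cos (c * 0)).
  apply: (@expect_unif_derive (fun x => x + - c^-1 * cos (c * x))).
  - move=> x; apply: cvgD; first exact: cvg_cst.
    by apply: continuous_comp; [exact: mulrl_continuous|exact: continuous_sin].
  - move=> x; have := is_derive_id_add_scale (- c^-1) (is_derive_cos (c * x)).
    by rewrite !mulNr mulrN opprK mulrCA mulVf ?mulr1.
  - by move=> x; rewrite -lerBlDl sub0r sin_geN1.
rewrite expectD//; last exact: bmeas_cst.
rewrite (expect_cst unif) mulr1 mulr0 cos0 cos_int mulr1 add0r addrK.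
move=> e; transitivity (\int[unif]_x sin (c * x)).
  by apply: eq_Rintegral => x _; rewrite mulrA.
by apply: (addrI 1); rewrite e addr0.
Qed.

End OneDimensional.

(** * Complex-valued integrals and characters *)

Section ComplexIntegral.
Local Open Scope classical_set_scope.
Local Open Scope ring_scope.
Local Open Scope complex_scope.
Context {R : realType} {d : nat}.
Local Notation point := (d.-tuple R).
Local Notation freq := (d.-tuple int).
Local Notation func := (point -> R[i]).
Local Notation normc := Normc.normc.
Implicit Types (f g : func) (h k : freq).

Lemma complexE2 (z : R[i]) : z = complex.Re z +i* complex.Im z.
Proof. by case: z. Qed.

Lemma ReD (z w : R[i]) : complex.Re (z + w) = complex.Re z + complex.Re w.
Proof. by case: z w => a b [c e]. Qed.

Lemma ImD (z w : R[i]) : complex.Im (z + w) = complex.Im z + complex.Im w.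
Proof. by case: z w => a b [c e]. Qed.

Lemma ReM (z w : R[i]) :
  complex.Re (z * w) = complex.Re z * complex.Re w - complex.Im z * complex.Im w.
Proof. by case: z w => a b [c e]. Qed.

Lemma ImM (z w : R[i]) :
  complex.Im (z * w) = complex.Re z * complex.Im w + complex.Im z * complex.Re w.
Proof. by case: z w => a b [c e]. Qed.

Lemma normc_ge0 (z : R[i]) : 0 <= normc z.
Proof. by case: z => a b; rewrite sqrtr_ge0. Qed.

Lemma normcM (z w : R[i]) : normc (z * w) = normc z * normc w.
Proof. by apply: complexI; rewrite rmorphM /= -!normC_normc normrM. Qed.

Lemma normcD (z w : R[i]) : normc (z + w) <= normc z + normc w.
Proof. by rewrite -lecR rmorphD /= -!normC_normc ler_normD. Qed.

Lemma normcN (z : R[i]) : normc (- z) = normc z.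
Proof. by apply: complexI; rewrite -!normC_normc normrN. Qed.

Lemma normc0 : normc (0 : R[i]) = 0.
Proof. by apply: complexI; rewrite -!normC_normc normr0. Qed.

Lemma normc_real (x : R) : normc x%:C = `|x|.
Proof. by rewrite /= expr0n /= addr0 sqrtr_sqr. Qed.

Lemma normcJ (z : R[i]) : normc (z^*) = normc z.
Proof. by case: z => a b /=; rewrite sqrrN. Qed.

Lemma normc_eq0 (z : R[i]) : (normc z == 0) = (z == 0).
Proof.
by rewrite -(normr_eq0 z) normC_normc -(inj_eq (@complexI R)).
Qed.

Lemma normc_sum I (s : seq I) (p : pred I) (F : I -> R[i]) :
  normc (\sum_(i <- s | p i) F i) <= \sum_(i <- s | p i) normc (F i).
Proof.
elim/big_rec2: _ => [|i x y _ h]; first by rewrite normc0.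
by rewrite (le_trans (normcD _ _))// lerD2l.
Qed.

Lemma sqr_normc (z : R[i]) : normc z ^+ 2 = complex.Re z ^+ 2 + complex.Im z ^+ 2.
Proof. by case: z => a b; rewrite /= sqr_sqrtr// addr_ge0 ?sqr_ge0. Qed.

Lemma sqr_normcE (z : R[i]) : (normc z ^+ 2)%:C = z * z^*.
Proof. by rewrite rmorphXn /= -normC_normc normCK. Qed.

Lemma Re_le_normc (z : R[i]) : `|complex.Re z| <= normc z.
Proof.
by rewrite -ler_sqr ?nnegrE ?normc_ge0// real_normK ?num_real// sqr_normc lerDl sqr_ge0.
Qed.

Lemma Im_le_normc (z : R[i]) : `|complex.Im z| <= normc z.
Proof.
by rewrite -ler_sqr ?nnegrE ?normc_ge0// real_normK ?num_real// sqr_normc lerDr sqr_ge0.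
Qed.

Lemma normc_le_ReIm (z : R[i]) : normc z <= `|complex.Re z| + `|complex.Im z|.
Proof.
rewrite -ler_sqr ?nnegrE ?normc_ge0 ?addr_ge0//.
rewrite sqr_normc sqrrD !real_normK ?num_real//.
by rewrite addrAC lerDl mulrn_wge0// mulr_ge0.
Qed.

Definition cbmeas f :=
  bmeas (fun x => complex.Re (f x)) /\ bmeas (fun x => complex.Im (f x)).

Lemma cbmeas_cst c : cbmeas (fun=> c).
Proof. by split; exact: bmeas_cst. Qed.

Lemma cbmeasD f g : cbmeas f -> cbmeas g -> cbmeas (fun x => f x + g x).
Proof.
move=> [f1 f2] [g1 g2]; split.
  by under [X in bmeas X]eq_fun do rewrite ReD; exact: bmeasD.
by under [X in bmeas X]eq_fun do rewrite ImD; exact: bmeasD.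
Qed.

Lemma cbmeasM f g : cbmeas f -> cbmeas g -> cbmeas (fun x => f x * g x).
Proof.
move=> [f1 f2] [g1 g2]; split.
  by under [X in bmeas X]eq_fun do rewrite ReM; apply: bmeasB; exact: bmeasM.
by under [X in bmeas X]eq_fun do rewrite ImM; apply: bmeasD; exact: bmeasM.
Qed.

Lemma cbmeasZ c f : cbmeas f -> cbmeas (fun x => c * f x).
Proof. by move=> bf; apply: cbmeasM => //; exact: cbmeas_cst. Qed.

Lemma cbmeasB f g : cbmeas f -> cbmeas g -> cbmeas (fun x => f x - g x).
Proof.
move=> bf bg; apply: cbmeasD => //.
by under [X in cbmeas X]eq_fun do rewrite -mulN1r; exact: cbmeasZ.
Qed.

Lemma cbmeas_sum I (s : seq I) (p : pred I) (f : I -> func) :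
  (forall i, cbmeas (f i)) -> cbmeas (fun x => \sum_(i <- s | p i) f i x).
Proof.
move=> bf; elim: s => [|i s IH].
  by under [X in cbmeas X]eq_fun do rewrite big_nil; exact: cbmeas_cst.
under [X in cbmeas X]eq_fun do rewrite big_cons.
by case: (p i) => //; exact: cbmeasD.
Qed.

Lemma cbmeas_bound f : cbmeas f -> exists L, forall x, normc (f x) <= L.
Proof.
move=> [[_ [L fL]] [_ [M fM]]]; exists (L + M) => x.
by rewrite (le_trans (normc_le_ReIm _))// lerD.
Qed.

Lemma cbmeasP f : Defs.measurableC f -> (exists L, forall x, normc (f x) <= L) -> cbmeas f.
Proof.
move=> [m1 m2] [L fL]; split; split => //; exists L => x.
  exact: le_trans (Re_le_normc _) (fL x).
exact: le_trans (Im_le_normc _) (fL x).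
Qed.

Lemma bmeas_normc f : cbmeas f -> bmeas (fun x => normc (f x)).
Proof.
move=> bf; have [L fL] := cbmeas_bound bf; split; last first.
  by exists L => x; rewrite ger0_norm ?normc_ge0.
have -> : (fun x => normc (f x)) =
    (fun x => Num.sqrt (complex.Re (f x) ^+ 2 + complex.Im (f x) ^+ 2)).
  by apply/funext => x; rewrite -sqr_normc sqrtr_sqr ger0_norm ?normc_ge0.
apply: measurableT_comp.
  by apply: continuous_measurable_fun; exact: sqrt_continuous.
by have [] := bmeasD (bmeasX 2 bf.1) (bmeasX 2 bf.2).
Qed.

Lemma cintegralD f g : cbmeas f -> cbmeas g ->
  cintegral (fun x => f x + g x) = cintegral f + cintegral g.
Proof.
move=> [f1 f2] [g1 g2]; rewrite /cintegral; apply/eqP; rewrite eq_complex /=.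
apply/andP; split; apply/eqP.
  by rewrite -expectD//; apply: eq_Rintegral => x _; rewrite ReD.
by rewrite -expectD//; apply: eq_Rintegral => x _; rewrite ImD.
Qed.

Lemma cintegralZ c f : cbmeas f -> cintegral (fun x => c * f x) = c * cintegral f.
Proof.
move=> [f1 f2]; rewrite /cintegral [in RHS](complexE2 c); apply/eqP; rewrite eq_complex /=.
have b0 (a : R) (u : point -> R) : bmeas u -> bmeas (fun x => a * u x).
  by move=> bu; apply: bmeasM => //; exact: bmeas_cst.
apply/andP; split; apply/eqP.
  rewrite -!expectZ// -expectB//; [|exact: b0|exact: b0].
  by apply: eq_Rintegral => x _; rewrite ReM.
rewrite -!expectZ// -expectD//; [|exact: b0|exact: b0].
by apply: eq_Rintegral => x _; rewrite ImM.
Qed.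

Lemma cintegral_cst c : cintegral (fun _ : point => c) = c.
Proof.
by rewrite /cintegral [RHS]complexE2 !(expect_cst (cube d)).
Qed.

Lemma cintegral_sum I (s : seq I) (p : pred I) (f : I -> func) :
  (forall i, cbmeas (f i)) ->
  cintegral (fun x => \sum_(i <- s | p i) f i x) = \sum_(i <- s | p i) cintegral (f i).
Proof.
move=> bf; elim: s => [|i s IH].
  rewrite big_nil -[RHS](cintegral_cst 0); congr cintegral.
  by apply/funext => x; rewrite big_nil.
rewrite big_cons; under [X in cintegral X]eq_fun do rewrite big_cons.
by case: (p i) => //; rewrite cintegralD ?IH//; exact: cbmeas_sum.
Qed.

Lemma normc_cintegral_le f (g : point -> R) : cbmeas f -> bmeas g ->
  (forall x, normc (f x) <= g x) -> normc (cintegral f) <= \int[cube d]_x g x.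
Proof.
move=> bf bg fg; set z := cintegral f.
have [z0|z0] := eqVneq z 0.
  rewrite z0 normc0 -[leLHS](expect_cst (cube d)); apply: le_expect => //.
    exact: bmeas_cst.
  by move=> x; exact: le_trans (normc_ge0 _) (fg x).
have nz : normc z != 0 by rewrite normc_eq0.
(* Multiplication by the unimodular u rotates the integral z onto its modulus, so |z| becomes the
   integral of the real part of u f. *)
pose u : R[i] := (normc z)^-1%:C * z^*.
have uz : u * z = (normc z)%:C.
  rewrite /u -mulrA [z^* * z]mulrC -sqr_normcE -rmorphM /=; congr (_%:C).
  by rewrite expr2 mulKf.
have u1 : normc u = 1.
  by rewrite /u normcM normcJ normc_real ger0_norm ?invr_ge0 ?normc_ge0// mulVf.
have -> : normc z = complex.Re (cintegral (fun x => u * f x)) by rewrite cintegralZ// -/z uz.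
apply: le_expect => //; first exact: (cbmeasZ u bf).1.
move=> x; apply: le_trans (fg x); apply: le_trans (ler_norm _) _.
by apply: le_trans (Re_le_normc _) _; rewrite normcM u1 mul1r.
Qed.

Lemma expcD (s t : R) : expc (s + t) = expc s * expc t.
Proof.
by apply/eqP; rewrite /expc mulrDr cosD sinD eq_complex /= eqxx addrC eqxx.
Qed.

Lemma expc0 : expc (0 : R) = 1.
Proof. by rewrite /expc mulr0 cos0 sin0. Qed.

Lemma expcN (t : R) : expc (- t) = (expc t)^*.
Proof. by rewrite /expc mulrN cosN sinN. Qed.

Lemma normc_expc (t : R) : normc (expc t) = 1.
Proof. by rewrite /= cos2Dsin2 sqrtr1. Qed.

Lemma expc_int (k : int) : expc (k%:~R : R) = 1.
Proof. by rewrite /expc cos_int sin_int. Qed.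

Definition chi h : func := fun x => expc (dot h x).

Lemma measurable_dot h : measurable_fun setT (dot h : point -> R).
Proof.
apply: measurable_sum => i; apply: measurable_funM => //; exact: measurable_tnth.
Qed.

Lemma cbmeas_chi h : cbmeas (chi h).
Proof.
have m2 : measurable_fun setT (fun x : point => 2 * pi * dot h x).
  by apply: measurable_funM => //; exact: measurable_dot.
by split; [exact: bmeas_cos|exact: bmeas_sin].
Qed.

Definition freqD h k : freq := [tuple tnth h i + tnth k i | i < d].
Definition freqN h : freq := [tuple - tnth h i | i < d].
Definition freq0 : freq := [tuple 0 | i < d].

Lemma chiD h k x : chi (freqD h k) x = chi h x * chi k x.
Proof.
rewrite -expcD; congr expc; rewrite -big_split /=; apply: eq_bigr => i _.
by rewrite tnth_mktuple intrD mulrDl.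
Qed.

Lemma dotN h x : dot (freqN h) x = - dot h x :> R.
Proof.
by rewrite -sumrN; apply: eq_bigr => i _; rewrite tnth_mktuple mulrNz mulNr.
Qed.

Lemma chiN h x : chi (freqN h) x = (chi h x)^*.
Proof. by rewrite /chi dotN expcN. Qed.

Lemma chi0 x : chi freq0 x = 1.
Proof.
by rewrite /chi /dot big1 ?expc0// => i _; rewrite tnth_mktuple mul0r.
Qed.

Lemma freqD_N h k : (freqD h (freqN k) == freq0) = (h == k).
Proof.
apply/eqP/eqP => [hk|->].
  apply: eq_from_tnth => i; have := congr1 (fun t => tnth t i) hk.
  by rewrite !tnth_mktuple => /eqP; rewrite subr_eq0 => /eqP.
by apply: eq_from_tnth => i; rewrite !tnth_mktuple subrr.
Qed.

Lemma normc_chi h x : normc (chi h x) = 1.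
Proof. exact: normc_expc. Qed.

Lemma periodic_chi h : Defs.periodic (chi h).
Proof.
move=> x k; rewrite /chi -[RHS]mulr1.
have -> : 1 = expc ((\sum_(i < d) tnth h i * tnth k i)%:~R : R) by rewrite expc_int.
rewrite -expcD; congr expc; rewrite rmorph_sum -big_split /=; apply: eq_bigr => i _.
by rewrite tnth_mktuple mulrDr rmorphM.
Qed.

End ComplexIntegral.

(** * Characters and Fourier coefficients *)

Section Orthogonality.
Local Open Scope classical_set_scope.
Local Open Scope ring_scope.
Local Open Scope complex_scope.
Context {R : realType}.
Local Notation unif := (uniform_prob (@ltr01 R)).

Lemma freq0P d (h : d.-tuple int) : reflect (forall i, tnth h i = 0) (h == freq0).
Proof.
apply: (iffP eqP) => [-> i|h0]; first by rewrite tnth_mktuple.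
by apply: eq_from_tnth => i; rewrite h0 tnth_mktuple.
Qed.

Lemma dot_cons d (h0 : int) (h : d.-tuple int) (x0 : R) (x : d.-tuple R) :
  dot [tuple of h0 :: h] [tuple of x0 :: x] = h0%:~R * x0 + dot h x.
Proof.
by rewrite /dot big_ord_recl !tnth0; congr (_ + _); apply: eq_bigr => i _; rewrite !tnthS.
Qed.

(** Both integrals go through the same induction, since the addition formulas express each of them
    by the inner integrals of cosine and sine together. *)
Lemma expect_cos_sin_dot d (h : d.-tuple int) :
  \int[cube d]_x cos (2 * pi * dot h x) = (h == freq0)%:R :> R /\
  \int[cube d]_x sin (2 * pi * dot h x) = 0 :> R.
Proof.
elim: d h => [|d IH] h.
  have dot0 (x : 0.-tuple R) : dot h x = 0 by rewrite /dot big_ord0.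
  have -> : h == freq0 by apply/freq0P => -[].
  split; under eq_Rintegral do rewrite dot0 mulr0 ?cos0 ?sin0.
    by rewrite (expect_cst (cube 0)).
  by rewrite (expect_cst (cube 0)).
case/tupleP: h => h0 h.
have {IH} [IHc IHs] := IH h.
have bc : bmeas (fun y => cos (2 * pi * dot h y)) := (cbmeas_chi h).1.
have bs : bmeas (fun y => sin (2 * pi * dot h y)) := (cbmeas_chi h).2.
have bZ (a : R) (u : d.-tuple R -> R) : bmeas u -> bmeas (fun x => a * u x).
  by move=> bu; apply: bmeasM => //; exact: bmeas_cst.
have h0E : ([tuple of h0 :: h] == freq0) = (h0 == 0) && (h == freq0).
  apply/freq0P/andP => [h00|[/eqP -> /freq0P h00] i]; last first.
    by have [j ->|->] := unliftP ord0 i; rewrite ?tnthS ?tnth0.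
  split; first by have /eqP := h00 ord0; rewrite tnth0.
  by apply/freq0P => i; have := h00 (lift ord0 i); rewrite tnthS.
have m1 : measurable_fun setT (fun x : measurableTypeR R => 2 * pi * (h0%:~R * x)).
  by do 2!apply: measurable_funM => //.
have bc1 : bmeas (fun x : measurableTypeR R => cos (2 * pi * (h0%:~R * x))) by exact: bmeas_cos.
have bs1 : bmeas (fun x : measurableTypeR R => sin (2 * pi * (h0%:~R * x))) by exact: bmeas_sin.
split.
- rewrite cube_fubini; last exact: (cbmeas_chi [tuple of h0 :: h]).1.
  rewrite (@eq_Rintegral _ _ _ unif _
    (fun x => (h == freq0)%:R * cos (2 * pi * (h0%:~R * x)))); last first.
    move=> x _.
    under eq_Rintegral do rewrite dot_cons mulrDr cosD.
    rewrite expectB; [|exact: bZ|exact: bZ].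
    rewrite !expectZ; [|exact: bs|exact: bc].
    rewrite (congr1 (fun z => _ * z - _) IHc) (congr1 (fun z => _ - _ * z) IHs).
    by rewrite mulr0 subr0 mulrC.
  rewrite [LHS](@expectZ _ (measurableTypeR R) R unif _ _ bc1).
  by rewrite (expect_unif_cos h0) h0E -natrM mulnb andbC.
- rewrite cube_fubini; last exact: (cbmeas_chi [tuple of h0 :: h]).2.
  rewrite (@eq_Rintegral _ _ _ unif _
    (fun x => (h == freq0)%:R * sin (2 * pi * (h0%:~R * x)))); last first.
    move=> x _.
    under eq_Rintegral do rewrite dot_cons mulrDr sinD.
    rewrite expectD; [|exact: bZ|exact: bZ].
    rewrite !expectZ; [|exact: bs|exact: bc].
    rewrite (congr1 (fun z => _ * z + _) IHc) (congr1 (fun z => _ + _ * z) IHs).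
    by rewrite mulr0 addr0 mulrC.
  rewrite [LHS](@expectZ _ (measurableTypeR R) R unif _ _ bs1).
  by rewrite (expect_unif_sin h0) mulr0.
Qed.

Lemma cintegral_chi d (h : d.-tuple int) :
  cintegral (chi h) = (h == freq0)%:R :> R[i].
Proof.
have [hc hs] := expect_cos_sin_dot h.
rewrite /cintegral [X in X +i* _]hc [X in _ +i* X]hs.
by case: (h == freq0).
Qed.

Lemma two_pi_in_0pi (y : R) : 0 <= y -> y <= 2^-1 -> 2 * pi * y \in `[0, pi].
Proof.
move=> y0 y2; have p0 := @pi_ge0 R; rewrite in_itv /=; apply/andP; split.
  by rewrite !mulr_ge0.
have : 0 <= pi * (2^-1 - y) by rewrite mulr_ge0// subr_ge0.
by nra.
Qed.

(** The hypothesis keeps |t| away from 0 and from 1, where cos (2 pi t) returns to its maximum.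
    Cosine decreases on the first half period, and the second half is reflected by t -> 1 - t. *)
Lemma ler_cos_far (delta t : R) : 0 <= delta -> delta <= `|t| <= 1 - delta ->
  cos (2 * pi * t) <= cos (2 * pi * delta).
Proof.
move=> d0 /andP[dt td].
have pi0 : 0 < 2 * pi :> R by rewrite mulr_gt0// pi_gt0.
have key (s : R) : delta <= s -> s <= 2^-1 -> cos (2 * pi * s) <= cos (2 * pi * delta).
  move=> ds s2.
  have s0 : 0 <= s := le_trans d0 ds.
  have := @ltr_cos R _ _ (two_pi_in_0pi s0 s2) (two_pi_in_0pi d0 (le_trans ds s2)).
  by rewrite leNgt => ->; rewrite ltr_pM2l// -leNgt.
have -> : cos (2 * pi * t) = cos (2 * pi * `|t|).
  by have [t0|t0] := lerP 0 t; rewrite ?(ger0_norm t0) ?(ltr0_norm t0) // mulrN cosN.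
have [t2|t2] := leP `|t| 2^-1; first exact: key.
have -> : cos (2 * pi * `|t|) = cos (2 * pi * (1 - `|t|)).
  have -> : 2 * pi * (1 - `|t|) = - (2 * pi * `|t|) + pi *+ 2 by rewrite mulr2n; ring.
  by rewrite cosD2pi cosN.
by apply: key; [lra|lra].
Qed.

Lemma cos_lt1 (t : R) : 0 < `|t| < 1 -> cos (2 * pi * t) < 1.
Proof.
move=> /andP[t0 t1]; pose delta := Num.min `|t| (1 - `|t|).
have d0 : 0 < delta by rewrite lt_min t0 subr_gt0.
have d2 : delta <= 2^-1.
  by rewrite ge_min; have [//|t2] := leP `|t| 2^-1; rewrite orFb; lra.
apply: (@le_lt_trans _ _ (cos (2 * pi * delta))).
  apply: ler_cos_far; first exact: ltW.
  by rewrite ge_min lexx/= lerBrDr -lerBrDl ge_min lexx orbT.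
rewrite -[ltRHS]cos0.
have pi0 : 0 < 2 * pi :> R by rewrite mulr_gt0// pi_gt0.
have in0 : (0 : R) \in `[0, pi] by rewrite in_itv /= lexx pi_ge0.
by rewrite (ltr_cos in0 (two_pi_in_0pi (ltW d0) d2)) mulr_gt0.
Qed.

Lemma expc_neq1 (t : R) : 0 < `|t| < 1 -> expc t != 1.
Proof.
move=> /cos_lt1 ct; apply/eqP => /(congr1 (@complex.Re R)) /= e.
by rewrite e ltxx in ct.
Qed.

Lemma expc_sum I (s : seq I) (p : pred I) (F : I -> R) :
  expc (\sum_(i <- s | p i) F i) = \prod_(i <- s | p i) expc (F i).
Proof. exact: (big_morph _ expcD expc0). Qed.

Lemma expcMn (t : R) n : expc (t * n%:R) = expc t ^+ n.
Proof.
by elim: n => [|n IH]; rewrite ?mulr0 ?expc0// -natr1 mulrDr mulr1 expcD IH exprSr.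
Qed.

Section Grid.
Variables (d q : nat).
Hypothesis q0 : (0 < q)%N.

Definition grid_node (p : {ffun 'I_d -> 'I_q}) : d.-tuple R :=
  [tuple (p i)%:R / q%:R | i < d].

Lemma torus_grid_node p : torus (grid_node p).
Proof.
move=> i; rewrite tnth_mktuple divr_ge0//= ltr_pdivrMr ?ltr0n// mul1r ltr_nat.
exact: ltn_ord.
Qed.

(** The sum is a product of geometric sums. In a coordinate with h_i nonzero the ratio z satisfies
    z^q = 1, and |h_i| < q excludes z = 1, so that factor vanishes. *)
Lemma sum_chi_grid (h : d.-tuple int) : (forall i, (`|tnth h i| < q)%N) ->
  \sum_p chi h (grid_node p) = #|{ffun 'I_d -> 'I_q}|%:R * (h == freq0)%:R :> R[i].
Proof.
move=> hq.
have [->|hn0] := eqVneq h freq0.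
  under eq_bigr do rewrite chi0.
  by rewrite sumr_const mulr1; congr (_ *+ _); apply: eq_card.
rewrite mulr0.
pose z i : R[i] := expc ((tnth h i)%:~R / q%:R).
have -> : \sum_p chi h (grid_node p) = \sum_(p : {ffun 'I_d -> 'I_q}) \prod_i z i ^+ p i.
  apply: eq_bigr => p _; rewrite /chi /dot expc_sum; apply: eq_bigr => i _.
  by rewrite tnth_mktuple -expcMn; congr expc; rewrite mulrCA mulrC.
rewrite -(bigA_distr_bigA (fun i j => z i ^+ nat_of_ord j)) /=.
have [i hi] : exists i, tnth h i != 0.
  by apply/existsP; rewrite -negb_forall; apply: contra hn0 => /forallP h0; apply/freq0P => i; apply/eqP.
rewrite (bigD1 i)//= [X in X * _](_ : _ = 0) ?mul0r//.
have z1 : z i != 1.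
  apply: expc_neq1; apply/andP; split.
    by rewrite normr_gt0 mulf_neq0 ?invr_neq0 ?pnatr_eq0 -?lt0n ?intr_eq0.
  rewrite normrM normfV [X in _ / X]ger0_norm// ltr_pdivrMr ?ltr0n// mul1r.
  by rewrite -intr_norm -[q%:R]/(q%:~R) ltr_int -abszE ltz_nat hq.
apply: (@mulfI _ (z i - 1)); first by rewrite subr_eq0.
rewrite mulr0 -subrX1 -expcMn divfK ?pnatr_eq0 -?lt0n//.
by rewrite expc_int subrr.
Qed.

End Grid.
End Orthogonality.

(** * Continuity, measurability and periodicity on tuples *)

Section Continuity.
Local Open Scope classical_set_scope.
Local Open Scope ring_scope.
Local Open Scope complex_scope.
Context {R : realType} {d : nat}.
Local Notation point := (d.-tuple R).
Local Notation freq := (d.-tuple int).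
Local Notation func := (point -> R[i]).
Local Notation normc := Normc.normc.
Implicit Types (u w : point -> R) (f g : func) (h k : freq) (x y : point).

Definition tuple_rv (v : 'rV[R]_d) : point := [tuple v ord0 i | i < d].
Definition rv_tuple x : 'rV[R]_d := \row_i tnth x i.

Lemma rv_tupleK : cancel rv_tuple tuple_rv.
Proof. by move=> x; apply: eq_from_tnth => i; rewrite tnth_mktuple mxE. Qed.

Definition near_pt x (e : R) y := forall i, `|tnth y i - tnth x i| < e.

Lemma continuous_tupleP u : continuous (fun v : 'rV[R]_d => u (tuple_rv v)) <->
  forall x (e : R), 0 < e -> exists2 delta : R, 0 < delta &
    forall y, near_pt x delta y -> `|u y - u x| < e.
Proof.
split=> [cu x e e0|cu v].
  have /cvgrPdist_lt/(_ e e0)/nbhs_ballP[delta /= d0 H] := cu (rv_tuple x).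
  exists delta => // y xy; rewrite distrC -[in u x](rv_tupleK x) -[in u y](rv_tupleK y).
  apply: H; split => // i j; rewrite !mxE /ball /= distrC; exact: xy.
move=> A /nbhs_ballP[e /= e0 eA].
have [delta d0 H] := cu (tuple_rv v) e e0.
apply/nbhs_ballP; exists delta => //= z [_ vz]; apply: eA.
rewrite /ball /= distrC; apply: H => i.
by rewrite !tnth_mktuple distrC; exact: vz.
Qed.

(** The sigma-algebra on tuples comes from the coordinates, not from open sets; an open preimage is
    therefore written as the union of the countably many rational boxes that it contains. *)
Lemma continuous_tuple_measurable u :
  continuous (fun v : 'rV[R]_d => u (tuple_rv v)) -> measurable_fun setT u.
Proof.
move=> /continuous_tupleP cu.
apply: (measurability _ (RGenOpens.measurableE R)) => _ [_ [a [b ->] <-]].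
rewrite setTI.
pose box (p : d.-tuple rat * d.-tuple rat) : set point :=
  [set y | forall i, `](ratr (tnth p.1 i)), (ratr (tnth p.2 i))[%classic (tnth y i)].
pose good := [set p | box p `<=` u @^-1` `]a, b[].
have -> : u @^-1` `]a, b[ = \bigcup_p (if p \in good then box p else set0).
  apply/seteqP; split => [x /=|x [p _]]; last first.
    by case: ifPn => //; rewrite inE => /[apply].
  rewrite in_itv /= => /andP[ax xb].
  have e0 : 0 < Num.min (u x - a) (b - u x) by rewrite lt_min !subr_gt0 ax xb.
  have [delta d0 H] := cu x _ e0.
  have lowx (i : 'I_d) : exists q : rat, tnth x i - delta < ratr q < tnth x i.
    have /rat_in_itvoo[q] : tnth x i - delta < tnth x i by rewrite ltrBlDr ltrDl.
    by rewrite in_itv /= => qi; exists q.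
  have highx (i : 'I_d) : exists q : rat, tnth x i < ratr q < tnth x i + delta.
    have /rat_in_itvoo[q] : tnth x i < tnth x i + delta by rewrite ltrDl.
    by rewrite in_itv /= => qi; exists q.
  pose p := ([tuple xchoose (lowx i) | i < d], [tuple xchoose (highx i) | i < d]).
  exists p => //.
  have xp : box p x.
    move=> i; rewrite /= in_itv /= !tnth_mktuple.
    by have /andP[_ ->] := xchooseP (lowx i); have /andP[-> _] := xchooseP (highx i).
  rewrite ifT // inE => y yp /=.
  have : `|u y - u x| < Num.min (u x - a) (b - u x).
    apply: H => i; have := yp i; rewrite /= in_itv /= !tnth_mktuple => /andP[y1 y2].
    have /andP[l1 l2] := xchooseP (lowx i); have /andP[h1 h2] := xchooseP (highx i).
    by rewrite ltr_norml; apply/andP; split; lra.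
  rewrite lt_min !ltr_norml in_itv /= => /andP[/andP[u1 u2] /andP[u3 u4]].
  by apply/andP; split; lra.
apply: countable_bigcupT_measurable; first exact: countableP.
move=> p; case: ifP => // _; apply: (@measurable_pi R d (fun i =>
  `](ratr (tnth p.1 i)), (ratr (tnth p.2 i))[%classic)) => i.
exact: measurable_itv.
Qed.

Lemma continuousC_measurable f : continuousC f -> Defs.measurableC f.
Proof.
move=> [f1 f2]; split.
  exact: (@continuous_tuple_measurable (fun x => complex.Re (f x))).
exact: (@continuous_tuple_measurable (fun x => complex.Im (f x))).
Qed.

Lemma continuous_tuple_bounded u :
  continuous (fun v : 'rV[R]_d => u (tuple_rv v)) ->
  exists L : R, forall x, (forall i, 0 <= tnth x i <= 1) -> `|u x| <= L.
Proof.
move=> cu.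
have cK := @rV_compact R d (fun=> `[0, 1]%classic) (fun=> @segment_compact R 0 1).
have /compact_bounded[L [_ HL]] := continuous_compact (continuous_subspaceT cu) cK.
exists (L + 1) => x x01; apply: HL; first by rewrite ltrDl.
exists (rv_tuple x); last by rewrite rv_tupleK.
by move=> i; rewrite /= mxE in_itv /=.
Qed.

Lemma periodic_reduce f x : Defs.periodic f ->
  exists y, (forall i, 0 <= tnth y i < 1) /\ f y = f x.
Proof.
move=> pf; pose k : freq := [tuple - Num.floor (tnth x i) | i < d].
exists [tuple tnth x i + (tnth k i)%:~R | i < d]; split; last exact: pf.
move=> i; rewrite !tnth_mktuple mulrNz subr_ge0 ltrBlDr.
by rewrite floor_le addrC -[1]/(1%:~R) -intrD floorD1_gt.
Qed.

Lemma cbmeas_periodic f : Defs.periodic f -> continuousC f -> cbmeas f.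
Proof.
move=> pf cf; apply: cbmeasP; first exact: continuousC_measurable.
have [L1 H1] := @continuous_tuple_bounded (fun x => complex.Re (f x)) cf.1.
have [L2 H2] := @continuous_tuple_bounded (fun x => complex.Im (f x)) cf.2.
exists (L1 + L2) => x; have [y [y01 <-]] := periodic_reduce x pf.
have y01' i : 0 <= tnth y i <= 1 by have /andP[-> /ltW ->] := y01 i.
by rewrite (le_trans (normc_le_ReIm _))// lerD ?H1 ?H2.
Qed.

Lemma continuousCP f : continuousC f <->
  forall x (e : R), 0 < e -> exists2 delta : R, 0 < delta &
    forall y, near_pt x delta y -> normc (f y - f x) < e.
Proof.
split=> [[c1 c2] x e e0|cf].
  move: c1 c2 => /(@continuous_tupleP (fun x => complex.Re (f x))) c1.
  move=> /(@continuous_tupleP (fun x => complex.Im (f x))) c2.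
  have e20 : 0 < e / 2 by rewrite divr_gt0.
  have [d1 d10 H1] := c1 x _ e20; have [d2 d20 H2] := c2 x _ e20.
  exists (Num.min d1 d2) => [|y xy]; first by rewrite lt_min d10.
  apply: le_lt_trans (normc_le_ReIm _) _; rewrite (splitr e) ltrD//.
    have : `|complex.Re (f y) - complex.Re (f x)| < e / 2.
      by apply: H1 => i; have := xy i; rewrite lt_min => /andP[].
    by case: (f y) (f x) => a b [a' b'].
  have : `|complex.Im (f y) - complex.Im (f x)| < e / 2.
    by apply: H2 => i; have := xy i; rewrite lt_min => /andP[].
  by case: (f y) (f x) => a b [a' b'].
split.
  apply/(@continuous_tupleP (fun x => complex.Re (f x))) => x e e0.
  have [delta d0 H] := cf x e e0; exists delta => // y /H; apply: le_lt_trans.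
  by apply: le_trans (Re_le_normc _); case: (f y) (f x) => a b [a' b'].
apply/(@continuous_tupleP (fun x => complex.Im (f x))) => x e e0.
have [delta d0 H] := cf x e e0; exists delta => // y /H; apply: le_lt_trans.
by apply: le_trans (Im_le_normc _); case: (f y) (f x) => a b [a' b'].
Qed.

Lemma continuousC_cst c : continuousC (fun _ : point => c).
Proof. by apply/continuousCP => x e e0; exists 1 => // y _; rewrite subrr normc0. Qed.

Lemma continuousCD f g : continuousC f -> continuousC g -> continuousC (fun x => f x + g x).
Proof.
move=> /continuousCP cf /continuousCP cg; apply/continuousCP => x e e0.
have e20 : 0 < e / 2 by rewrite divr_gt0.
have [d1 d10 H1] := cf x _ e20; have [d2 d20 H2] := cg x _ e20.
exists (Num.min d1 d2) => [|y xy]; first by rewrite lt_min d10.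
rewrite opprD addrACA (splitr e); apply: le_lt_trans (normcD _ _) _; rewrite ltrD//.
  by apply: H1 => i; have := xy i; rewrite lt_min => /andP[].
by apply: H2 => i; have := xy i; rewrite lt_min => /andP[].
Qed.

Lemma continuousCZ c f : continuousC f -> continuousC (fun x => c * f x).
Proof.
move=> /continuousCP cf; apply/continuousCP => x e e0.
have c0 : 0 < normc c + 1 by rewrite ltr_wpDl ?normc_ge0.
have e20 : 0 < e / (normc c + 1) by rewrite divr_gt0.
have [delta d0 H] := cf x _ e20; exists delta => // y /H.
rewrite ltr_pdivlMr// -mulrBr normcM; apply: le_lt_trans.
by rewrite mulrC ler_wpM2l ?normc_ge0// lerDl.
Qed.

Lemma continuousC_sum I (s : seq I) (p : pred I) (F : I -> func) :
  (forall i, continuousC (F i)) -> continuousC (fun x => \sum_(i <- s | p i) F i x).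
Proof.
move=> cF; elim: s => [|i s IH].
  by under [X in continuousC X]eq_fun do rewrite big_nil; exact: continuousC_cst.
under [X in continuousC X]eq_fun do rewrite big_cons.
by case: (p i) => //; exact: continuousCD.
Qed.

Lemma continuousC_chi h : continuousC (chi h : func).
Proof.
have cdot : continuous (fun v : 'rV[R]_d => 2 * pi * dot h (tuple_rv v)).
  apply/(@continuous_tupleP (fun x => 2 * pi * dot h x)) => x e e0.
  pose S : R := `|2 * pi| * \sum_(i < d) `|(tnth h i)%:~R|.
  have S0 : 0 < S + 1 by rewrite ltr_wpDl// mulr_ge0// sumr_ge0.
  exists (e / (S + 1)) => [|y xy]; first by rewrite divr_gt0.
  rewrite -mulrBr /dot -sumrB normrM.
  apply: (@le_lt_trans _ _ (S * (e / (S + 1)))); last first.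
    by rewrite mulrA ltr_pdivrMr// mulrC ltr_pM2l// ltrDl.
  rewrite -mulrA ler_wpM2l// mulr_suml (le_trans (ler_norm_sum _ _ _))//.
  by apply: ler_sum => i _; rewrite -mulrBr normrM ler_wpM2l// ltW.
split=> v.
  exact: (continuous_comp (cdot v) (@continuous_cos R _)).
exact: (continuous_comp (cdot v) (@continuous_sin R _)).
Qed.

Lemma near_pt_sub x e1 e2 y : e1 <= e2 -> near_pt x e1 y -> near_pt x e2 y.
Proof. by move=> e12 xy i; exact: lt_le_trans (xy i) e12. Qed.


End Continuity.

(** * Concentration of trigonometric bumps *)

Section Fejer.
Local Open Scope classical_set_scope.
Local Open Scope ring_scope.
Local Open Scope complex_scope.
Context {R : realType} {d : nat}.
Local Notation point := (d.-tuple R).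
Local Notation freq := (d.-tuple int).
Local Notation func := (point -> R[i]).
Local Notation normc := Normc.normc.
Hypothesis d0 : (0 < d)%N.
Implicit Types (f g : func) (h k : freq) (x y : point).

(* The powers of the bump concentrate at x: away from x on the cube it is at most 1 - kappa, near x
   it is at least 1 - kappa / 2. *)
Definition bump x y : R :=
  2^-1 + (2 * d%:R)^-1 * \sum_(i < d) cos (2 * pi * (tnth y i - tnth x i)).

Let dR0 : 0 < d%:R :> R.
Proof. by rewrite ltr0n. Qed.

Let sum_d (c : R) : (2 * d%:R)^-1 * \sum_(i < d) c = c / 2.
Proof.
by rewrite sumr_const card_ord -mulr_natr; field; rewrite gt_eqF.
Qed.

Lemma bump_ge x y (c : R) : (forall i, c <= cos (2 * pi * (tnth y i - tnth x i))) ->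
  2^-1 + c / 2 <= bump x y.
Proof.
by move=> H; rewrite lerD2l -sum_d ler_wpM2l ?ler_sum// invr_ge0 mulr_ge0.
Qed.

Lemma bump_ge0 x y : 0 <= bump x y.
Proof.
apply: le_trans (bump_ge (c := -1) _) => [|i]; last exact: cos_geN1.
by lra.
Qed.

Lemma bmeas_bump x : bmeas (bump x).
Proof.
apply: bmeasD; first exact: bmeas_cst.
apply: bmeasM; first exact: bmeas_cst.
apply: bmeas_sum => i; apply: bmeas_cos; apply: measurable_funM => //.
by apply: measurable_funB => //; exact: measurable_tnth.
Qed.

Lemma bump_le_far x y (delta : R) i : 0 <= delta ->
  delta <= `|tnth y i - tnth x i| <= 1 - delta ->
  bump x y <= 1 - (1 - cos (2 * pi * delta)) / (2 * d%:R).
Proof.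
move=> dl0 /(ler_cos_far dl0) far.
rewrite /bump (bigD1 i)//=.
apply: (@le_trans _ _ (2^-1 + (2 * d%:R)^-1 * (cos (2 * pi * delta) - 1 + \sum_(j < d) 1))).
  rewrite lerD2l ler_wpM2l ?invr_ge0 ?mulr_ge0//.
  rewrite [X in _ <= _ - 1 + X](bigD1 i)//= addrA subrK; apply: lerD => //; apply: ler_sum => j _.
  exact: cos_le1.
rewrite mulrDr sum_d; move: (cos _) dR0 => c; move: (d%:R) => D D0.
by rewrite le_eqVlt; apply/orP; left; apply/eqP; field; rewrite gt_eqF.
Qed.

Lemma bump_near x (kappa : R) : 0 < kappa -> exists2 delta : R, 0 < delta &
  forall y, near_pt x delta y -> 1 - kappa <= bump x y.
Proof.
move=> k0.
have : (fun t : R => cos (2 * pi * t)) @ (0 : R) --> cos (2 * pi * 0).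
  by apply: continuous_comp; [exact: mulrl_continuous|exact: continuous_cos].
rewrite mulr0 cos0 => /cvgrPdist_lt/(_ kappa k0)/nbhs_ballP[delta /= dl0 H].
exists delta => // y xy.
apply: (@le_trans _ _ (2^-1 + (1 - 2 * kappa) / 2)); first by lra.
apply: bump_ge => i; have := H (tnth y i - tnth x i).
rewrite /ball /= sub0r normrN => /(_ (xy i)); rewrite ltr_norml => /andP[_].
by lra.
Qed.

Lemma exists_expr_lt (q e : R) : 0 <= q -> q < 1 -> 0 < e -> exists n, q ^+ n < e.
Proof.
move=> q0 q1 e0.
have := @cvg_expr R q; rewrite ger0_norm// => /(_ q1)/cvgrPdist_lt/(_ e e0)[n _ H].
by exists n; have := H n (leqnn n); rewrite /= sub0r normrN ger0_norm// exprn_ge0.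
Qed.

(** On a small box A around x the integrand is at least e * q'^n; at other points near x it is
    nonnegative; far from x it is at least - L * q^n, where L bounds |psi|. Since q < q', the gain
    on A, of positive measure, dominates for large n. *)
Lemma bump_concentrates x (psi : point -> R) (e delta : R) :
  bmeas psi -> (forall i, 0 < tnth x i < 1) -> 0 < e -> 0 < delta ->
  (forall y, near_pt x delta y -> e <= psi y) ->
  exists n, 0 < \int[cube d]_y (psi y * bump x y ^+ n).
Proof.
(* With the cube of radius delta around x inside the unit cube, a point y of the open unit cube has
   coordinate distances below 1 - delta, so it cannot be close to x modulo 1 without being close to
   x. *)
move=> bpsi x01 e0; wlog [dl1 dlx] : delta / delta < 1 /\ forall i, delta <= tnth x i <= 1 - delta.
  move=> wl dl0 H.
  pose m := \big[Num.min/2^-1]_(i < d) Num.min (tnth x i) (1 - tnth x i).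
  have m0 : 0 < m.
    rewrite /m; elim/big_ind: _ => [|a b a0 b0|i _]; first by rewrite invr_gt0.
      by rewrite lt_min a0.
    by have /andP[x0 x1] := x01 i; rewrite lt_min x0 subr_gt0.
  apply: (wl (Num.min delta m)).
  - split; first by rewrite gt_min; apply/orP; right;
      rewrite (@le_lt_trans _ _ 2^-1)// ?bigmin_le_id//; lra.
    move=> i; have : m <= Num.min (tnth x i) (1 - tnth x i) by exact: bigmin_le_cond.
    rewrite le_min => /andP[mx1 mx2]; apply/andP; split.
      by rewrite ge_min mx1 orbT.
    by rewrite lerBrDr -lerBrDl ge_min mx2 orbT.
  - by rewrite lt_min dl0.
  - by move=> y xy; apply: H; apply: near_pt_sub xy; rewrite ge_min lexx.
move=> dl0 Hpsi.
have cdl : cos (2 * pi * delta) < 1 by apply: cos_lt1; rewrite gtr0_norm// dl0.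
pose kappa := (1 - cos (2 * pi * delta)) / (2 * d%:R).
have k0 : 0 < kappa by rewrite divr_gt0 ?subr_gt0 ?mulr_gt0.
have k1 : kappa <= 1.
  rewrite ler_pdivrMr ?mulr_gt0// mul1r.
  have d1 : 1 <= d%:R :> R by rewrite ler1n.
  by have := cos_geN1 (2 * pi * delta); lra.
have k20 : 0 < kappa / 2 by rewrite divr_gt0.
have [delta1 dl10 Hnear] := bump_near x k20.
pose dl := Num.min delta delta1.
have dlp : 0 < dl by rewrite lt_min dl0.
pose A := [set y | forall i,
  tnth [tuple tnth x i - dl | i < d] i < tnth y i < tnth [tuple tnth x i + dl | i < d] i].
have mA : measurable A.
  rewrite (_ : A = [set y | forall i, `](tnth [tuple tnth x i - dl | i < d] i),
    (tnth [tuple tnth x i + dl | i < d] i)[%classic (tnth y i)]).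
    apply: (@measurable_pi R d (fun i => `](tnth [tuple tnth x i - dl | i < d] i),
      (tnth [tuple tnth x i + dl | i < d] i)[%classic)) => i; exact: measurable_itv.
  by apply/seteqP; split => y /= + i => /(_ i); rewrite in_itv.
have Anear y : A y -> near_pt x dl y.
  move=> Ay i; have := Ay i; rewrite !tnth_mktuple => /andP[y1 y2].
  by rewrite ltr_norml; apply/andP; split; lra.
have dldelta : dl <= delta by rewrite ge_min lexx.
have muA : 0 < fine (cube d A).
  apply: cube_box_gt0 => i; rewrite !tnth_mktuple; have /andP[? ?] := dlx i; lra.
have [L0 HL0] := bpsi.2; pose L := Num.max L0 1.
have L1 : 0 < L by rewrite lt_max ltr01 orbT.
have HL y : `|psi y| <= L by rewrite le_max HL0.
set q := 1 - kappa; set q' := 1 - kappa / 2.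
have q0 : 0 <= q by rewrite subr_ge0.
have q'0 : 0 < q' by rewrite /q'; lra.
have qq' : q / q' < 1 by rewrite ltr_pdivrMr// mul1r /q /q'; lra.
have emu : 0 < e * fine (cube d A) / L by rewrite divr_gt0// mulr_gt0.
have [n Hn] := exists_expr_lt (divr_ge0 q0 (ltW q'0)) qq' emu.
exists n.
have bn : bmeas (fun y => bump x y ^+ n) by apply: bmeasX; exact: bmeas_bump.
have bA : bmeas (fun y => e * q' ^+ n * \1_A y - L * q ^+ n).
  by apply: bmeasB; [apply: bmeasM; [exact: bmeas_cst|exact: bmeas_indic]|exact: bmeas_cst].
have : \int[cube d]_y (e * q' ^+ n * \1_A y - L * q ^+ n) <= \int[cube d]_y (psi y * bump x y ^+ n).
  apply: le_expect_ae => //; first exact: bmeasM.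
  apply: filterS (ae_cube_oo d) => y y01.
  have Tn0 : 0 <= bump x y ^+ n by rewrite exprn_ge0// bump_ge0.
  have Lq0 : 0 <= L * q ^+ n by rewrite mulr_ge0 ?exprn_ge0// ltW.
  rewrite indicE; have [/set_mem Ay|nAy] := boolP (y \in A).
    have nearA := Anear _ Ay.
    rewrite mulr1 lerBlDr ler_wpDr// ler_pM//; first exact: ltW.
    - by rewrite exprn_ge0// ltW.
    - by apply: Hpsi; exact: near_pt_sub nearA.
    - apply: lerXn2r; [by rewrite nnegrE ltW|by rewrite nnegrE bump_ge0|].
      apply: Hnear; apply: near_pt_sub nearA.
      by rewrite ge_min lexx orbT.
  rewrite mulr0 sub0r.
  have [yn|yn] := pselect (near_pt x delta y).
    rewrite (@le_trans _ _ 0) ?oppr_le0// mulr_ge0// (le_trans (ltW e0))//; exact: Hpsi.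
  have [i yi] : exists i, delta <= `|tnth y i - tnth x i|.
    apply: contrapT => /forallNP H; apply: yn => i.
    by rewrite ltNge; apply/negP; exact: H.
  have bq : bump x y <= q.
    apply: (@bump_le_far _ _ _ i); [exact: ltW|rewrite yi/= ler_norml].
    have /andP[? ?] := y01 i; have /andP[? ?] := dlx i.
    by apply/andP; split; lra.
  have : `|psi y * bump x y ^+ n| <= L * q ^+ n.
    rewrite normrM ler_pM// ger0_norm//.
    by apply: lerXn2r; rewrite ?nnegrE ?bump_ge0.
  by rewrite ler_norml => /andP[].
rewrite expectB; [|by apply: bmeasM; [exact: bmeas_cst|exact: bmeas_indic]|exact: bmeas_cst].
rewrite expectZ; last exact: bmeas_indic.
rewrite (expect_cst (cube d)) expect_indic//; apply: lt_le_trans.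
move: Hn; rewrite expr_div_n ltr_pdivrMr ?exprn_gt0// mulrAC ltr_pdivlMr// => Hn.
by rewrite subr_gt0 mulrC (lt_le_trans Hn)// mulrAC.
Qed.

End Fejer.

(** * Fourier coefficients and pointwise bounds *)

Section FourierSeries.
Local Open Scope classical_set_scope.
Local Open Scope ring_scope.
Local Open Scope complex_scope.
Context {R : realType} {d : nat}.
Local Notation point := (d.-tuple R).
Local Notation freq := (d.-tuple int).
Local Notation func := (point -> R[i]).
Local Notation normc := Normc.normc.
Implicit Types (f g p : func) (h k : freq) (x y : point).

Lemma fourierE f h : fourier f h = cintegral (fun x => f x * chi (freqN h) x).
Proof.
congr cintegral; apply/funext => x; congr (_ * _).
by rewrite /chi dotN.
Qed.

Lemma fourierD f g h : cbmeas f -> cbmeas g ->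
  fourier (fun x => f x + g x) h = fourier f h + fourier g h.
Proof.
move=> bf bg; rewrite !fourierE -cintegralD; [|by apply: cbmeasM => //; exact: cbmeas_chi..].
by congr cintegral; apply/funext => x; rewrite mulrDl.
Qed.

Lemma fourierZ c f h : cbmeas f -> fourier (fun x => c * f x) h = c * fourier f h.
Proof.
move=> bf; rewrite !fourierE -cintegralZ; last by apply: cbmeasM => //; exact: cbmeas_chi.
by congr cintegral; apply/funext => x; rewrite mulrA.
Qed.

Lemma fourierB f g h : cbmeas f -> cbmeas g ->
  fourier (fun x => f x - g x) h = fourier f h - fourier g h.
Proof.
move=> bf bg.
rewrite -[- fourier g h]mulN1r -fourierZ// -fourierD//; last exact: cbmeasZ.
by congr (fourier _ h); apply/funext => x; rewrite mulN1r.
Qed.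

Lemma fourier_chi k h : fourier (chi k : func) h = (k == h)%:R.
Proof.
rewrite fourierE -freqD_N -cintegral_chi; congr cintegral.
by apply/funext => x; rewrite chiD.
Qed.

Lemma fourier_sum I (s : seq I) (P : pred I) (F : I -> func) h :
  (forall i, cbmeas (F i)) ->
  fourier (fun x => \sum_(i <- s | P i) F i x) h = \sum_(i <- s | P i) fourier (F i) h.
Proof.
move=> bF; rewrite fourierE; under [RHS]eq_bigr do rewrite fourierE.
rewrite -cintegral_sum; last by move=> i; apply: cbmeasM => //; exact: cbmeas_chi.
by congr cintegral; apply/funext => x; rewrite mulr_suml.
Qed.

Lemma normc_fourier_le f (g : point -> R) h : cbmeas f -> bmeas g ->
  (forall x, normc (f x) <= g x) -> normc (fourier f h) <= \int[cube d]_x g x.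
Proof.
move=> bf bg fg; rewrite fourierE; apply: normc_cintegral_le => //.
  by apply: cbmeasM => //; exact: cbmeas_chi.
by move=> x; rewrite normcM normc_chi mulr1.
Qed.

Lemma fourier_trig (S : seq freq) (a : freq -> R[i]) h : uniq S ->
  fourier (fun x : point => \sum_(k <- S) a k * chi k x) h = if h \in S then a h else 0.
Proof.
move=> uS; rewrite fourier_sum; last by move=> k; apply: cbmeasZ; exact: cbmeas_chi.
under eq_bigr => k _ do rewrite (fourierZ _ _ (cbmeas_chi k)) fourier_chi.
case: ifPn => hS.
  rewrite (bigD1_seq h)//= eqxx mulr1 big1 ?addr0// => k kh.
  by rewrite (negPf kh) mulr0.
rewrite big_seq big1// => k kS; rewrite (_ : k == h = false) ?mulr0//.
by apply: contraNF hS => /eqP <-.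
Qed.

Definition trigpoly p := exists s : seq (R[i] * freq),
  forall x, p x = \sum_(q <- s) q.1 * chi q.2 x.

Lemma trigpolyD p1 p2 : trigpoly p1 -> trigpoly p2 -> trigpoly (fun x => p1 x + p2 x).
Proof. by move=> [s1 e1] [s2 e2]; exists (s1 ++ s2) => x; rewrite big_cat /= -e1 -e2. Qed.

Lemma trigpolyM p1 p2 : trigpoly p1 -> trigpoly p2 -> trigpoly (fun x => p1 x * p2 x).
Proof.
move=> [s1 e1] [s2 e2].
exists [seq (q1.1 * q2.1, freqD q1.2 q2.2) | q1 <- s1, q2 <- s2] => x.
rewrite big_allpairs_dep /= e1 e2 big_distrlr /=; apply: eq_bigr => q1 _.
by apply: eq_bigr => q2 _; rewrite chiD mulrACA.
Qed.

Lemma trigpoly_chi c h : trigpoly (fun x => c * chi h x).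
Proof. by exists [:: (c, h)] => x; rewrite big_seq1. Qed.

Lemma trigpoly_cst c : trigpoly (fun=> c).
Proof. by exists [:: (c, freq0)] => x; rewrite big_seq1 /= chi0 mulr1. Qed.

Lemma trigpoly_sum I (s : seq I) (P : pred I) (F : I -> func) :
  (forall i, trigpoly (F i)) -> trigpoly (fun x => \sum_(i <- s | P i) F i x).
Proof.
move=> tF; elim: s => [|i s IH].
  by under [X in trigpoly X]eq_fun do rewrite big_nil; exact: trigpoly_cst.
under [X in trigpoly X]eq_fun do rewrite big_cons.
by case: (P i) => //; exact: trigpolyD.
Qed.

Lemma trigpolyX p n : trigpoly p -> trigpoly (fun x => p x ^+ n).
Proof.
move=> tp; elim: n => [|n IH].
  by under [X in trigpoly X]eq_fun do rewrite expr0; exact: trigpoly_cst.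
by under [X in trigpoly X]eq_fun do rewrite exprS; exact: trigpolyM.
Qed.

Lemma cbmeas_trigpoly p : trigpoly p -> cbmeas p.
Proof.
move=> [s e]; rewrite (_ : p = fun x => \sum_(q <- s) q.1 * chi q.2 x); last exact/funext.
by apply: cbmeas_sum => q; apply: cbmeasZ; exact: cbmeas_chi.
Qed.

(** Merging the terms of equal frequency gives distinct frequencies, and then the coefficients are
    the Fourier coefficients. *)
Lemma trigpoly_fourier p : trigpoly p -> exists2 S : seq freq, uniq S &
  forall x, p x = \sum_(h <- S) fourier p h * chi h x.
Proof.
move=> [s e]; pose S := undup [seq q.2 | q <- s].
pose a h := \sum_(q <- s | q.2 == h) q.1.
have pE x : p x = \sum_(h <- S) a h * chi h x.
  rewrite e /a; under [RHS]eq_bigr do rewrite mulr_suml big_mkcond.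
  rewrite exchange_big /= big_seq [RHS]big_seq; apply: eq_bigr => q qs.
  rewrite (bigD1_seq q.2) ?undup_uniq ?mem_undup ?map_f//= eqxx big1 ?addr0// => h hq.
  by rewrite eq_sym (negPf hq).
exists S; first exact: undup_uniq.
move=> x; rewrite pE; apply: eq_big_seq => h hS.
by rewrite (_ : p = fun x => \sum_(h <- S) a h * chi h x) ?fourier_trig ?undup_uniq ?hS//;
    exact/funext.
Qed.

Lemma cos_expc (t : R) : (cos (2 * pi * t))%:C = (2^-1)%:C * (expc t + expc (- t)).
Proof.
rewrite expcN /expc; apply/eqP; rewrite eq_complex /=.
by apply/andP; split; apply/eqP; field.
Qed.

Definition freq_unit (i : 'I_d) : freq := [tuple (i == j)%:Z | j < d].

Lemma chi_unit i x : chi (freq_unit i) x = expc (tnth x i).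
Proof.
rewrite /chi /dot (bigD1 i)//= big1 => [|j ji].
  by rewrite tnth_mktuple eqxx mul1r addr0.
by rewrite tnth_mktuple eq_sym (negPf ji) mul0r.
Qed.

Lemma freqNK : involutive (freqN : freq -> freq).
Proof. by move=> h; apply: eq_from_tnth => i; rewrite !tnth_mktuple opprK. Qed.

Lemma trigpoly_bump x n : trigpoly (fun y => (bump x y ^+ n)%:C).
Proof.
under [X in trigpoly X]eq_fun do rewrite rmorphXn /=.
apply: trigpolyX.
rewrite (_ : (fun y => _) = fun y => (2^-1)%:C + ((2 * d%:R)^-1)%:C * \sum_(i < d)
   (2^-1)%:C * (expc (- tnth x i) * chi (freq_unit i) y +
                expc (tnth x i) * chi (freqN (freq_unit i)) y)).
  apply: trigpolyD; first exact: trigpoly_cst.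
  apply: trigpolyM; first exact: trigpoly_cst.
  apply: trigpoly_sum => i; apply: trigpolyM; first exact: trigpoly_cst.
  by apply: trigpolyD; exact: trigpoly_chi.
apply/funext => y; rewrite /bump rmorphD rmorphM /= rmorph_sum /=; congr (_ + _ * _).
apply: eq_bigr => i _; rewrite cos_expc chiN chi_unit -expcN -!expcD.
by rewrite opprB [- tnth x i + _]addrC.
Qed.

(* If |f x1| > B, then the integral of (Re (u f) - B) bump^n is positive for some n (u rotates f x1 to
   its modulus), whereas expanding bump^n into characters shows that it is at most 0. *)
Lemma normc_le_fourier_sums f (B : R) : (0 < d)%N -> Defs.periodic f -> continuousC f ->
  (forall S : seq freq, uniq S -> \sum_(h <- S) normc (fourier f h) <= B) ->
  forall x, normc (f x) <= B.
Proof.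
move=> d0 pf cf HB x; rewrite leNgt; apply/negP => Bx.
have bf := cbmeas_periodic pf cf.
have B0 : 0 <= B by have := HB [::] isT; rewrite big_nil.
(* Concentration is available at interior points only. Periodicity brings the point into the
   half-open cube, and a small shift towards the centre (1/2, ..., 1/2) makes it interior while
   continuity preserves the strict inequality. *)
have [x1 [x101 Bx1]] : exists x1, (forall i, 0 < tnth x1 i < 1) /\ B < normc (f x1).
  have [y [y01 fyx]] := periodic_reduce x pf; rewrite -fyx in Bx.
  have e0 : 0 < normc (f y) - B by rewrite subr_gt0.
  have [delta dl0 Hd] := (continuousCP f).1 cf y _ e0.
  pose t := Num.min (delta / 2) 2^-1.
  have t0 : 0 < t by rewrite lt_min; apply/andP; split; lra.
  have t1 : t <= 2^-1 by rewrite ge_min lexx orbT.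
  have td : t < delta by rewrite (@le_lt_trans _ _ (delta / 2))// ?ge_min ?lexx//; lra.
  pose z := [tuple (1 - t) * tnth y i + t / 2 | i < d].
  exists z; split=> [i|].
    by rewrite tnth_mktuple; have /andP[? ?] := y01 i; apply/andP; split; nra.
  have yz : near_pt y delta z.
    move=> i; rewrite tnth_mktuple; have /andP[? ?] := y01 i.
    by rewrite ltr_norml; apply/andP; split; nra.
  have := Hd z yz; have := normcD (f y - f z) (f z).
  by rewrite subrK -[f y - f z]opprB normcN; lra.
set v := f x1 in Bx1.
have v0 : normc v != 0 by rewrite gt_eqF// (le_lt_trans B0).
pose u : R[i] := (normc v)^-1%:C * v^*.
have uv : u * v = (normc v)%:C.
  rewrite /u -mulrA [v^* * v]mulrC -sqr_normcE -rmorphM /=; congr (_%:C).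
  by rewrite expr2 mulKf.
have u1 : normc u = 1.
  by rewrite /u normcM normcJ normc_real ger0_norm ?invr_ge0 ?normc_ge0// mulVf.
pose psi y := complex.Re (u * f y) - B.
have bpsi : bmeas psi by apply: bmeasB; [exact: (cbmeasZ u bf).1|exact: bmeas_cst].
have e0 : 0 < (normc v - B) / 2 by rewrite divr_gt0// subr_gt0.
have [delta dl0 Hd] := (continuousCP f).1 cf x1 _ e0.
have Hpsi y : near_pt x1 delta y -> (normc v - B) / 2 <= psi y.
  move=> /Hd fyv; have := Re_le_normc (u * (f y - v)).
  rewrite normcM u1 mul1r mulrBr uv ler_norml => /andP[+ _].
  have -> : complex.Re (u * f y - (normc v)%:C) = complex.Re (u * f y) - normc v.
    by case: (u * f y).
  by rewrite /psi; lra.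
have [n] := bump_concentrates d0 bpsi x101 e0 dl0 Hpsi.
apply/negP; rewrite -leNgt.
have bT : bmeas (fun y => bump x1 y ^+ n) by apply: bmeasX; exact: bmeas_bump.
have T0 y : 0 <= bump x1 y ^+ n by rewrite exprn_ge0// bump_ge0.
have tP := trigpoly_bump x1 n; have bP := cbmeas_trigpoly tP.
set P : func := fun y => _ in tP bP; have [S uS PS] := trigpoly_fourier tP.
have -> : \int[cube d]_y (psi y * bump x1 y ^+ n) =
    complex.Re (u * cintegral (fun y => f y * P y)) - B * \int[cube d]_y (bump x1 y ^+ n).
  rewrite -cintegralZ; last exact: cbmeasM.
  rewrite -expectZ// -expectB; [|by apply: (cbmeasZ u (cbmeasM bf bP)).1|].
    apply: eq_Rintegral => y _; rewrite /psi mulrBl; congr (_ - _).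
    by rewrite mulrA [RHS]ReM /P [X in _ = _ - _ * X]/= mulr0 subr0.
  by apply: bmeasM => //; exact: bmeas_cst.
rewrite subr_le0; apply: le_trans (ler_norm _) _; apply: le_trans (Re_le_normc _) _.
rewrite normcM u1 mul1r.
have -> : cintegral (fun y => f y * P y) = \sum_(h <- S) fourier P h * fourier f (freqN h).
  rewrite (_ : (fun y => _) = fun y => \sum_(h <- S) fourier P h * (f y * chi h y)); last first.
    by apply/funext => y; rewrite PS mulr_sumr; apply: eq_bigr => h _; rewrite mulrCA.
  rewrite cintegral_sum => [|h]; last by apply/cbmeasZ/cbmeasM => //; exact: cbmeas_chi.
  apply: eq_bigr => h _; rewrite cintegralZ ?fourierE ?freqNK//.
  by apply: cbmeasM => //; exact: cbmeas_chi.
apply: le_trans (normc_sum _ _ _) _.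
(* As the bump is nonnegative, each Fourier coefficient of its power is bounded in modulus by its
   integral, which factors out of the sum. *)
apply: (@le_trans _ _ (\int[cube d]_y (bump x1 y ^+ n) *
    \sum_(h <- map freqN S) normc (fourier f h))).
  rewrite big_map mulr_sumr; apply: ler_sum => h _; rewrite normcM ler_wpM2r ?normc_ge0//.
  by apply: normc_fourier_le => // y; rewrite normc_real ger0_norm.
rewrite mulrC ler_wpM2r//; last by apply: HB; rewrite map_inj_uniq//; exact: inv_inj freqNK.
by apply: Rintegral_ge0.
Qed.

End FourierSeries.

(** * The weighted space *)

#[local] Arguments Normc.normc : simpl never.
#[local] Arguments fourier : simpl never.
#[local] Arguments cintegral : simpl never.
#[local] Arguments expc : simpl never.

Section FiniteSums.
Local Open Scope classical_set_scope.
Local Open Scope ring_scope.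
Local Open Scope complex_scope.
Context {R : realType}.
Local Notation normc := Normc.normc.

Lemma esum_leP (T : choiceType) (a : T -> R) (B : R) : (forall x, 0 <= a x) ->
  (\esum_(x in [set: T]) (a x)%:E <= B%:E)%E <->
  (forall s : seq T, uniq s -> \sum_(x <- s) a x <= B).
Proof.
move=> a0; split=> [aB s us|H].
  rewrite -lee_fin -sumEFin fsbig_seq//; apply: le_trans aB.
  by apply: ereal_sup_ubound; exists [set` s] => //; split => //; exact: finite_set_seq.
apply: ge_ereal_sup => _ [A [fA _] <-].
by rewrite fsbig_finite//= sumEFin lee_fin; apply: H; exact: fset_uniq.
Qed.

Lemma cauchy_schwarz_seq I (s : seq I) (P : pred I) (a b : I -> R) :
  (\sum_(i <- s | P i) a i * b i) ^+ 2 <=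
  (\sum_(i <- s | P i) a i ^+ 2) * (\sum_(i <- s | P i) b i ^+ 2).
Proof.
set A := \sum_(i <- s | P i) a i ^+ 2; set B := \sum_(i <- s | P i) b i ^+ 2.
set X := \sum_(i <- s | P i) a i * b i.
have A0 : 0 <= A by apply: sumr_ge0 => i _; exact: sqr_ge0.
have B0 : 0 <= B by apply: sumr_ge0 => i _; exact: sqr_ge0.
have key t : 0 <= A - 2 * t * X + t ^+ 2 * B.
  have -> : A - 2 * t * X + t ^+ 2 * B = \sum_(i <- s | P i) (a i - t * b i) ^+ 2.
    rewrite /A /X /B !mulr_sumr -sumrB -big_split /=.
    by apply: eq_bigr => i _; ring.
  by apply: sumr_ge0 => i _; exact: sqr_ge0.
have [B00|Bn0] := eqVneq B 0.
  rewrite B00 mulr0.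
  have [->|Xn0] := eqVneq X 0; first by rewrite expr0n.
  have := key ((A + 1) / (2 * X)); rewrite B00 mulr0 addr0.
  have -> : A - 2 * ((A + 1) / (2 * X)) * X = -1 by field.
  by rewrite oppr_ge0 ler10.
have Bp : 0 < B by rewrite lt_def Bn0.
have := key (X / B).
have -> : A - 2 * (X / B) * X + (X / B) ^+ 2 * B = (A * B - X ^+ 2) / B by field.
by rewrite pmulr_lge0 ?invr_gt0// subr_ge0.
Qed.

Lemma normc_cauchy_schwarz I (s : seq I) (P : pred I) (a b : I -> R[i]) :
  normc (\sum_(i <- s | P i) a i * b i) ^+ 2 <=
  (\sum_(i <- s | P i) normc (a i) ^+ 2) * (\sum_(i <- s | P i) normc (b i) ^+ 2).
Proof.
apply: le_trans (cauchy_schwarz_seq _ _ _ _).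
rewrite ler_sqr ?nnegrE ?normc_ge0 ?sumr_ge0//; last first.
  by move=> i _; rewrite mulr_ge0 ?normc_ge0.
by rewrite (le_trans (normc_sum _ _ _))//; apply: ler_sum => i _; rewrite normcM.
Qed.

Lemma sqrtr_le (x c : R) : 0 <= c -> (Num.sqrt x <= c) = (x <= c ^+ 2).
Proof.
by move=> c0; rewrite -[in LHS](ger0_norm c0) -sqrtr_sqr ler_sqrt ?sqr_ge0.
Qed.

End FiniteSums.

Section WeightedSpace.
Local Open Scope classical_set_scope.
Local Open Scope ring_scope.
Local Open Scope complex_scope.
Context {R : realType} {d : nat}.
Local Notation point := (d.-tuple R).
Local Notation freq := (d.-tuple int).
Local Notation func := (point -> R[i]).
Local Notation normc := Normc.normc.
Implicit Types (f g p : func) (h k : freq) (x y : point).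
Variable r : freq -> R.
Hypothesis r_gt0 : forall h, 0 < r h.

(** A partial sum of the squared norm. [Hnorm_leP] and [Hnorm_ltyP] translate norm conditions into
    bounds on all such sums over duplicate-free lists, the form used from here on. *)
Definition energy f (s : seq freq) : R := \sum_(h <- s) r h * normc (fourier f h) ^+ 2.

Let r_ge0 h : 0 <= r h. Proof. exact: ltW. Qed.

Lemma Hnorm_leP f c : 0 <= c ->
  (Hnorm r f <= c%:E)%E <-> (forall s, uniq s -> energy f s <= c ^+ 2).
Proof.
move=> c0; rewrite /Hnorm.
have a0 h : 0 <= r h * normc (fourier f h) ^+ 2.
  by rewrite mulr_ge0// exprn_ge0// normc_ge0.
have := esum_leP (c ^+ 2) a0.
have : (0 <= \esum_(h in [set: freq]) (r h * normc (fourier f h) ^+ 2)%:E)%E.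
  by apply: esum_ge0 => h _; rewrite lee_fin.
case: (\esum_(h in _) _)%E => [x| |] x0 H; last by [].
  rewrite !lee_fin in x0 H; rewrite poweR_EFin lee_fin powR12_sqrt// sqrtr_le//.
by rewrite poweRyr ?invr_eq0.
Qed.

Lemma Hnorm_ltyP f : (Hnorm r f < +oo)%E <->
  exists2 c, 0 <= c & (forall s, uniq s -> energy f s <= c ^+ 2).
Proof.
split=> [fH|[c c0 H]]; last first.
  by apply: le_lt_trans (ltry c); apply/Hnorm_leP.
have H0 : (0 <= Hnorm r f)%E by exact: poweR_ge0.
exists (fine (Hnorm r f)); first exact: fine_ge0.
by apply/Hnorm_leP; rewrite ?fine_ge0// fineK// ge0_fin_numE.
Qed.

(** Cauchy-Schwarz after splitting each coefficient into the factors 1 / sqrt r and sqrt r. *)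
Lemma sum_normc_fourier_le f (s : seq freq) (P : pred freq) c eps : 0 <= c -> 0 <= eps ->
  energy f s <= c ^+ 2 -> \sum_(h <- s | P h) (r h)^-1 <= eps ^+ 2 ->
  \sum_(h <- s | P h) normc (fourier f h) <= eps * c.
Proof.
move=> c0 e0 fc se.
rewrite -ler_sqr ?nnegrE ?sumr_ge0 ?mulr_ge0// => [|h _]; last exact: normc_ge0.
rewrite (eq_bigr (fun h => Num.sqrt (r h)^-1 * (Num.sqrt (r h) * normc (fourier f h)))); last first.
  by move=> h _; rewrite mulrA -sqrtrM ?invr_ge0// mulVf ?gt_eqF// sqrtr1 mul1r.
apply: le_trans (cauchy_schwarz_seq _ _ _ _) _; rewrite exprMn ler_pM//.
- by apply: sumr_ge0 => h _; exact: sqr_ge0.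
- by apply: sumr_ge0 => h _; exact: sqr_ge0.
- by under eq_bigr do rewrite sqr_sqrtr ?invr_ge0//.
apply: le_trans fc; under eq_bigr do rewrite exprMn sqr_sqrtr//.
rewrite /energy [leRHS](bigID P) /= lerDl sumr_ge0// => h _.
by rewrite mulr_ge0// exprn_ge0// normc_ge0.
Qed.

Lemma cbmeas_Hspace f : Hspace r f -> cbmeas f.
Proof. by case=> pf cf _; exact: cbmeas_periodic. Qed.

Lemma periodic_lin (a : R[i]) f g : Defs.periodic f -> Defs.periodic g ->
  Defs.periodic (fun x => a * f x + g x).
Proof. by move=> pf pg x k; rewrite pf pg. Qed.

Lemma fourier_lin (a : R[i]) f g h : cbmeas f -> cbmeas g ->
  fourier (fun x => a * f x + g x) h = a * fourier f h + fourier g h.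
Proof.
move=> bf bg; rewrite -fourierZ//; apply: (@fourierD _ _ (fun x => a * f x)) => //.
exact: cbmeasZ.
Qed.

Lemma Hspace_lin (a : R[i]) f g : Hspace r f -> Hspace r g ->
  Hspace r (fun x => a * f x + g x).
Proof.
move=> Hf Hg; have bf := cbmeas_Hspace Hf; have bg := cbmeas_Hspace Hg.
case: Hf Hg => pf cf /Hnorm_ltyP[c c0 fc] [pg cg /Hnorm_ltyP[e e0 ge]].
split; [exact: periodic_lin|by apply: continuousCD => //; exact: continuousCZ|].
apply/Hnorm_ltyP; exists (Num.sqrt (2 * normc a ^+ 2 * c ^+ 2 + 2 * e ^+ 2)); first exact: sqrtr_ge0.
have a20 : 0 <= 2 * normc a ^+ 2 by rewrite mulr_ge0// exprn_ge0// normc_ge0.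
move=> s us; rewrite sqr_sqrtr; last by rewrite addr_ge0// mulr_ge0// sqr_ge0.
apply: (@le_trans _ _ (2 * normc a ^+ 2 * energy f s + 2 * energy g s)); last first.
  apply: lerD; first by apply: ler_wpM2l => //; exact: fc.
  by apply: ler_wpM2l => //; exact: ge.
rewrite /energy !mulr_sumr -big_split /=; apply: ler_sum => h _.
rewrite (fourier_lin _ _ bf bg).
set u := fourier f h; set v := fourier g h.
have -> : 2 * normc a ^+ 2 * (r h * normc u ^+ 2) + 2 * (r h * normc v ^+ 2) =
  r h * (2 * (normc (a * u) ^+ 2 + normc v ^+ 2)) by rewrite normcM exprMn; ring.
rewrite ler_wpM2l//.
have : normc (a * u + v) ^+ 2 <= (normc (a * u) + normc v) ^+ 2.
  by rewrite ler_sqr ?nnegrE ?addr_ge0 ?normc_ge0// normcD.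
by have := sqr_ge0 (normc (a * u) - normc v); nra.
Qed.

Lemma Hspace_chi h : Hspace r (chi h).
Proof.
split; [exact: periodic_chi|exact: continuousC_chi|].
apply/Hnorm_ltyP; exists (Num.sqrt (r h)); first exact: sqrtr_ge0.
move=> t ut; rewrite sqr_sqrtr// /energy.
have [ht|ht] := boolP (h \in t).
  rewrite (bigD1_seq h)//= fourier_chi eqxx big1 ?addr0; first by rewrite normc_real normr1 expr1n mulr1.
  by move=> k kh; rewrite fourier_chi eq_sym (negPf kh) normc0 expr0n mulr0.
rewrite big_seq big1// => k kt; rewrite fourier_chi (_ : h == k = false) ?normc0 ?expr0n ?mulr0//.
by apply: contraNF ht => /eqP ->.
Qed.

Lemma Hspace_trig (s : seq freq) (a : freq -> R[i]) :
  Hspace r (fun x => \sum_(h <- s) a h * chi h x).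
Proof.
elim: s => [|h s IH].
  under [X in Hspace r X]eq_fun do rewrite big_nil.
  split; [by []|exact: continuousC_cst|].
  apply/Hnorm_ltyP; exists 0 => // s us; rewrite expr0n /= le_eqVlt.
  apply/orP; left; apply/eqP/big1 => h _.
  have -> : fourier (fun _ : point => 0) h = 0 :> R[i].
    transitivity (fourier (fun x : point => \sum_(k <- [::]) (0 : R[i]) * chi k x) h).
      by congr (fourier _ h); apply/funext => x; rewrite big_nil.
    by rewrite (@fourier_trig _ _ [::] (fun=> 0)).
  by rewrite normc0 expr0n mulr0.
under [X in Hspace r X]eq_fun do rewrite big_cons.
by apply: Hspace_lin; [exact: Hspace_chi|exact: IH].
Qed.

(** The remainder is continuous and periodic with coefficients supported outside s0, and their
    absolute sum is at most eps * c by Cauchy-Schwarz; [normc_le_fourier_sums] turns this into a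
    bound at every point. *)
Lemma fourier_truncation f c eps (s0 : seq freq) x : (0 < d)%N -> Hspace r f ->
  0 <= c -> 0 <= eps -> (forall s, uniq s -> energy f s <= c ^+ 2) -> uniq s0 ->
  (forall s, uniq s -> \sum_(h <- s | h \notin s0) (r h)^-1 <= eps ^+ 2) ->
  normc (f x - \sum_(h <- s0) fourier f h * chi h x) <= eps * c.
Proof.
move=> d0 Hf c0 e0 fc us0 tail; have bf := cbmeas_Hspace Hf.
pose p := (fun x : point => \sum_(h <- s0) fourier f h * chi h x).
have Hp : Hspace r p by exact: Hspace_trig.
have bp := cbmeas_Hspace Hp.
have gE : (fun x => f x - p x) = fun x => -1 * p x + f x.
  by apply/funext => y; rewrite mulN1r addrC.
have [pg cg _] : Hspace r (fun x => f x - p x) by rewrite gE; exact: Hspace_lin.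
apply: (normc_le_fourier_sums d0 pg cg) => s us.
rewrite (eq_bigr (fun h => if h \notin s0 then normc (fourier f h) else 0)).
  by rewrite -big_mkcond; apply: sum_normc_fourier_le => //; [exact: fc|exact: tail].
move=> h _; rewrite fourierB// fourier_trig//; case: ifP => hs; first by rewrite subrr normc0.
by rewrite subr0.
Qed.

End WeightedSpace.

(** * Approximation numbers from below *)

Section LowerBound.
Local Open Scope classical_set_scope.
Local Open Scope ring_scope.
Local Open Scope complex_scope.
Local Open Scope sesquilinear_scope.
Context {R : realType}.
Local Notation C := R[i].
Local Notation normc := Normc.normc.

(** Bathtub principle: weights between 0 and 1 with at least this total mass are cheapest when they
    fill the indices of smallest L, those outside I. The threshold l separates the values of L
    outside and inside I. *)
Lemma weighted_sum_ge n (L q : 'I_n -> R) (I : {pred 'I_n}) :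
  (forall j, 0 <= L j) -> (forall j, 0 <= q j <= 1) ->
  (forall i j, i \in I -> j \notin I -> L j <= L i) ->
  (#|[predC I]|)%:R <= \sum_j q j ->
  \sum_(j | j \notin I) L j <= \sum_j L j * q j.
Proof.
move=> L0 q01 LI qs.
pose l := \big[Num.max/0]_(j | j \notin I) L j.
have lI i : i \in I -> l <= L i.
  by move=> iI; apply: bigmax_le => // j jI; exact: LI.
have lnI j : j \notin I -> L j <= l by move=> jI; exact: le_bigmax_cond.
have l0 : 0 <= l by exact: bigmax_ge_id.
have H1 : l * \sum_(j | j \in I) q j <= \sum_(j | j \in I) L j * q j.
  rewrite mulr_sumr; apply: ler_sum => j jI; apply: ler_wpM2r; last exact: lI.
  by have /andP[] := q01 j.
have H2 : \sum_(j | j \notin I) L j * (1 - q j) <= l * \sum_(j | j \notin I) (1 - q j).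
  rewrite mulr_sumr; apply: ler_sum => j jI; apply: ler_wpM2r; last exact: lnI.
  by rewrite subr_ge0; have /andP[] := q01 j.
rewrite [leRHS](bigID (mem I)) /=.
have -> : \sum_(j | j \notin I) L j =
    \sum_(j | j \notin I) L j * q j + \sum_(j | j \notin I) L j * (1 - q j).
  by rewrite -big_split /=; apply: eq_bigr => j _; ring.
rewrite [leRHS]addrC; apply: lerD => //; apply: le_trans H2 _; apply: le_trans H1.
apply: ler_wpM2l => //; rewrite sumrB lerBlDr sumr_const.
apply: le_trans (_ : \sum_j q j <= _); last by rewrite [leLHS](bigID (mem I)) /=.
by apply: le_trans qs; rewrite ler_nat; apply: subset_leq_card; apply/fintype.subsetP => j.
Qed.

(** Bessel's inequality: a rectangular N in [unitarymx] has orthonormal rows, and e is the residual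
    of b after projection onto their span. *)
Lemma unitarymx_contraction k n (N : 'M[C]_(k, n)) (b : 'cV[C]_n) : N \is unitarymx ->
  \sum_i normc ((N *m b) i 0) ^+ 2 <= \sum_j normc (b j 0) ^+ 2.
Proof.
move=> /unitarymxP NN.
have normE m (c : 'cV[C]_m) : (\sum_j normc (c j 0) ^+ 2)%:C = (c ^t* *m c) 0 0.
  rewrite mxE rmorph_sum /=; apply: eq_bigr => j _.
  by rewrite sqr_normcE !mxE mulrC.
pose e := b - N ^t* *m (N *m b).
have tCD m (c c' : 'cV[C]_m) : (c - c') ^t* = c ^t* - c' ^t*.
  by apply/matrixP => i j; rewrite !mxE rmorphB.
have eE : e ^t* *m e = b ^t* *m b - (N *m b) ^t* *m (N *m b).
  rewrite /e; set c := N *m b.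
  have h1 : b ^t* *m (N ^t* *m c) = c ^t* *m c.
    by rewrite mulmxA -map_mxM -trmx_mul.
  have h2 : (N ^t* *m c) ^t* *m b = c ^t* *m c.
    by rewrite trmx_mul map_mxM trmxCK -mulmxA.
  have h3 : (N ^t* *m c) ^t* *m (N ^t* *m c) = c ^t* *m c.
    by rewrite trmx_mul map_mxM trmxCK -mulmxA [N *m _]mulmxA NN mul1mx.
  by rewrite tCD mulmxBl !mulmxBr h1 h2 h3 subrr subr0.
rewrite -lecR !normE -subr_ge0.
have -> : (b ^t* *m b) 0 0 - ((N *m b) ^t* *m (N *m b)) 0 0 = (e ^t* *m e) 0 0.
  by rewrite eE [RHS]mxE [X in _ = _ + X]mxE.
by rewrite -normE lecR sumr_ge0// => j _; rewrite exprn_ge0// normc_ge0.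
Qed.

(** Gram-Schmidt is applied to a basis of the left kernel of A, of dimension n minus the rank of
    A. *)
Lemma exists_unitary_annihilator n m (A : 'M[C]_(n, m)) :
  exists k (N : 'M[C]_(k, n)), [/\ N \is unitarymx, N *m A = 0 & (n - m <= k)%N].
Proof.
pose K := row_base (kermx A).
have kn : (\rank (kermx A) <= n)%N by exact: rank_leq_col.
exists (\rank (kermx A)), (schmidt K); split.
- exact: schmidt_unitarymx.
- apply/sub_kermxP; rewrite -(eq_row_base (kermx A)).
  by rewrite (eqmx_schmidt_free (row_base_free _)).
- by rewrite mxrank_ker leq_sub2l// rank_leq_col.
Qed.

Section Trunc.
Variable t : R.
(** Rounding towards zero does not increase the modulus, so rounded coefficient vectors stay in the
    unit ball. *)
Definition truncr : int := if 0 <= t then Num.floor t else - Num.floor (- t).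

Lemma truncr_norm : `|truncr%:~R| <= `|t|.
Proof.
rewrite /truncr; case: ifPn => t0.
  rewrite !ger0_norm ?floor_le// ler0z floor_ge0//.
rewrite -ltNge in t0; rewrite mulrNz normrN (ltr0_norm t0) ger0_norm ?floor_le//.
by rewrite ler0z floor_ge0 oppr_ge0 ltW.
Qed.

Lemma truncr_dist : `|t - truncr%:~R| <= 1.
Proof.
rewrite /truncr; case: ifPn => t0.
  have := floor_le t; have := floorD1_gt t; rewrite intrD => ? ?.
  by rewrite ler_norml; apply/andP; split; lra.
have := floor_le (- t); have := floorD1_gt (- t); rewrite intrD mulrNz => ? ?.
by rewrite ler_norml; apply/andP; split; lra.
Qed.
End Trunc.

(* Countably many coefficient vectors, so that bounds holding almost everywhere for each of them hold
   almost everywhere for all of them. *)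
Definition gauss_frac n (p : {ffun 'I_n -> int * int}) (N : nat) (j : 'I_n) : C :=
  ((p j).1%:~R / N.+1%:R) +i* ((p j).2%:~R / N.+1%:R).

(** By duality the norm s of z is the pairing with the unit vector conj z / s. Rounding this vector
    to denominator N + 1 changes the pairing by at most 2 Z / (N + 1), and N is chosen to make this
    smaller than the supposed gap s - B. *)
Lemma sum_sqr_le_dense n (z : 'I_n -> C) (B : R) : 0 <= B ->
  (forall p N, \sum_j normc (gauss_frac p N j) ^+ 2 <= 1 ->
     normc (\sum_j gauss_frac p N j * z j) <= B) ->
  \sum_j normc (z j) ^+ 2 <= B ^+ 2.
Proof.
move=> B0 H; set S := \sum_j _.
have S0 : 0 <= S by apply: sumr_ge0 => j _; rewrite exprn_ge0// normc_ge0.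
pose s := Num.sqrt S.
have s0 : 0 <= s by exact: sqrtr_ge0.
have sS : s ^+ 2 = S by rewrite sqr_sqrtr.
rewrite -sS ler_sqr ?nnegrE//.
have [->//|sn0] := eqVneq s 0.
have sp : 0 < s by rewrite lt_def sn0.
rewrite leNgt; apply/negP => Bs.
pose Z := \sum_j normc (z j).
have Z0 : 0 <= Z by apply: sumr_ge0 => j _; exact: normc_ge0.
pose N := Num.truncn (2 * Z / (s - B)).
have NB : 2 * Z / N.+1%:R < s - B.
  rewrite ltr_pdivrMr ?ltr0n// [ltRHS]mulrC -ltr_pdivrMr ?subr_gt0//.
  exact: truncnS_gt.
pose a j : C := (s^-1)%:C * (z j)^*.
have aN j : normc (a j) = normc (z j) / s.
  by rewrite /a normcM normcJ normc_real ger0_norm ?invr_ge0// mulrC.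
pose p : {ffun 'I_n -> int * int} :=
  [ffun j => (truncr (complex.Re (a j) * N.+1%:R), truncr (complex.Im (a j) * N.+1%:R))].
have N0 : 0 < N.+1%:R :> R by rewrite ltr0n.
have le_abs (u : R) : `|(truncr (u * N.+1%:R))%:~R / N.+1%:R| <= `|u|.
  rewrite normrM normfV (ger0_norm (ltW N0)) ler_pdivrMr//.
  by have := truncr_norm (u * N.+1%:R); rewrite [leRHS]normrM (ger0_norm (ltW N0)).
have dist_abs (u : R) : `|u - (truncr (u * N.+1%:R))%:~R / N.+1%:R| <= N.+1%:R^-1.
  have -> : u - (truncr (u * N.+1%:R))%:~R / N.+1%:R =
      (u * N.+1%:R - (truncr (u * N.+1%:R))%:~R) / N.+1%:R.
    by rewrite mulrBl mulfK// gt_eqF.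
  rewrite normrM normfV (ger0_norm (ltW N0)) ler_pdivrMr// mulVf ?gt_eqF//.
  exact: truncr_dist.
have sum_aN : \sum_j normc (a j) ^+ 2 = 1.
  under eq_bigr do rewrite aN expr_div_n.
  by rewrite -mulr_suml -/S sS divff// -sS expf_neq0.
have p1 : \sum_j normc (gauss_frac p N j) ^+ 2 <= 1.
  rewrite -sum_aN; apply: ler_sum => j _; rewrite !sqr_normc /gauss_frac /p !ffunE /=.
  by apply: lerD; rewrite -[leLHS]real_normK ?num_real// -[leRHS]real_normK ?num_real//
    ler_sqr ?nnegrE// le_abs.
have := H p N p1; apply/negP; rewrite -ltNge.
have az : \sum_j a j * z j = s%:C.
  rewrite /a; under eq_bigr do rewrite -mulrA [_^* * _]mulrC -sqr_normcE -rmorphM.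
  rewrite -rmorph_sum -mulr_sumr -/S /= -sS; congr (_%:C).
  by rewrite expr2 mulKf.
have diff : normc (\sum_j a j * z j - \sum_j gauss_frac p N j * z j) <= 2 * Z / N.+1%:R.
  rewrite -sumrB; apply: le_trans (normc_sum _ _ _) _.
  rewrite mulrAC /Z mulr_sumr; apply: ler_sum => j _.
  rewrite -mulrBl normcM; apply: ler_wpM2r; first exact: normc_ge0.
  apply: le_trans (normc_le_ReIm _) _; rewrite /gauss_frac /p !ffunE.
  have -> : 2 / N.+1%:R = N.+1%:R^-1 + N.+1%:R^-1 :> R by ring.
  by apply: lerD; [have := dist_abs (complex.Re (a j))|have := dist_abs (complex.Im (a j))];
    case: (a j).
have := normcD (\sum_j a j * z j - \sum_j gauss_frac p N j * z j) (\sum_j gauss_frac p N j * z j).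
rewrite subrK [X in normc X <= _]az normc_real ger0_norm// => tri.
by move: diff tri NB; move: (normc _) (normc _) (2 * Z / _) => u v w; lra.
Qed.

End LowerBound.

Section ApproximationNumbers.
Local Open Scope classical_set_scope.
Local Open Scope ring_scope.
Local Open Scope complex_scope.
Local Open Scope sesquilinear_scope.
Context {R : realType} {d : nat}.
Local Notation C := R[i].
Local Notation point := (d.-tuple R).
Local Notation freq := (d.-tuple int).
Local Notation func := (point -> R[i]).
Local Notation normc := Normc.normc.

Lemma Linf_normP (g : func) (c : R) :
  (Linf_norm g <= c%:E)%E <-> \forall x \ae cube d, normc (g x) <= c.
Proof.
rewrite /Linf_norm unlock /= [X in (0 < X)%E](@probability_setT _ _ _ (cube d)) lte01.
split=> [/ess_supP|] H.
  apply: filterS H => x; rewrite /= lee_fin.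
  by rewrite ger0_norm ?normc_ge0.
apply/ess_supP; apply: filterS H => x; rewrite /= lee_fin.
by rewrite ger0_norm ?normc_ge0.
Qed.

Lemma parseval n (e : 'I_n -> freq) (a : 'I_n -> C) : injective e ->
  \int[cube d]_x (normc (\sum_j a j * chi (e j) x) ^+ 2) = \sum_j normc (a j) ^+ 2.
Proof.
move=> ei; pose F : func := fun x => \sum_j \sum_k (a j * (a k)^* ) * chi (freqD (e j) (freqN (e k))) x.
have FE x : (normc (\sum_j a j * chi (e j) x) ^+ 2)%:C = F x.
  rewrite sqr_normcE rmorph_sum big_distrlr /=; apply: eq_bigr => j _; apply: eq_bigr => k _.
  by rewrite chiD chiN rmorphM mulrACA.
transitivity (complex.Re (cintegral F)).
  by apply: eq_Rintegral => x _; rewrite -FE.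
have bt (j k : 'I_n) : cbmeas (fun x => (a j * (a k)^* ) * chi (freqD (e j) (freqN (e k))) x).
  by apply: cbmeasZ; exact: cbmeas_chi.
have -> : cintegral F = (\sum_j normc (a j) ^+ 2)%:C.
  rewrite /F cintegral_sum => [|j]; last exact: cbmeas_sum.
  rewrite rmorph_sum /=; apply: eq_bigr => j _; rewrite cintegral_sum// (bigD1 j)//=.
  rewrite cintegralZ; last exact: cbmeas_chi.
  rewrite cintegral_chi freqD_N eqxx mulr1 big1 ?addr0 ?sqr_normcE// => k kj.
  rewrite cintegralZ; last exact: cbmeas_chi.
  by rewrite cintegral_chi freqD_N (inj_eq ei) eq_sym (negPf kj) mulr0.
by [].
Qed.

Variable r : freq -> R.
Hypothesis r_gt0 : forall h, 0 < r h.

Lemma bounded_linear_sum (A : func -> func) n (e : 'I_n -> freq) (a : 'I_n -> C) :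
  bounded_linear r A ->
  \forall x \ae cube d, A (fun y => \sum_j a j * chi (e j) y) x = \sum_j a j * A (chi (e j)) x.
Proof.
move=> [_ Alin _].
have H0 : Hspace r (fun _ : point => 0 : C).
  by have := Hspace_trig r_gt0 [::] (fun=> 0); congr Hspace; apply/funext => x; rewrite big_nil.
suff : forall s : seq 'I_n, Hspace r (fun y => \sum_(j <- s) a j * chi (e j) y) /\
    \forall x \ae cube d, A (fun y => \sum_(j <- s) a j * chi (e j) y) x =
      \sum_(j <- s) a j * A (chi (e j)) x.
  by move=> /(_ (index_enum _))[].
elim=> [|j s [Hs IH]].
  have E0 : (fun y : point => \sum_(j <- [::]) a j * chi (e j) y) = fun=> 0.
    by apply/funext => x; rewrite big_nil.
  rewrite E0; split => //.
  (* Linearity at a = -1 and f = g = 0 forces A 0 = 0 almost everywhere. *)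
  apply: filterS (Alin (-1) _ _ H0 H0) => x; rewrite big_nil.
  have -> : (fun y : point => -1 * (0 : C) + 0) = fun=> 0 by apply/funext => y; rewrite mulr0 addr0.
  by move=> ->; rewrite mulN1r addNr.
have E1 : (fun y : point => \sum_(k <- j :: s) a k * chi (e k) y) =
    fun y => a j * chi (e j) y + \sum_(k <- s) a k * chi (e k) y.
  by apply/funext => x; rewrite big_cons.
have Hc := Hspace_chi r_gt0 (e j).
rewrite E1; split; first by apply: Hspace_lin.
apply: (filterS2 _ _ (Alin (a j) _ _ Hc Hs) IH) => x -> ->.
by rewrite big_cons.
Qed.

(** The functions chi_h / sqrt r(h) are orthonormal in H_r. *)
Lemma Hball_trig n (e : 'I_n -> freq) (a : 'I_n -> C) : injective e ->
  \sum_j normc (a j) ^+ 2 <= 1 ->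
  Hball r (fun x => \sum_j (a j * (Num.sqrt (r (e j))^-1)%:C) * chi (e j) x).
Proof.
move=> ei a1; set f : func := fun x => _.
have fE h : fourier f h = \sum_(j | e j == h) a j * (Num.sqrt (r (e j))^-1)%:C.
  rewrite /f fourier_sum => [|j]; last by apply: cbmeasZ; exact: cbmeas_chi.
  rewrite [RHS]big_mkcond; apply: eq_bigr => j _.
  by rewrite (fourierZ _ _ (cbmeas_chi _)) fourier_chi; case: eqP; rewrite ?mulr1 ?mulr0.
have en s : uniq s -> energy r f s <= 1 ^+ 2.
  move=> us; rewrite expr1n; apply: le_trans a1.
  rewrite /energy (eq_bigr (fun h => \sum_(j | e j == h) normc (a j) ^+ 2)); last first.
    move=> h _; rewrite fE.
    have [/existsP[j /eqP jh]|/existsPn nh] := boolP [exists j, e j == h].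
      have P1 : (fun k => e k == h) =1 pred1 j by move=> k; rewrite /= -jh (inj_eq ei).
      rewrite !(big_pred1 j)// normcM exprMn normc_real real_normK ?num_real//.
      by rewrite sqr_sqrtr ?invr_ge0 ?ltW// jh mulrCA mulfV ?mulr1// gt_eqF.
    by rewrite !big_pred0 ?normc0 ?expr0n ?mulr0// => j; apply/negbTE.
  under eq_bigr do rewrite big_mkcond; rewrite exchange_big /=.
  apply: ler_sum => j _; rewrite -big_mkcond /=.
  have [js|js] := boolP (e j \in s).
    rewrite big_mkcond (bigD1_seq (e j))//= eqxx big1 ?addr0// => h hj.
    by rewrite eq_sym (negPf hj).
  rewrite big_seq_cond big_pred0 ?exprn_ge0 ?normc_ge0// => h.
  by apply/negbTE; apply: contra js => /andP[hs /eqP ->].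
have Hf : Hspace r f.
  split; last by apply/(Hnorm_ltyP r_gt0); exists 1.
    by move=> x k; apply: eq_bigr => j _; rewrite periodic_chi.
  by apply: continuousC_sum => j; apply: continuousCZ; exact: continuousC_chi.
by split => //; apply/(Hnorm_leP r_gt0).
Qed.

Lemma ae_forall_countable (T : countType) (P : T -> point -> Prop) :
  (forall t, \forall x \ae cube d, P t x) -> \forall x \ae cube d, forall t, P t x.
Proof.
move=> H.
have : \forall x \ae cube d, forall k, if choice.unpickle k is Some t then P t x else True.
  by apply: ae_foralln => k; case: (choice.unpickle k) => [t|]; [exact: H|exact: aeW].
by apply: filterS => x Hx t; have := Hx (choice.pickle t); rewrite choice.pickleK.
Qed.

Lemma approx_lower_bound (A : func -> func) (t B : R) n m (e : 'I_n -> freq)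
    (I : {pred 'I_n}) :
  0 <= B -> bounded_linear r A -> rank_lt r A t -> t <= m.+1%:R ->
  injective e -> (#|[predC I]| <= n - m)%N ->
  (forall i j, i \in I -> j \notin I -> r (e i) <= r (e j)) ->
  (op_norm r (fun f x => (embedding f x - A f x)%R) <= B%:E)%E ->
  \sum_(j | j \notin I) (r (e j))^-1 <= B ^+ 2.
Proof.
move=> B0 bA [m' [g [m't _ rk]]] tm ei cI rI opB.
(* The rank m' is a natural number below t, and t is at most m + 1. *)
have m'm : (m' <= m)%N by rewrite -ltnS -(ltr_nat R); exact: lt_le_trans tm.
pose s j := Num.sqrt (r (e j))^-1.
have s2 j : s j ^+ 2 = (r (e j))^-1 by rewrite sqr_sqrtr// invr_ge0 ltW.
pose b j x := (s j)%:C * (chi (e j) x - A (chi (e j)) x).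
have rkj j : exists c : 'I_m' -> C,
    \forall x \ae cube d, A (chi (e j)) x = \sum_l c l * g l x.
  exact: rk (Hspace_chi r_gt0 (e j)).
have [c cE] := boolp.choice rkj.
have comb (a : 'I_n -> C) : \sum_j normc (a j) ^+ 2 <= 1 ->
    \forall x \ae cube d, normc (\sum_j a j * b j x) <= B.
  move=> a1; set f : func := fun x => \sum_j (a j * (s j)%:C) * chi (e j) x.
  have Bf : Hball r f by exact: Hball_trig.
  have : (Linf_norm (fun x => (f x - A f x)%R) <= B%:E)%E.
    by apply: le_trans opB; apply: ereal_sup_ubound; exists f.
  move=> /Linf_normP; apply: (filterS2 _ _ (bounded_linear_sum e (fun j => a j * (s j)%:C) bA)).
  move=> x Ax; rewrite -/f in Ax; rewrite Ax /f -sumrB.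
  rewrite (_ : \sum_i _ = \sum_j a j * b j x)//.
  by apply: eq_bigr => j _; rewrite /b -mulrBr mulrA.
have dense : \forall x \ae cube d, \sum_j normc (b j x) ^+ 2 <= B ^+ 2.
  have : \forall x \ae cube d, forall q : {ffun 'I_n -> int * int} * nat,
      \sum_j normc (gauss_frac q.1 q.2 j : C) ^+ 2 <= 1 ->
      normc (\sum_j gauss_frac q.1 q.2 j * b j x) <= B.
    apply: ae_forall_countable => q.
    have [q1|q1] := pselect (\sum_j normc (gauss_frac q.1 q.2 j : C) ^+ 2 <= 1).
      by apply: filterS (comb _ q1) => x.
    by apply: aeW.
  apply: filterS => x Hx; apply: sum_sqr_le_dense => // p N; exact: (Hx (p, N)).
(* Row j of [Cm] expresses s_j * A chi_j in terms of the g_l. Since N annihilates [Cm], applying N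
   to the error vector b removes A, and only the weighted characters remain. *)
pose Cm : 'M[C]_(n, m') := \matrix_(j, l) ((s j)%:C * c j l).
have [k [N [uN NC kn]]] := exists_unitary_annihilator Cm.
have cE' : \forall x \ae cube d, forall j, A (chi (e j)) x = \sum_l c j l * g l x.
  exact: ae_forall_countable.
have ptw : \forall x \ae cube d,
    \sum_i normc (\sum_j (N i j * (s j)%:C) * chi (e j) x) ^+ 2 <= B ^+ 2.
  apply: (filterS2 _ _ dense cE') => x bx Ax; apply: le_trans bx.
  have := unitarymx_contraction (\col_j b j x) uN.
  have -> : \sum_j normc ((\col_j b j x) j 0) ^+ 2 = \sum_j normc (b j x) ^+ 2.
    by apply: eq_bigr => j _; rewrite mxE.
  apply: le_trans; apply: ler_sum => i _.
  rewrite le_eqVlt; apply/orP; left; apply/eqP; congr (normc _ ^+ 2).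
  have NCi : \sum_l (N *m Cm) i l * g l x = 0 by apply: big1 => l _; rewrite NC mxE mul0r.
  transitivity (\sum_j (N i j * (s j)%:C) * chi (e j) x - \sum_l (N *m Cm) i l * g l x).
    by rewrite NCi subr0.
  have -> : \sum_l (N *m Cm) i l * g l x = \sum_j N i j * ((s j)%:C * \sum_l c j l * g l x).
    under eq_bigr do rewrite mxE mulr_suml.
    rewrite exchange_big /=; apply: eq_bigr => j _; rewrite !mulr_sumr.
    by apply: eq_bigr => l _; rewrite mxE !mulrA.
  rewrite -sumrB [RHS]mxE; apply: eq_bigr => j _; rewrite [in RHS]mxE /b Ax.
  by rewrite -mulrA -mulrBr -mulrBr.
have bN i : bmeas (fun x => normc (\sum_j (N i j * (s j)%:C) * chi (e j) x) ^+ 2).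
  by apply/bmeasX/bmeas_normc/cbmeas_sum => j; apply: cbmeasZ; exact: cbmeas_chi.
have : \sum_i \sum_j normc (N i j * (s j)%:C) ^+ 2 <= B ^+ 2.
  under eq_bigr do rewrite -(parseval _ ei).
  rewrite -expect_sum// -[leRHS](expect_cst (cube d)); apply: le_expect_ae => //.
    exact: bmeas_sum.
  exact: bmeas_cst.
apply: le_trans.
(* q_j is a diagonal entry of the orthogonal projection onto the row span of N. It lies in [0, 1],
   and the total is the number k of rows, at least n - m; so the bathtub principle applies. *)
pose q j := \sum_i normc (N i j) ^+ 2.
have -> : \sum_i \sum_j normc (N i j * (s j)%:C) ^+ 2 = \sum_j (r (e j))^-1 * q j.
  rewrite exchange_big; apply: eq_bigr => j _; rewrite mulr_sumr; apply: eq_bigr => i _.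
  by rewrite normcM exprMn normc_real real_normK ?num_real// s2 mulrC.
apply: weighted_sum_ge.
- by move=> j; rewrite invr_ge0 ltW.
- move=> j; rewrite sumr_ge0/= => [|i _]; last by rewrite exprn_ge0// normc_ge0.
  have := unitarymx_contraction (delta_mx j 0) uN.
  rewrite (eq_bigr (fun i => normc (N i j) ^+ 2)) => [|i _]; last first.
    by rewrite -colE mxE.
  move/le_trans; apply; rewrite (bigD1 j)//= mxE !eqxx big1 ?addr0 => [|i ij].
    by rewrite normc_real normr1 expr1n.
  by rewrite mxE (negPf ij) normc0 expr0n.
- by move=> i j iI jI; rewrite lef_pV2 ?posrE// rI.
- rewrite /q exchange_big /=.
  have rowN i : \sum_j normc (N i j) ^+ 2 = 1.
    apply: complexI; rewrite rmorph_sum /=.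
    transitivity ((1%:M : 'M[C]_k) i i); last by rewrite mxE eqxx.
    have /unitarymxP <- := uN; rewrite [RHS]mxE.
    by apply: eq_bigr => j _; rewrite sqr_normcE !mxE.
  under eq_bigr do rewrite rowN; rewrite sumr_const card_ord ler_nat.
  by rewrite (leq_trans cI)// (leq_trans _ kn)// leq_sub2l.
Qed.

End ApproximationNumbers.

(** * Sampling numbers from above *)

Section SamplingUpperBound.
Local Open Scope classical_set_scope.
Local Open Scope ring_scope.
Local Open Scope complex_scope.
Local Open Scope sesquilinear_scope.
Context {R : realType} {d : nat}.
Local Notation C := R[i].
Local Notation point := (d.-tuple R).
Local Notation freq := (d.-tuple int).
Local Notation func := (point -> R[i]).
Local Notation normc := Normc.normc.
Variable r : freq -> R.
Hypothesis r_gt0 : forall h, 0 < r h.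

Lemma Linf_cbmeas (f : func) : cbmeas f -> Linf f.
Proof.
move=> bf; split; first by split; [exact: bf.1.1|exact: bf.2.1].
have [L fL] := cbmeas_bound bf.
by apply: le_lt_trans (ltry L); apply/Linf_normP; exact: aeW.
Qed.

Lemma HballP (f : func) : Hball r f <->
  Hspace r f /\ forall s, uniq s -> energy r f s <= 1.
Proof.
by split=> -[Hf H]; split=> //; [move/(Hnorm_leP r_gt0 _ ler01): H|apply/(Hnorm_leP r_gt0 _ ler01)];
  rewrite expr1n.
Qed.

Lemma Hball_half_sub (f g : func) : Hball r f -> Hball r g ->
  Hball r (fun x => (2^-1)%:C * f x + (- 2^-1)%:C * g x).
Proof.
move=> /HballP[Hf ef] /HballP[Hg eg]; apply/HballP.
have bf := cbmeas_Hspace Hf; have bg := cbmeas_Hspace Hg.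
have H0 : Hspace r (fun _ : point => 0 : C).
  by have := Hspace_trig r_gt0 [::] (fun=> 0); congr Hspace; apply/funext => x; rewrite big_nil.
have Hg2 : Hspace r (fun x => (- 2^-1)%:C * g x).
  have := Hspace_lin r_gt0 (- 2^-1)%:C Hg H0.
  by congr Hspace; apply/funext => x; rewrite addr0.
split; first exact: Hspace_lin.
move=> s us; apply: (@le_trans _ _ (2^-1 * energy r f s + 2^-1 * energy r g s)); last first.
  by have := ef s us; have := eg s us; lra.
rewrite /energy !mulr_sumr -big_split /=; apply: ler_sum => h _.
have -> : fourier (fun x => (2^-1)%:C * f x + (- 2^-1)%:C * g x) h =
    (2^-1)%:C * fourier f h + (- 2^-1)%:C * fourier g h.
  by rewrite fourier_lin//; [rewrite fourierZ|exact: cbmeasZ].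
set u := fourier f h; set v := fourier g h.
have -> : 2^-1 * (r h * normc u ^+ 2) + 2^-1 * (r h * normc v ^+ 2) =
  r h * (2^-1 * (normc u ^+ 2 + normc v ^+ 2)) by ring.
apply: ler_wpM2l; first exact: ltW.
have : normc ((2^-1)%:C * u + (- 2^-1)%:C * v) <= 2^-1 * normc u + 2^-1 * normc v.
  by rewrite (le_trans (normcD _ _))// !normcM !normc_real normrN ger0_norm.
move: (normc_ge0 ((2^-1)%:C * u + (- 2^-1)%:C * v)).
move: (normc _) (normc u) (normc v) => a b c a0 abc.
have : a ^+ 2 <= (2^-1 * b + 2^-1 * c) ^+ 2 by rewrite ler_sqr ?nnegrE ?(le_trans a0).
by have := sqr_ge0 (b - c); nra.
Qed.

Lemma sampling_number_le (X : {fset point}) (M : nat) (rho : R) :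
  (#|` X| <= M)%N -> (forall x, x \in X -> torus x) ->
  (forall f, Hball r f -> (forall x, x \in X -> f x = 0) -> forall x, normc (f x) <= rho) ->
  (sampling_number r M <= (2 * rho)%:E)%E.
Proof.
move=> XM XT sep.
(* The reconstruction picks any ball function with the given samples: half the difference of two such
   functions lies in the ball and vanishes on X. *)
pose fits (y : {ffun X -> C}) (f : func) := Hball r f /\ forall x : X, f (val x) = y x.
(* Data attained by no function of the ball get the value 0. They do not enter the worst case, but A
   must map all data into L_oo. *)
pose A (y : {ffun X -> C}) : func :=
  if pselect (exists f, fits y f) is left H then projT1 (cid H) else fun=> 0.
have AP y f : fits y f -> fits y (A y).
  by move=> yf; rewrite /A; case: pselect => [H|[]]; [case: cid|exists f].
have LA y : Linf (A y).
  apply: Linf_cbmeas; rewrite /A; case: pselect => [H|_]; last exact: cbmeas_cst.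
  by case: cid => f /= [[Hf _] _]; exact: cbmeas_Hspace Hf.
apply: (@le_trans _ _ (worst_case_error r A)).
  apply: (@le_trans _ _ (ereal_inf [set worst_case_error r A |
      A in [set A : {ffun X -> C} -> func | forall y, Linf (A y)]])).
    by apply: ereal_inf_lbound; exists X.
  by apply: ereal_inf_lbound; exists A.
apply: ge_ereal_sup => _ [f Bf <-].
set y := [ffun _ => _]; have [Bg gX] : fits y (A y) by apply: (AP y f); split => // x; rewrite ffunE.
apply/Linf_normP; apply: aeW => x.
have := sep _ (Hball_half_sub Bf Bg) _ x.
rewrite (_ : (2^-1)%:C * f x + (- 2^-1)%:C * A y x = (2^-1)%:C * (f x - A y x)); last first.
  by rewrite rmorphN mulrBr mulNr.
rewrite normcM normc_real ger0_norm// => H.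
have {}H : 2^-1 * normc (f x - A y x) <= rho.
  apply: H => z zX; have := gX [` zX]%fset; rewrite ffunE /= => ->.
  by rewrite rmorphN mulNr subrr.
by rewrite mulrC -ler_pdivrMr// mulrC.
Qed.

Definition tails (s0 : seq freq) : set R :=
  [set \sum_(h <- s | h \notin s0) (r h)^-1 | s in [set s : seq freq | uniq s]].

(** With s0 listing the m frequencies of smallest weight, this is tau_m squared. *)
Definition tail2 (s0 : seq freq) : R := sup (tails s0).

Hypothesis r_summable : (\esum_(h in [set: freq]) ((r h)^-1)%:E < +oo)%E.

Let rV_ge0 h : 0 <= (r h)^-1.
Proof. by rewrite invr_ge0 ltW. Qed.

Lemma sum_inv_weights_le (s : seq freq) : uniq s ->
  \sum_(h <- s) (r h)^-1 <= fine (\esum_(h in [set: freq]) ((r h)^-1)%:E).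
Proof.
move: s; apply/(esum_leP _ rV_ge0); rewrite fineK// ge0_fin_numE//.
by apply: esum_ge0 => h _; rewrite lee_fin.
Qed.

Lemma has_sup_tails s0 : has_sup (tails s0).
Proof.
split; first by exists 0, [::] => //; rewrite big_nil.
exists (fine (\esum_(h in [set: freq]) ((r h)^-1)%:E)) => _ [s us <-].
apply: le_trans (sum_inv_weights_le us).
by rewrite [leRHS](bigID [pred h | h \notin s0])/= lerDl sumr_ge0.
Qed.

Lemma le_tail2 (s0 s : seq freq) : uniq s -> \sum_(h <- s | h \notin s0) (r h)^-1 <= tail2 s0.
Proof. by move=> us; apply: sup_upper_bound; [exact: has_sup_tails|exists s]. Qed.

Lemma tail2_le (s0 : seq freq) (b : R) :
  (forall s, uniq s -> \sum_(h <- s | h \notin s0) (r h)^-1 <= b) -> tail2 s0 <= b.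
Proof.
move=> H; apply: sup_le_ub; first by have [] := has_sup_tails s0.
by move=> _ [s us <-]; exact: H.
Qed.

(** Take s1 with sum outside s0 within e of the supremum. Whatever lies outside both lists could be
    appended to s1 without exceeding the supremum, so it contributes at most e. *)
Lemma small_tail (s0 : seq freq) (e : R) : 0 < e -> uniq s0 ->
  exists s1, [/\ uniq s1, {subset s0 <= s1} &
    forall s, uniq s -> \sum_(h <- s | h \notin s1) (r h)^-1 <= e].
Proof.
move=> e0 us0.
have [_ [s1 us1 <-] Hs1] := sup_adherent e0 (has_sup_tails s0).
pose s2 := s0 ++ [seq h <- s1 | h \notin s0].
have us2 : uniq s2.
  rewrite cat_uniq us0 filter_uniq// andbT /=; apply/hasPn => h.
  by rewrite mem_filter => /andP[].
exists s2; split => // [h hs0|s us]; first by rewrite mem_cat hs0.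
pose s3 := s1 ++ [seq h <- s | h \notin s2 & h \notin s1].
have us3 : uniq s3.
  rewrite cat_uniq us1 filter_uniq// andbT /=; apply/hasPn => h.
  by rewrite mem_filter => /andP[/andP[]].
have := le_tail2 s0 us3; rewrite big_cat /= big_filter_cond /=.
rewrite [X in _ + X <= _](_ : _ = \sum_(h <- s | h \notin s2) (r h)^-1); last first.
  apply: eq_bigl => h; rewrite mem_cat mem_filter negb_or negb_and.
  by case: (h \in s0); case: (h \in s1).
by move: Hs1; rewrite -/(tail2 s0); lra.
Qed.

Lemma freq_bound (s : seq freq) : exists q : nat, forall h, h \in s -> forall i,
  (`|tnth h i| <= q)%N.
Proof.
elim: s => [|k s [q Hq]]; first by exists 0%N.
exists (q + \sum_i `|tnth k i|)%N => h; rewrite inE => /orP[/eqP ->|hs] i.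
  by rewrite (bigD1 i)//= addnCA leq_addr.
by rewrite (leq_trans (Hq h hs i))// leq_addr.
Qed.

Lemma energy_reindex n (e : 'I_n -> freq) (s : seq freq) (f : func) :
  s = [seq e j | j <- enum 'I_n] ->
  energy r f s = \sum_j r (e j) * normc (fourier f (e j)) ^+ 2.
Proof. by move=> ->; rewrite /energy big_map big_enum. Qed.

(** Truncation to a finite list s makes the volume argument applicable. The constant is 13 = 12 + 1:
    12 exceeds the square root of 128, and one further tau covers all truncation errors. *)
Lemma exists_sampling_nodes (sI : seq freq) : (0 < d)%N -> uniq sI -> (0 < size sI)%N ->
  0 < tail2 sI ->
  exists X : {fset point}, [/\ (#|` X| <= size sI + size sI)%N,
    forall x, x \in X -> torus x &
    forall f, Hball r f -> (forall x, x \in X -> f x = 0) ->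
      forall x, normc (f x) <= 13 * Num.sqrt (tail2 sI)].
Proof.
move=> d0 uI m0 t0; set m := size sI; pose tau := Num.sqrt (tail2 sI).
have tau0 : 0 < tau by rewrite sqrtr_gt0.
have tau2 : tau ^+ 2 = tail2 sI by rewrite sqr_sqrtr// ltW.
(* The truncation error occurs once at the evaluation point and at fewer than 2m nodes with weights
   of modulus at most 2; altogether it is at most (1 + 4m) eps = tau. *)
pose eps := tau / (1 + 4 * m%:R).
have den0 : 0 < 1 + 4 * m%:R :> R by rewrite ltr_pwDl// mulr_ge0.
have eps0 : 0 < eps by rewrite divr_gt0.
have [s [us sIs stail]] := small_tail (exprn_gt0 2 eps0) uI.
pose n := size s; pose e (j : 'I_n) : freq := nth freq0 s j.
have ei : injective e.
  by move=> i j /eqP; rewrite nth_uniq// => /eqP ij; exact: val_inj.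
have sE : s = [seq e j | j <- enum 'I_n].
  apply: (@eq_from_nth _ freq0); first by rewrite size_map size_enum_ord.
  move=> k kn; rewrite (nth_map (Ordinal kn)) ?size_enum_ord//.
  by rewrite /e nth_enum_ord.
have [q0 Hq0] := freq_bound s.
(* Differences of two frequencies of s have entries of modulus at most 2 q0 < q, so the grid with q
   points per direction keeps their characters orthogonal. *)
pose q := (q0 + q0).+1.
pose torus_pt := {x : point | torus x}.
pose X (x : torus_pt) (j : 'I_n) : C := chi (e j) (projT1 x).
pose a (j : 'I_n) : C := (Num.sqrt (r (e j))^-1)%:C.
have a2 j : `|a j| ^+ 2 = ((r (e j))^-1)%:C.
  rewrite normC_normc normc_real -rmorphXn /= real_normK ?num_real//.
  by rewrite sqr_sqrtr ?rV_ge0.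
pose node (p : {ffun 'I_d -> 'I_q}) : torus_pt := exist _ _ (@torus_grid_node R d q isT p).
pose tail : {pred 'I_n} := [pred j | e j \notin sI].
have X1 x j : `|X x j| = 1 by rewrite normC_normc normc_chi.
have a0 j : a j != 0.
  by rewrite -normr_eq0 -sqrf_eq0 a2 (inj_eq (@complexI R)) gt_eqF// invr_gt0.
have Q0 : (0 < #|{ffun 'I_d -> 'I_q}|)%N by rewrite card_ffun expn_gt0 card_ord.
have Xo j j' : \sum_p X (node p) j * (X (node p) j')^* = #|{ffun 'I_d -> 'I_q}|%:R * (j == j')%:R.
  rewrite -(inj_eq ei) -freqD_N -(@sum_chi_grid R d q isT); last first.
    move=> i; rewrite tnth_mktuple tnth_mktuple ltnS (leq_trans (leqD_dist _ 0 _))//.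
    by rewrite subr0 sub0r abszN leq_add// Hq0// mem_nth.
  by apply: eq_bigr => p _; rewrite chiD chiN.
have tail_card : #|[predC tail]| = m.
  transitivity (size [seq h <- s | h \in sI]); last first.
    apply/perm_size/uniq_perm; [exact: filter_uniq|exact: uI|move=> h].
    by rewrite mem_filter; have [/sIs ->|] := boolP (h \in sI).
  rewrite -sum1_card -sum1_size big_filter [in RHS]sE big_map big_enum_cond.
  by apply: eq_bigl => j; rewrite !inE negbK.
have [k [Y [km HY]]] := exists_good_nodes X1 a0 Q0 Xo m0 tail_card.
exists [fset projT1 (Y i) | i in 'I_k]%fset; split.
- apply: leq_trans (ltnW km); rewrite (leq_trans (leq_imfset_card _ _ _))//=.
  by rewrite -cardE card_ord.
- by move=> x /imfsetP[i _ ->]; case: (Y i).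
move=> f Bf fX x; have [Hf ef] := (HballP f).1 Bf.
have pf : Defs.periodic f by case: Hf.
have [y [y01 <-]] := periodic_reduce x pf.
pose y' : torus_pt := exist _ y y01.
have [w [w2 Hw]] := HY y'.
pose trunc z := \sum_(h <- s) fourier f h * chi h z.
have err z : normc (f z - trunc z) <= eps.
  rewrite -[leRHS]mulr1; apply: (fourier_truncation r_gt0) => //; first exact: ltW.
  by move=> t ut; rewrite expr1n ef.
(* These are the coordinates of f in the orthonormal system chi_h / sqrt r(h); as f lies in the
   ball, they form a vector of norm at most 1. *)
pose al j : C := fourier f (e j) * (Num.sqrt (r (e j)))%:C.
have truncE (z : torus_pt) : trunc (projT1 z) = \sum_j al j * (a j * X z j).
  rewrite /trunc sE big_map big_enum; apply: eq_bigr => j _.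
  rewrite /al /a mulrA -[_ * _%:C * _%:C]mulrA -rmorphM /= -sqrtrM ?(ltW (r_gt0 _))//.
  by rewrite mulfV ?gt_eqF// sqrtr1 mulr1.
have w1 i : normc (w i) <= 2.
  have := w2 i; rewrite normC_normc -rmorphXn /= -(rmorph_nat (real_complex R)) lecR => H.
  by rewrite -ler_sqr ?nnegrE ?normc_ge0// (le_trans H)//; lra.
have al1 : \sum_j normc (al j) ^+ 2 <= 1.
  apply: le_trans (ef s us); rewrite (energy_reindex _ sE); apply: ler_sum => j _.
  rewrite /al normcM exprMn normc_real real_normK ?num_real//.
  rewrite [X in _ * X <= _]sqr_sqrtr; last exact: (ltW (r_gt0 _)).
  by rewrite [leRHS]mulrC.
have comb : normc (trunc y - \sum_i w i * trunc (projT1 (Y i))) <= 12 * tau.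
  have -> : trunc y - \sum_i w i * trunc (projT1 (Y i)) =
      \sum_j al j * (a j * X y' j - \sum_i w i * (a j * X (Y i) j)).
    rewrite -[y in trunc y]/(projT1 y') truncE.
    rewrite [X in _ - X](eq_bigr (fun i => \sum_j w i * (al j * (a j * X (Y i) j)))); last first.
      by move=> i _; rewrite truncE mulr_sumr.
    rewrite [X in _ - X]exchange_big /= -sumrB; apply: eq_bigr => j _.
    rewrite mulrBr mulr_sumr; congr (_ - _); apply: eq_bigr => i _.
    by rewrite mulrCA.
  rewrite -ler_sqr ?nnegrE ?normc_ge0 ?mulr_ge0 ?(ltW tau0)//.
  apply: le_trans (normc_cauchy_schwarz _ _ _ _) _.
  apply: (@le_trans _ _ (1 * (128 * tail2 sI))); last by rewrite -tau2 mul1r exprMn; have := sqr_ge0 tau; lra.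
  apply: ler_pM => //; [by apply: sumr_ge0 => j _; rewrite exprn_ge0 ?normc_ge0..|].
  have tailE : \sum_(j in tail) (r (e j))^-1 = \sum_(h <- s | h \notin sI) (r h)^-1.
    by rewrite [in RHS]sE big_map big_enum_cond.
  apply: (@le_trans _ _ (128 * \sum_(j in tail) (r (e j))^-1)); last first.
    by apply: ler_wpM2l => //; rewrite tailE; exact: le_tail2.
  rewrite -lecR rmorph_sum rmorphM rmorph_sum rmorph_nat /=.
  apply: le_trans (le_trans Hw _).
    by apply: ler_sum => j _; rewrite rmorphXn /= -normC_normc.
  by apply: ler_wpM2l => //; apply: ler_sum => j _; rewrite a2.
(* As f vanishes at the nodes, the truncated series there is pure truncation error. *)
have nodes0 : normc (\sum_i w i * trunc (projT1 (Y i))) <= 4 * m%:R * eps.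
  apply: le_trans (normc_sum _ _ _) _.
  apply: (@le_trans _ _ (\sum_(i < k) 2 * eps)).
    apply: ler_sum => i _; rewrite normcM; apply: ler_pM; rewrite ?normc_ge0//.
    have := err (projT1 (Y i)); rewrite fX ?sub0r ?normcN//.
    by apply/imfsetP; exists i.
  have kmR : 0 <= 2 * m%:R - k%:R :> R.
    by rewrite subr_ge0 -natrM ler_nat mul2n -addnn ltnW.
  rewrite sumr_const card_ord -[leLHS]mulr_natl.
  by have := mulr_ge0 kmR (ltW eps0); nra.
have : normc (f y) <= eps + 12 * tau + 4 * m%:R * eps.
  have -> : f y = (f y - trunc y) + (trunc y - \sum_i w i * trunc (projT1 (Y i))) +
      \sum_i w i * trunc (projT1 (Y i)) by rewrite addrA subrK subrK.
  apply: le_trans (normcD _ _) _; apply: lerD => //.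
  by apply: le_trans (normcD _ _) _; apply: lerD.
move/le_trans; apply; rewrite -/tau.
have : (1 + 4 * m%:R) * eps = tau by rewrite /eps mulrC divfK// gt_eqF.
by lra.
Qed.

End SamplingUpperBound.

(** * Reproducing kernel and spline projection *)

Section Kernel.
Local Open Scope classical_set_scope.
Local Open Scope ring_scope.
Local Open Scope complex_scope.
Context {R : realType} {d : nat}.
Local Notation C := R[i].
Local Notation point := (d.-tuple R).
Local Notation freq := (d.-tuple int).
Local Notation func := (point -> R[i]).
Local Notation normc := Normc.normc.
Variable r : freq -> R.
Hypothesis r_gt0 : forall h, 0 < r h.
Hypothesis r_summable : (\esum_(h in [set: freq]) ((r h)^-1)%:E < +oo)%E.

Definition total (a : freq -> R) : R :=
  sup [set \sum_(h <- s) a h | s in [set s : seq freq | uniq s]].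

Lemma sum_cap_le (a : freq -> R) (s s1 : seq freq) : (forall h, 0 <= a h) ->
  uniq s -> uniq s1 -> \sum_(h <- s | h \in s1) a h <= \sum_(h <- s1) a h.
Proof.
move=> a0 us us1.
have -> : \sum_(h <- s | h \in s1) a h = \sum_(h <- s1 | h \in s) a h.
  rewrite -big_filter -[RHS]big_filter; apply: perm_big; apply: uniq_perm; rewrite ?filter_uniq//.
  by move=> h; rewrite !mem_filter andbC.
by rewrite [leRHS](bigID [pred h | h \in s])/= lerDl sumr_ge0.
Qed.

Lemma total_approx (a : freq -> R) (s1 : seq freq) (b : R) : (forall h, 0 <= a h) -> uniq s1 ->
  (forall s, uniq s -> \sum_(h <- s | h \notin s1) a h <= b) ->
  \sum_(h <- s1) a h <= total a <= \sum_(h <- s1) a h + b.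
Proof.
move=> a0 us1 H.
have ub : ubound [set \sum_(h <- s) a h | s in [set s : seq freq | uniq s]]
    (\sum_(h <- s1) a h + b).
  move=> _ [s us <-]; rewrite (bigID [pred h | h \in s1])/=.
  by apply: lerD; [exact: sum_cap_le|exact: H].
apply/andP; split.
  apply: sup_upper_bound; last by exists s1.
  by split; [exists (\sum_(h <- s1) a h), s1|exists (\sum_(h <- s1) a h + b)].
by apply: sup_le_ub => //; exists (\sum_(h <- s1) a h), s1.
Qed.

Definition kcoef (y : point) h : C := ((r h)^-1)%:C * (chi h y)^*.

(* The family c is shifted by 1/r to become nonnegative, so that suprema of finite sums give its sum. *)
Definition kernel (y x : point) : C :=
  let c h := kcoef y h * chi h x in
  (total (fun h => (r h)^-1 + complex.Re (c h)) - total (fun h => (r h)^-1)) +i*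
  (total (fun h => (r h)^-1 + complex.Im (c h)) - total (fun h => (r h)^-1)).

Lemma normc_kcoef y h : normc (kcoef y h) = (r h)^-1.
Proof.
rewrite normcM normcJ normc_chi mulr1 normc_real ger0_norm// invr_ge0.
exact: (ltW (r_gt0 h)).
Qed.

(** The shifted terms lie between 0 and 2 / r(h), so the real and the imaginary part are each off by
    at most 2 b. *)
Lemma kernel_approx y x (s1 : seq freq) (b : R) : uniq s1 ->
  (forall s, uniq s -> \sum_(h <- s | h \notin s1) (r h)^-1 <= b) ->
  normc (kernel y x - \sum_(h <- s1) kcoef y h * chi h x) <= 4 * b.
Proof.
move=> us1 H; set c := fun h => kcoef y h * chi h x.
have rV0 h : 0 <= (r h)^-1 by rewrite invr_ge0 ltW.
have cr h : normc (c h) = (r h)^-1 by rewrite /c normcM normc_kcoef normc_chi mulr1.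
have key (u : freq -> R) : (forall h, `|u h| <= (r h)^-1) ->
    `|total (fun h => (r h)^-1 + u h) - total (fun h => (r h)^-1) - \sum_(h <- s1) u h| <= 2 * b.
  move=> uH.
  have a0 h : 0 <= (r h)^-1 + u h by have := uH h; rewrite ler_norml => /andP[? _]; lra.
  have H2 s : uniq s -> \sum_(h <- s | h \notin s1) ((r h)^-1 + u h) <= 2 * b.
    move=> us; apply: (@le_trans _ _ (2 * \sum_(h <- s | h \notin s1) (r h)^-1)); last first.
      by apply: ler_wpM2l => //; exact: H.
    rewrite mulr_sumr; apply: ler_sum => h _.
    by have := uH h; rewrite ler_norml => /andP[_ ?]; lra.
  have /andP[t1 t2] := total_approx a0 us1 H2.
  have /andP[t3 t4] := total_approx rV0 us1 H.
  have b0 : 0 <= b by have := H [::] isT; rewrite big_nil.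
  rewrite big_split /= in t1 t2.
  by rewrite ler_norml; apply/andP; split; lra.
apply: le_trans (normc_le_ReIm _) _.
have -> : 4 * b = 2 * b + 2 * b by ring.
have ReS : complex.Re (\sum_(h <- s1) c h) = \sum_(h <- s1) complex.Re (c h).
  by elim/big_rec2: _ => // h u v _ <-; rewrite ReD.
have ImS : complex.Im (\sum_(h <- s1) c h) = \sum_(h <- s1) complex.Im (c h).
  by elim/big_rec2: _ => // h u v _ <-; rewrite ImD.
apply: lerD.
  have := key (fun h => complex.Re (c h)); rewrite -ReS => k1.
  have -> : complex.Re (kernel y x - \sum_(h <- s1) c h) =
      complex.Re (kernel y x) - complex.Re (\sum_(h <- s1) c h).
    by case: (\sum_(h <- s1) c h).
  by apply: k1 => h; rewrite -cr; exact: Re_le_normc.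
have := key (fun h => complex.Im (c h)); rewrite -ImS => k1.
have -> : complex.Im (kernel y x - \sum_(h <- s1) c h) =
    complex.Im (kernel y x) - complex.Im (\sum_(h <- s1) c h).
  by case: (\sum_(h <- s1) c h).
by apply: k1 => h; rewrite -cr; exact: Im_le_normc.
Qed.

Lemma periodic_kernel y : Defs.periodic (kernel y).
Proof.
move=> x k; rewrite /kernel.
have E h : chi h [tuple tnth x i + (tnth k i)%:~R | i < d] = chi h x :> C.
  exact: periodic_chi.
by congr (_ +i* _); congr (_ - _); congr (sup _); apply/seteqP; split => _ [s us <-];
  exists s => //; apply: eq_bigr => h _; rewrite E.
Qed.

Lemma continuous_kernel y : continuousC (kernel y).
Proof.
apply/continuousCP => x e e0.
have e1 : 0 < e / 16 by rewrite divr_gt0.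
have [s1 [us1 _ H]] := small_tail r_gt0 r_summable e1 (isT : uniq [::]).
have cp : continuousC (fun x : point => \sum_(h <- s1) kcoef y h * chi h x).
  by apply: continuousC_sum => h; apply: continuousCZ; exact: continuousC_chi.
have e2 : 0 < e / 2 by rewrite divr_gt0.
have [delta dl0 Hd] := (continuousCP _).1 cp x _ e2.
exists delta => // z xz; have := Hd z xz.
have := kernel_approx y x us1 H; have := kernel_approx y z us1 H.
set p := fun x : point => \sum_(h <- s1) kcoef y h * chi h x.
rewrite -/(p x) -/(p z) => kz kx pxz.
have -> : kernel y z - kernel y x = (kernel y z - p z) + (p z - p x) - (kernel y x - p x) by ring.
have := normcD (kernel y z - p z + (p z - p x)) (- (kernel y x - p x)).
have := normcD (kernel y z - p z) (p z - p x); rewrite normcN.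
move: kz kx pxz; move: (normc _) (normc _) (normc _) (normc _) (normc _) => *.
by lra.
Qed.

Lemma cbmeas_kernel y : cbmeas (kernel y).
Proof. by apply: cbmeas_periodic; [exact: periodic_kernel|exact: continuous_kernel]. Qed.

(** The kernel is a uniform limit of finite sums containing the frequency h, all of which have this
    coefficient. *)
Lemma fourier_kernel y h : fourier (kernel y) h = kcoef y h.
Proof.
apply/eqP; rewrite -subr_eq0 -normc_eq0 eq_le normc_ge0 andbT.
apply/ler_addgt0Pr => e e0; rewrite add0r.
have e1 : 0 < e / 4 by rewrite divr_gt0.
have [s1 [us1 hs1 H]] := small_tail r_gt0 r_summable e1 (isT : uniq [:: h]).
pose p := fun x : point => \sum_(k <- s1) kcoef y k * chi k x.
have bp : cbmeas p by apply: cbmeas_sum => k; apply: cbmeasZ; exact: cbmeas_chi.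
have -> : kcoef y h = fourier p h by rewrite fourier_trig// hs1 ?mem_head.
rewrite -fourierB//; last exact: cbmeas_kernel.
rewrite -[leRHS](expect_cst (cube d)); apply: normc_fourier_le.
- by apply: cbmeasB => //; exact: cbmeas_kernel.
- exact: bmeas_cst.
- by move=> x; apply: le_trans (kernel_approx y x us1 H) _; lra.
Qed.

End Kernel.

Section Spline.
Local Open Scope classical_set_scope.
Local Open Scope ring_scope.
Local Open Scope complex_scope.
Context {R : realType} {d : nat}.
Local Notation C := R[i].
Local Notation point := (d.-tuple R).
Local Notation freq := (d.-tuple int).
Local Notation func := (point -> R[i]).
Local Notation normc := Normc.normc.
Hypothesis d0 : (0 < d)%N.
Variable r : freq -> R.
Hypothesis r_gt0 : forall h, 0 < r h.
Hypothesis r_summable : (\esum_(h in [set: freq]) ((r h)^-1)%:E < +oo)%E.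
Variables (k : nat) (X : 'I_k -> point).

Local Notation kern := (kernel r).

Definition gram_kernel : 'M[C]_k := \matrix_(i, j) kern (X i) (X j).
Definition samples (f : func) : 'rV[C]_k := \row_j f (X j).
(** The points X_i may coincide, so the Gram matrix may be singular and a pseudo-inverse is used;
    the coefficients still depend linearly on the samples. *)
Definition spline_coef (f : func) : 'rV[C]_k := samples f *m pinvmx gram_kernel.
Definition spline (f : func) : func := fun x => \sum_i spline_coef f 0 i * kern (X i) x.

Lemma simultaneous_approx (e : R) (s : seq freq) : 0 < e -> uniq s ->
  exists s1 : seq freq, [/\ uniq s1, {subset s <= s1},
    forall i j, normc (kern (X i) (X j) - \sum_(h <- s1) kcoef r (X i) h * chi h (X j)) <= e &
    forall f, Hspace r f -> (forall s, uniq s -> energy r f s <= 1) ->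
      forall j, normc (f (X j) - \sum_(h <- s1) fourier f h * chi h (X j)) <= e].
Proof.
(* The kernel error is 4 b, whereas the error for functions of the ball is the square root of the
   tail: hence e / 4 and e^2. *)
move=> e0 us; pose b := Num.min (e / 4) (e ^+ 2).
have b0 : 0 < b by rewrite lt_min divr_gt0//= exprn_gt0.
have [s1 [us1 ss1 H]] := small_tail r_gt0 r_summable b0 us.
exists s1; split => // [i j|f Hf ef j].
  apply: le_trans (kernel_approx r_gt0 _ _ us1 H) _.
  by have : b <= e / 4; [rewrite ge_min lexx|lra].
rewrite -[leRHS]mulr1; apply: (fourier_truncation r_gt0) => //; first exact: ltW.
  by move=> t ut; rewrite expr1n ef.
by move=> t ut; apply: le_trans (H t ut) _; rewrite ge_min lexx orbT.
Qed.

Lemma normc_sum_mul_le n (a b : 'I_n -> C) (e : R) : (forall i, normc (b i) <= e) ->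
  normc (\sum_i a i * b i) <= (\sum_i normc (a i)) * e.
Proof.
move=> be; rewrite mulr_suml (le_trans (normc_sum _ _ _))//; apply: ler_sum => i _.
by rewrite normcM ler_wpM2l ?normc_ge0.
Qed.

(* Finite sums of the reproducing identity <f, sum_i c_i K_(X i)> = sum_i conj(c_i) f (X i). *)
Definition dual_coef (c : 'I_k -> C) h : C := \sum_i c i * (chi h (X i))^*.

Lemma sum_fourier_dual f c (s1 : seq freq) :
  \sum_(h <- s1) fourier f h * (dual_coef c h)^* =
  \sum_i (c i)^* * \sum_(h <- s1) fourier f h * chi h (X i).
Proof.
under [RHS]eq_bigr do rewrite mulr_sumr.
rewrite exchange_big /=; apply: eq_bigr => h _.
rewrite /dual_coef rmorph_sum mulr_sumr; apply: eq_bigr => i _.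
  by rewrite rmorphM /= conjCK mulrCA.
Qed.

(** Finite version of the identity between the squared norm of sum_i c_i K_(X i) and its quadratic
    form in the kernel values. *)
Lemma sum_dual_dual c (s1 : seq freq) :
  (\sum_(h <- s1) (r h)^-1 * normc (dual_coef c h) ^+ 2)%:C =
  \sum_j (c j)^* * \sum_i c i * \sum_(h <- s1) kcoef r (X i) h * chi h (X j).
Proof.
transitivity (\sum_(h <- s1) (((r h)^-1)%:C * dual_coef c h) * (dual_coef c h)^*).
  by rewrite rmorph_sum /=; apply: eq_bigr => h _; rewrite rmorphM /= sqr_normcE mulrA.
under [RHS]eq_bigr do under eq_bigr do rewrite mulr_sumr.
under [RHS]eq_bigr do rewrite exchange_big /= mulr_sumr.
rewrite [RHS]exchange_big /=; apply: eq_bigr => h _.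
rewrite {2}/dual_coef rmorph_sum mulr_sumr; apply: eq_bigr => j _.
rewrite rmorphM /= conjCK [RHS]mulrC mulrCA [RHS]mulrC; congr (_ * _).
rewrite /dual_coef mulr_sumr mulr_suml; apply: eq_bigr => i _.
by rewrite /kcoef; ring.
Qed.

Lemma le0_of_le_scale (a b : R) : 0 <= b -> (forall e, 0 < e -> a <= b * e) -> a <= 0.
Proof.
move=> b0 H; apply/ler_addgt0Pr => e e0; rewrite add0r.
have b1 : 0 < b + 1 by rewrite ltr_wpDl.
apply: le_trans (H (e / (b + 1)) (divr_gt0 e0 b1)) _.
by rewrite mulrA ler_pdivrMr// mulrC ler_pM2l// lerDl.
Qed.

(** For z in the kernel of the Gram matrix, the combination of the K_(X i) with coefficients conj
    z_i has norm 0, so its inner product with f, the conjugate of [samples f *m z] up to the order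
    of the arguments, vanishes by Cauchy-Schwarz. On finite lists this holds up to an arbitrarily
    small error. *)
Lemma gram_kernel_null f (z : 'cV[C]_k) : Hspace r f -> (forall s, uniq s -> energy r f s <= 1) ->
  gram_kernel *m z = 0 -> samples f *m z = 0.
Proof.
move=> Hf ef Gz; apply/matrixP => i0 j0; rewrite !ord1 [RHS]mxE.
apply/eqP; rewrite -normc_eq0 eq_le normc_ge0 andbT.
set v := (_ *m _) 0 0.
pose c i := (z i 0)^*.
pose S := \sum_i normc (c i).
have S0 : 0 <= S by apply: sumr_ge0 => i _; exact: normc_ge0.
have dual0 (e : R) : 0 < e -> exists s1 : seq freq, [/\ uniq s1,
    normc (v - \sum_(h <- s1) fourier f h * (dual_coef c h)^*) <= S * e &
    \sum_(h <- s1) (r h)^-1 * normc (dual_coef c h) ^+ 2 <= S * (S * e)].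
  move=> e0; have [s1 [us1 _ aK af]] := simultaneous_approx e0 (isT : uniq [::]).
  exists s1; split => //.
    rewrite sum_fourier_dual /v mxE.
    have -> : \sum_j samples f 0 j * z j 0 - \sum_i (c i)^* * \sum_(h <- s1) fourier f h * chi h (X i) =
        \sum_i (c i)^* * (f (X i) - \sum_(h <- s1) fourier f h * chi h (X i)).
      rewrite -sumrB; apply: eq_bigr => i _; rewrite mxE /c conjCK mulrBr.
      by rewrite [f _ * _]mulrC.
    apply: le_trans (normc_sum_mul_le _ (af f Hf ef)) _.
    by rewrite /S; under eq_bigr do rewrite normcJ.
  have G0 : \sum_j (c j)^* * \sum_i c i * kern (X i) (X j) = 0.
    under eq_bigr do rewrite mulr_sumr.
    rewrite exchange_big big1//= => i _.
    under eq_bigr do rewrite mulrCA.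
    rewrite -mulr_sumr; have /matrixP/(_ i 0) := Gz; rewrite !mxE => Gzi.
    rewrite (_ : \sum_j _ = 0) ?mulr0// -[RHS]Gzi; apply: eq_bigr => j _.
    by rewrite mxE /c conjCK mulrC.
  rewrite -[leLHS]ger0_norm -?normc_real; last first.
    by apply: sumr_ge0 => h _; rewrite mulr_ge0 ?exprn_ge0 ?normc_ge0// invr_ge0 ltW.
  rewrite sum_dual_dual -[X in normc X]subr0 -[X in normc (_ - X)]G0 -sumrB.
  under eq_bigr do rewrite -mulrBr -sumrB.
  apply: le_trans (normc_sum_mul_le (e := S * e) _ _) _ => [j|]; last first.
    by rewrite /S; under eq_bigr do rewrite normcJ.
  under eq_bigr do rewrite -mulrBr.
  by apply: normc_sum_mul_le => i; rewrite -opprB normcN.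
have key (e : R) : 0 < e -> normc v <= (S + S + 0) * e.
  (* The dual norm enters squared: accuracy e^2 there gives e after the square root, and accuracy e
     suffices for the samples. *)
  move=> e0; have ee0 : 0 < Num.min e (e ^+ 2) by rewrite lt_min e0 exprn_gt0.
  have [s1 [us1 H1 H2]] := dual0 _ ee0.
  set u := \sum_(h <- s1) fourier f h * _ in H1.
  have H1' : normc (v - u) <= S * e.
    by apply: le_trans H1 _; rewrite ler_wpM2l// ge_min lexx.
  have H2' : normc u <= S * e.
    rewrite -ler_sqr ?nnegrE ?normc_ge0 ?mulr_ge0 ?(ltW e0)//.
    have -> : u = \sum_(h <- s1) ((Num.sqrt (r h))%:C * fourier f h) *
        ((Num.sqrt (r h)^-1)%:C * (dual_coef c h)^*).
      apply: eq_bigr => h _; rewrite mulrACA -rmorphM /= -sqrtrM; last exact: ltW.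
      by rewrite mulfV ?gt_eqF// sqrtr1 mul1r.
    apply: le_trans (normc_cauchy_schwarz _ _ _ _) _.
    apply: (@le_trans _ _ (1 * (S * (S * e ^+ 2)))); last by rewrite mul1r exprMn expr2 mulrA.
    apply: ler_pM.
    - by apply: sumr_ge0 => h _; rewrite exprn_ge0 ?normc_ge0.
    - by apply: sumr_ge0 => h _; rewrite exprn_ge0 ?normc_ge0.
    - apply: le_trans (ef _ us1); apply: ler_sum => h _.
      rewrite normcM normc_real exprMn real_normK ?num_real// [X in X * _]sqr_sqrtr//.
      exact: ltW.
    - apply: le_trans (_ : S * (S * Num.min e (e ^+ 2)) <= _); last first.
        by rewrite !ler_wpM2l// ge_min lexx orbT.
      apply: le_trans H2; apply: ler_sum => h _.
      rewrite normcM normcJ normc_real exprMn real_normK ?num_real// [X in X * _]sqr_sqrtr//.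
      by rewrite invr_ge0 ltW.
  by have := normcD (v - u) u; rewrite subrK; lra.
by apply: le0_of_le_scale key; rewrite !addr_ge0.
Qed.

(** By [gram_kernel_null] the samples are annihilated by the cokernel of the Gram matrix, so they
    lie in its row space, where the pseudo-inverse solves the system exactly. *)
Lemma spline_interpolates f j : Hspace r f -> (forall s, uniq s -> energy r f s <= 1) ->
  spline f (X j) = f (X j).
Proof.
move=> Hf ef.
have sub : (samples f <= gram_kernel)%MS.
  rewrite submxE; apply/eqP/matrixP => i0 l; rewrite !ord1 [RHS]mxE.
  have Gz : gram_kernel *m col l (cokermx gram_kernel) = 0.
    by rewrite colE mulmxA mulmx_coker mul0mx.
  have /matrixP/(_ 0 0) := gram_kernel_null Hf ef Gz.
  by rewrite colE mulmxA -colE mxE [RHS]mxE.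
have /matrixP/(_ 0 j) := mulmxKpV sub; rewrite [RHS]mxE => <-.
rewrite [RHS]mxE; apply: eq_bigr => i _; congr (_ * _).
by rewrite mxE.
Qed.

End Spline.

Section SplineOptimality.
Local Open Scope classical_set_scope.
Local Open Scope ring_scope.
Local Open Scope complex_scope.
Context {R : realType} {d : nat}.
Local Notation C := R[i].
Local Notation point := (d.-tuple R).
Local Notation freq := (d.-tuple int).
Local Notation func := (point -> R[i]).
Local Notation normc := Normc.normc.
Hypothesis d0 : (0 < d)%N.
Variable r : freq -> R.
Hypothesis r_gt0 : forall h, 0 < r h.
Hypothesis r_summable : (\esum_(h in [set: freq]) ((r h)^-1)%:E < +oo)%E.

Section Points.
Variables (k : nat) (X : 'I_k -> point).
Local Notation kern := (kernel r).

Lemma cbmeas_spline f : cbmeas (spline r X f).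
Proof. by apply: cbmeas_sum => i; apply: cbmeasZ; exact: cbmeas_kernel. Qed.

Lemma fourier_spline f h :
  fourier (spline r X f) h = ((r h)^-1)%:C * dual_coef X (spline_coef r X f 0) h.
Proof.
rewrite /spline fourier_sum => [|i]; last by apply: cbmeasZ; exact: cbmeas_kernel.
rewrite /dual_coef mulr_sumr; apply: eq_bigr => i _.
by rewrite fourierZ ?fourier_kernel//; [rewrite /kcoef mulrCA|exact: cbmeas_kernel].
Qed.

(** Pythagoras: since P f interpolates f, both <f, P f> and |P f|^2 equal the value [al], whence |f
    - P f|^2 = |f|^2 - |P f|^2. On a finite list p and q are only close to [al], with total defect
    at most (2 S + 2 S^2) e. *)
Lemma spline_residual_energy f (s : seq freq) :
  Hspace r f -> (forall s, uniq s -> energy r f s <= 1) -> uniq s ->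
  energy r (fun x => f x - spline r X f x) s <= 1.
Proof.
move=> Hf ef us; have bf := cbmeas_Hspace Hf.
set g : func := fun x => _; set c := spline_coef r X f 0.
pose S := \sum_i normc (c i).
have S0 : 0 <= S by apply: sumr_ge0 => i _; exact: normc_ge0.
have rg0 h : 0 <= r h * normc (fourier g h) ^+ 2.
  by apply: mulr_ge0; [exact: ltW|rewrite exprn_ge0// normc_ge0].
rewrite -subr_le0; apply: (@le0_of_le_scale R _ (2 * S + 2 * (S * S))) => [|e e0].
  by rewrite addr_ge0// mulr_ge0// mulr_ge0.
have [s1 [us1 ss1 aK af]] := simultaneous_approx d0 r_gt0 r_summable X e0 us.
have mono : energy r g s <= energy r g s1.
  apply: le_trans (sum_cap_le rg0 us us1).
  rewrite /energy [leRHS]big_mkcond big_seq [leRHS]big_seq.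
  by apply: ler_sum => h /ss1 ->.
pose p := complex.Re (\sum_(h <- s1) fourier f h * (dual_coef X c h)^*).
pose q := \sum_(h <- s1) (r h)^-1 * normc (dual_coef X c h) ^+ 2.
pose al := complex.Re (\sum_i (c i)^* * f (X i)).
have q0 : 0 <= q.
  by apply: sumr_ge0 => h _; rewrite mulr_ge0 ?invr_ge0 ?exprn_ge0 ?normc_ge0// ltW.
have gE : energy r g s1 = energy r f s1 - 2 * p + q.
  rewrite /energy /p /q.
  have -> : complex.Re (\sum_(h <- s1) fourier f h * (dual_coef X c h)^*) =
      \sum_(h <- s1) complex.Re (fourier f h * (dual_coef X c h)^*).
    by elim/big_rec2: _ => // h u v _ <-; rewrite ReD.
  rewrite mulr_sumr -sumrB -big_split /=; apply: eq_bigr => h _.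
  rewrite /g fourierB ?fourier_spline//; last exact: cbmeas_spline.
  move: (fourier f h) (dual_coef X c h) => [u1 u2] [w1 w2].
  by rewrite !sqr_normc /=; field; rewrite gt_eqF.
have pal : `|p - al| <= S * e.
  have -> : p - al = complex.Re (\sum_(h <- s1) fourier f h * (dual_coef X c h)^* -
      \sum_i (c i)^* * f (X i)).
    by rewrite /p /al; case: (\sum_(h <- s1) _) (\sum_i _) => [? ?] [? ?].
  apply: le_trans (Re_le_normc _) _; rewrite sum_fourier_dual -sumrB.
  under eq_bigr do rewrite -mulrBr.
  apply: le_trans (normc_sum_mul_le (e := e) _ _) _ => [i|].
    by rewrite -opprB normcN; exact: af.
  by rewrite /S; under eq_bigr do rewrite normcJ.
have qal : `|q - al| <= S * (S * e).
  have -> : q - al = complex.Re (q%:C - \sum_i (c i)^* * f (X i)).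
    by rewrite /al; case: (\sum_i _).
  apply: le_trans (Re_le_normc _) _; rewrite sum_dual_dual -sumrB.
  under eq_bigr do rewrite -mulrBr.
  apply: le_trans (normc_sum_mul_le (e := S * e) _ _) _ => [j|].
    rewrite -(spline_interpolates d0 r_gt0 r_summable X j Hf ef) /spline -/c -sumrB.
    under eq_bigr do rewrite -mulrBr.
    by apply: normc_sum_mul_le => i; rewrite -opprB normcN.
  by rewrite /S; under eq_bigr do rewrite normcJ.
have := ef s1 us1; move: mono; rewrite gE.
have -> : (2 * S + 2 * (S * S)) * e = 2 * (S * e) + 2 * (S * (S * e)) by ring.
move: pal qal; rewrite !ler_norml => /andP[? ?] /andP[? ?] ? ?; lra.
Qed.

Lemma spline_lin (a : C) (f g : func) x :
  spline r X (fun y => a * f y + g y) x = a * spline r X f x + spline r X g x.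
Proof.
rewrite /spline mulr_sumr -big_split /=; apply: eq_bigr => i _.
have -> : spline_coef r X (fun y => a * f y + g y) 0 i =
    a * spline_coef r X f 0 i + spline_coef r X g 0 i.
  rewrite /spline_coef !mxE mulr_sumr -big_split /=; apply: eq_bigr => j _.
  by rewrite !mxE mulrDl mulrA.
by rewrite mulrDl mulrA.
Qed.

Lemma bounded_linear_spline : bounded_linear r (spline r X).
Proof.
split.
- by move=> f _; apply: Linf_cbmeas; exact: cbmeas_spline.
- by move=> a f g _ _; apply: aeW => x; exact: spline_lin.
pose T := fine (\esum_(h in [set: freq]) ((r h)^-1)%:E).
have T0 : 0 <= T by apply: fine_ge0; apply: esum_ge0 => h _; rewrite lee_fin invr_ge0 ltW.
have [L HL] : exists L : 'I_k -> R, forall i x, normc (kern (X i) x) <= L i.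
  have bk i : exists L, forall x, normc (kern (X i) x) <= L.
    by apply: cbmeas_bound; exact: cbmeas_kernel.
  by have [L HL] := boolp.choice bk; exists L.
pose P := pinvmx (gram_kernel r X).
exists (\sum_i (\sum_j normc (P j i) * Num.sqrt T) * L i) => f Hf.
have [_ _ /(Hnorm_ltyP r_gt0) [c1 c10 _]] := Hf.
have H0 : (0 <= Hnorm r f)%E by exact: poweR_ge0.
have Hfin : (Hnorm r f \is a fin_num)%E by rewrite ge0_fin_numE//; case: Hf.
pose c := fine (Hnorm r f); have c0 : 0 <= c by exact: fine_ge0.
have cE : Hnorm r f = c%:E by rewrite fineK.
have ec : forall s, uniq s -> energy r f s <= c ^+ 2.
  by apply/(Hnorm_leP r_gt0 _ c0); rewrite cE.
have fb x : normc (f x) <= Num.sqrt T * c.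
  have := fourier_truncation r_gt0 x d0 Hf c0 (sqrtr_ge0 T) ec (isT : uniq [::]).
  rewrite big_nil subr0; apply => s us; rewrite sqr_sqrtr//.
  by apply: sum_inv_weights_le.
rewrite cE -EFinM; apply/Linf_normP; apply: aeW => x.
apply: le_trans (normc_sum _ _ _) _; rewrite mulr_suml; apply: ler_sum => i _.
rewrite normcM mulrAC; apply: ler_pM; rewrite ?normc_ge0//.
rewrite mxE mulr_suml (le_trans (normc_sum _ _ _))//; apply: ler_sum => j _.
by rewrite normcM mulrC -mulrA ler_wpM2l ?normc_ge0// mxE.
Qed.

Lemma rank_lt_spline : rank_lt r (spline r X) k.+1%:R.
Proof.
exists k, (fun i => kern (X i)); split.
- by rewrite ltr_nat.
- by move=> j; apply: Linf_cbmeas; exact: cbmeas_kernel.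
- by move=> f _; exists (spline_coef r X f 0); apply: aeW.
Qed.

Lemma Hspace_spline_residual f : Hball r f -> Hball r (fun x => f x - spline r X f x).
Proof.
move=> /(HballP r_gt0)[Hf ef]; apply/(HballP r_gt0).
have en s : uniq s -> energy r (fun x => f x - spline r X f x) s <= 1.
  exact: spline_residual_energy.
split; last exact: en.
have [pf cf _] := Hf; split.
- move=> x h; rewrite pf; congr (_ - _); apply: eq_bigr => i _.
  by rewrite periodic_kernel.
- have -> : (fun x => f x - spline r X f x) = fun x => f x + -1 * spline r X f x.
    by apply/funext => x; rewrite mulN1r.
  apply: continuousCD => //; apply: continuousCZ; apply: continuousC_sum => i.
  by apply: continuousCZ; exact: continuous_kernel.
- by apply/(Hnorm_ltyP r_gt0); exists 1 => // s us; rewrite expr1n en.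
Qed.

End Points.

Lemma Linf_norm_half (g b : func) (w : \bar R) :
  (Linf_norm (fun x => (g x - b x)%R) <= w)%E ->
  (Linf_norm (fun x => (- g x - b x)%R) <= w)%E -> (Linf_norm g <= w)%E.
Proof.
case: w => [w| |]; [|by move=> *; rewrite leey|].
- move=> /Linf_normP H1 /Linf_normP H2; apply/Linf_normP.
  apply: (filterS2 _ _ H1 H2) => x h1 h2.
  have : normc (2%:C * g x) <= w + w.
    have -> : 2%:C * g x = (g x - b x) + - (- g x - b x) by rewrite -[2]/(1 + 1) rmorphD /=; ring.
    by rewrite (le_trans (normcD _ _))// normcN lerD.
  by rewrite normcM normc_real ger0_norm//; lra.
have L0 (u : func) : (0 <= Linf_norm u)%E.
  by apply: Lnorm_ge0.
by move=> H; have := le_trans (L0 _) H.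
Qed.

Lemma approx_le_sampling (M : nat) :
  (approx_number r embedding M.+1%:R <= sampling_number r M)%E.
Proof.
apply: le_ereal_inf_tmp => _ [X [XM XT] <-].
apply: le_ereal_inf_tmp => _ [A LA <-].
pose k := #|` X|; pose pt (i : 'I_k) : point := nth [tuple 0 | i < d] X i.
have ptX i : pt i \in X by rewrite /pt mem_nth.
have Xpt x : x \in X -> exists i, pt i = x.
  move=> xX; have xk : (index x X < k)%N by rewrite index_mem.
  by exists (Ordinal xk); rewrite /pt /= nth_index.
apply: (@le_trans _ _ (op_norm r (fun f x => (embedding f x - spline r pt f x)%R))).
  apply: ereal_inf_lbound; exists (spline r pt) => //; split; first exact: bounded_linear_spline.
  (* The spline has rank at most |X| <= M, hence less than M + 1. *)
  have [m [g [mk Lg rg]]] := rank_lt_spline pt.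
  by exists m, g; split => //; rewrite (lt_le_trans mk)// ler_nat ltnS.
apply: ge_ereal_sup => _ [f Bf <-].
have [Hf ef] := (HballP r_gt0 f).1 Bf.
have Bg := Hspace_spline_residual pt Bf.
rewrite /embedding; set g : func := fun x => f x - spline r pt f x.
have g0 x : x \in X -> g x = 0.
  by move=> /Xpt[i <-]; rewrite /g spline_interpolates// subrr.
have BNg : Hball r (fun x => - g x).
  have [Hg eg] := (HballP r_gt0 g).1 Bg; apply/(HballP r_gt0).
  have Z0 : Hspace r (fun _ : point => 0 : C).
    by have := Hspace_trig r_gt0 [::] (fun=> 0); congr Hspace; apply/funext => x; rewrite big_nil.
  have gE : (fun x => - g x) = fun x => -1 * g x + 0.
    by apply/funext => x; rewrite mulN1r addr0.
  split; first by rewrite gE; exact: Hspace_lin.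
  move=> s us; apply: le_trans (eg s us).
  have bg := cbmeas_Hspace Hg.
  rewrite /energy; apply: ler_sum => h _.
  have -> : fourier (fun x => - g x) h = - fourier g h.
    by rewrite -mulN1r -fourierZ//; congr (fourier _ h); apply/funext => x; rewrite mulN1r.
  by rewrite normcN.
(* The zero data are all that A sees of both g and its negative. *)
pose y0 : {ffun X -> C} := [ffun _ => 0].
have sup_le u : Hball r u -> (forall x, x \in X -> u x = 0) ->
    (Linf_norm (fun x => (u x - A y0 x)%R) <= worst_case_error r A)%E.
  move=> Bu u0; apply: ereal_sup_ubound; exists u => //.
  congr Linf_norm; apply/funext => x; congr (_ - A _ x).
  by apply/ffunP => z; rewrite !ffunE u0// fsvalP.
apply: (Linf_norm_half (b := A y0)); first exact: sup_le.
by apply: (sup_le (fun x => - g x)) => // x xX; rewrite g0 ?oppr0.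
Qed.

End SplineOptimality.

(** * Comparison *)

Section TailBounds.
Local Open Scope classical_set_scope.
Local Open Scope ring_scope.
Local Open Scope complex_scope.
Context {R : realType} {d : nat}.
Local Notation C := R[i].
Local Notation point := (d.-tuple R).
Local Notation freq := (d.-tuple int).
Local Notation func := (point -> R[i]).
Local Notation normc := Normc.normc.
Hypothesis d0 : (0 < d)%N.
Variable r : freq -> R.
Hypothesis r_gt0 : forall h, 0 < r h.
Hypothesis r_summable : (\esum_(h in [set: freq]) ((r h)^-1)%:E < +oo)%E.

Lemma smallest_weights_seq n (J : set freq) : smallest_weights r n J ->
  exists s, [/\ uniq s, size s = n.-1 &
    forall k h, k \in s -> h \notin s -> r k <= r h].
Proof.
move=> [Jn Jr]; have fJ : finite_set J by apply/finite_setP; exists n.-1.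
exists (fset_set J); split; first exact: fset_uniq.
  exact: card_fset_set.
move=> k h; rewrite !in_fset_set// => kJ hJ; apply: Jr; first by rewrite inE in kJ.
by rewrite notin_setE in hJ.
Qed.

(** For d > 0 there is always a frequency outside a finite list. Positivity of tau_m allows finitely
    many bounds to be expressed as multiples of it. *)
Lemma tail2_gt0 (s : seq freq) : 0 < tail2 r s.
Proof.
have [q Hq] := freq_bound s.
pose h : freq := [tuple q.+1%:Z | i < d].
have hs : h \notin s.
  apply/negP => /Hq /(_ (Ordinal d0)); rewrite tnth_mktuple.
  by rewrite absz_nat ltnn.
have := @le_tail2 _ _ _ r_gt0 r_summable s [:: h] isT.
by rewrite big_cons big_nil hs addr0; apply: lt_le_trans; rewrite invr_gt0.
Qed.

Lemma Linf_norm_ge0 (g : func) : (0 <= Linf_norm g)%E.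
Proof. exact: Lnorm_ge0. Qed.

Lemma approx_ge_tail (s : seq freq) (t : R) : uniq s ->
  (forall k h, k \in s -> h \notin s -> r k <= r h) -> t <= (size s).+1%:R ->
  ((Num.sqrt (tail2 r s))%:E <= approx_number r embedding t)%E.
Proof.
move=> us sr ts; apply: le_ereal_inf_tmp => _ [A [bA rA] <-].
have op0 : (0 <= op_norm r (fun f x => (embedding f x - A f x)%R))%E.
  (* The empty combination lies in the unit ball, so the supremum defining the operator norm runs
     over a nonempty set and cannot be -oo. *)
  pose e (j : 'I_0) : freq := freq0.
  have ei : injective e by case.
  have := Hball_trig r_gt0 (a := fun=> 0) ei; rewrite big_ord0 => /(_ ler01) B0.
  by apply: le_trans (Linf_norm_ge0 _) _; apply: ereal_sup_ubound; eexists; [exact: B0|].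
case opE : (op_norm _ _) op0 => [B| |//]; last by move=> _; rewrite leey.
- rewrite lee_fin => B0.
rewrite lee_fin -[leRHS]ger0_norm// -sqrtr_sqr ler_wsqrtr//.
apply: tail2_le => // s1 us1.
(* Including all of s makes the head I exactly of size |s|, so its complement has n - |s| elements
   as the rank argument requires. *)
pose s2 := undup (s ++ s1); pose n := size s2.
pose e (j : 'I_n) : freq := nth freq0 s2 j.
have us2 : uniq s2 := undup_uniq _.
have ei : injective e.
  by move=> i j /eqP; rewrite nth_uniq// => /eqP ij; exact: val_inj.
have sE : s2 = [seq e j | j <- enum 'I_n].
  apply: (@eq_from_nth _ freq0); first by rewrite size_map size_enum_ord.
  move=> k kn; rewrite (nth_map (Ordinal kn)) ?size_enum_ord//.
  by rewrite /e nth_enum_ord.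
pose I : {pred 'I_n} := [pred j | e j \in s].
have cI : #|I| = size s.
  transitivity (size [seq h <- s2 | h \in s]); last first.
    apply/perm_size/uniq_perm => //; first exact: filter_uniq.
    by move=> h; rewrite mem_filter mem_undup mem_cat; case: (h \in s).
  rewrite -sum1_card -sum1_size big_filter [in RHS]sE big_map big_enum_cond.
  by apply: eq_bigl => j; rewrite !inE.
have cI' : (#|[predC I]| <= n - size s)%N by rewrite -[X in (X - _)%N]card_ord -(cardC I) cI addKn.
apply: le_trans (approx_lower_bound r_gt0 B0 bA rA ts ei cI' _ _) => [|i j|];
  [|by rewrite !inE; exact: sr|by rewrite opE].
have -> : \sum_(j | j \notin I) (r (e j))^-1 = \sum_(h <- s2 | h \notin s) (r h)^-1.
  by rewrite [in RHS]sE big_map big_enum_cond.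
rewrite [leLHS]big_mkcond [leRHS]big_mkcond.
have rg0 h : 0 <= (if h \notin s then (r h)^-1 else 0).
  by case: ifP => // _; rewrite invr_ge0 ltW.
apply: le_trans (sum_cap_le rg0 us1 us2).
rewrite [leLHS]big_seq [leRHS]big_mkcond big_seq /=.
by apply: ler_sum => h hs; rewrite mem_undup mem_cat hs orbT.
Qed.


(** No nodes are used: the ball is bounded in the sup norm by the square root of the sum of 1/r.
    This finite bound serves the small M. *)
Lemma sampling_le_total M : exists2 T, 0 <= T & (sampling_number r M <= T%:E)%E.
Proof.
pose T := fine (\esum_(h in [set: freq]) ((r h)^-1)%:E).
have T0 : 0 <= T by apply: fine_ge0; apply: esum_ge0 => h _; rewrite lee_fin invr_ge0 ltW.
exists (2 * Num.sqrt T); first by rewrite mulr_ge0.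
apply: (@sampling_number_le R d r r_gt0 fset0) => //.
move=> f /(HballP r_gt0)[Hf ef] _ x; rewrite -[leRHS]mulr1.
have en s : uniq s -> energy r f s <= 1 ^+ 2 by rewrite expr1n; exact: ef.
have := fourier_truncation r_gt0 x d0 Hf ler01 (sqrtr_ge0 T) en (isT : uniq [::]).
rewrite big_nil subr0; apply => s us; rewrite sqr_sqrtr//.
by apply: sum_inv_weights_le.
Qed.

Lemma le_half_ln (M : nat) : (1 < M)%N -> 2^-1 <= ln (M%:R : R).
Proof.
move=> M1; apply: (@le_trans _ _ (ln 2)); last first.
  by rewrite ler_ln ?posrE ?ltr0n ?ler_nat// (ltn_trans _ M1).
(* ln (1 + x) <= x at x = -1/2 gives ln 2 >= 1/2. *)
have := @le_ln1Dx R (- 2^-1); have -> : 1 + - 2^-1 = 2^-1 :> R by lra.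
by rewrite lnV ?posrE//; lra.
Qed.

Lemma le2_ln (M : nat) : (16 <= M)%N -> 2 <= ln (M%:R : R).
Proof.
move=> M16; apply: (@le_trans _ _ (ln (2 ^+ 4))); last first.
  rewrite ler_ln ?posrE ?ltr0n//; last exact: leq_trans M16.
  by apply: (@le_trans _ _ 16%:R); rewrite ?ler_nat//; lra.
by rewrite lnXn// -[leRHS]mulr_natl; have := @le_half_ln 2 isT; lra.
Qed.

Lemma sampling_le_approx (J : nat -> set freq) :
  (forall n, (0 < n)%N -> smallest_weights r n (J n)) ->
  exists2 K : R, 0 < K & forall M : nat, (1 < M)%N ->
    (sampling_number r M <=
     K%:E * (approx_number r embedding (M%:R / ln M%:R) * (ln M%:R)%:E))%E.
Proof.
move=> HJ.
have /boolp.choice[sI HI] : forall m, exists s : seq freq, [/\ uniq s, size s = m &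
    forall k h, k \in s -> h \notin s -> r k <= r h].
  by move=> m; exact: smallest_weights_seq (HJ m.+1 isT).
pose tau m : R := Num.sqrt (tail2 r (sI m)).
have tau0 m : 0 < tau m by rewrite sqrtr_gt0 tail2_gt0.
have /boolp.choice[T HT] : forall M, exists T : R, 0 <= T /\ (sampling_number r M <= T%:E)%E.
  by move=> M; have [T] := sampling_le_total M; exists T.
pose c m M : R := T M / tau m.
have c0 m M : 0 <= c m M by rewrite divr_ge0 ?(ltW (tau0 _))//; have [] := HT M.
(* 52 = 2 * 26 with 26 = 2 * 13, and the sums dominate every quotient c m M with M < 16 and m < 33;
   the doubling compensates ln M >= 1/2. *)
pose K : R := 52 + 2 * \sum_(M < 16) \sum_(m < 33) c m M.
have K0 : 0 < K.
  by rewrite ltr_pwDl// mulr_ge0// sumr_ge0// => M _; rewrite sumr_ge0.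
exists K => // M M1; set L := ln (M%:R : R).
have L2 : 2^-1 <= L by exact: le_half_ln.
have L0 : 0 < L by apply: lt_le_trans L2.
pose t : R := M%:R / L; have t0 : 0 <= t by rewrite divr_ge0// ltW.
pose m := Num.truncn t; have /andP[mt tm] := truncn_itv t0.
have [uI mI rI] := HI m.
(* As t < m + 1, an operator of rank less than t has rank at most m, so tau_m bounds a_t from
   below. *)
have tauL : ((tau m * L)%:E <= approx_number r embedding t * L%:E)%E.
  rewrite EFinM lee_wpmul2r ?lee_fin ?(ltW L0)//.
  by apply: approx_ge_tail; rewrite // mI ltW.
suff : (sampling_number r M <= (K * (tau m * L))%:E)%E.
  move/le_trans; apply; rewrite EFinM lee_wpmul2l//.
  by rewrite lee_fin ltW.
have mLM : m%:R * L <= M%:R by rewrite -ler_pdivlMr.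
have Kmono b : 0 <= b -> 2 * b <= K -> b * tau m <= K * (tau m * L).
  move=> b0 bK; rewrite [leRHS]mulrCA [leLHS]mulrC ler_pM2l//.
  by apply: (@le_trans _ _ (2 * b * L)); [nra|rewrite ler_pM2r].
have [M16|M16] := leqP 16 M; last first.
  (* From m ln M <= M and ln M >= 1/2 one gets m <= 2 M, so only finitely many pairs occur. *)
  have m33 : (m < 33)%N.
    rewrite -(ltr_nat R); have : M%:R < 16 :> R by rewrite ltr_nat.
    have : 0 <= m%:R :> R by [].
    by nra.
  have [T0 HTM] := HT M.
  apply: le_trans HTM _; rewrite lee_fin -[leLHS](divfK (lt0r_neq0 (tau0 m))).
  apply: Kmono; first exact: c0.
  rewrite -/(c m M) /K (bigD1 (Ordinal M16))//= (bigD1 (Ordinal m33))//=.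
  have : 0 <= \sum_(i < 33 | i != Ordinal m33) c i M by exact: sumr_ge0.
  have : 0 <= \sum_(i < 16 | i != Ordinal M16) \sum_(m < 33) c m i.
    by apply: sumr_ge0 => i _; exact: sumr_ge0.
  by lra.
have M2 : (m + m <= M)%N.
  rewrite -(ler_nat R) natrD; have := le2_ln M16; rewrite -/L => ?.
  by have : 0 <= m%:R :> R by []; nra.
have m0 : (0 < size (sI m))%N.
  rewrite mI truncn_gt0 ler_pdivlMr// mul1r ltW//.
  by apply: ln_sublinear; rewrite ltr0n (ltn_trans _ M1).
have [X [cX XT HX]] := exists_sampling_nodes r_gt0 r_summable d0 uI m0 (tail2_gt0 _).
apply: le_trans (sampling_number_le r_gt0 (leq_trans cX _) XT HX) _; first by rewrite mI.
rewrite lee_fin [leLHS]mulrA; apply: Kmono; first by lra.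
rewrite /K; have : 0 <= \sum_(M < 16) \sum_(m < 33) c m M.
  by apply: sumr_ge0 => i _; exact: sumr_ge0.
by lra.
Qed.

End TailBounds.

Local Open Scope classical_set_scope.
Local Open Scope ring_scope.
Local Open Scope ereal_scope.

Theorem theorem4p11 (R : realType) (d : nat) (d_gt0 : (0 < d)%N)
    (r : d.-tuple int -> R)
    (r_gt0 : forall h, (0 < r h)%R)
    (r_summable : \esum_(h in [set: d.-tuple int]) ((r h)^-1)%R%:E < +oo)
    (I : nat -> set (d.-tuple int))
    (I_smallest : forall n, (0 < n)%N -> smallest_weights r n (I n))
    (I_box : forall n, (0 < n)%N -> forall k, I n k ->
       forall i : 'I_d, (- n%:Z + 1 <= tnth k i <= n%:Z - 1)%R) :
  (forall M : nat, (0 < M)%N ->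
     approx_number r embedding (M.+1)%:R <= sampling_number r M) /\
  (exists C : R, (0 < C)%R /\
     forall M : nat, (1 < M)%N ->
       sampling_number r M <=
         C%:E * (approx_number r embedding (M%:R / ln M%:R)%R
                 / ((ln M%:R)^-1)%R%:E)).
Proof.
split => [M _|]; first exact: approx_le_sampling.
have [K K0 HK] := sampling_le_approx d_gt0 r_gt0 r_summable I_smallest.
exists K; split => // M M1; apply: le_trans (HK M M1) _.
have L0 : (0 < ln (M%:R : R))%R by rewrite ln_gt0// ltr1n.
(* In the extended reals, dividing by the nonzero 1 / ln M is multiplying by ln M. *)
by rewrite inver invr_eq0 gt_eqF// invrK.
Qed.
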